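(* Let $\bar u$ be an optimal control of $(P_0)$ with optimal state $\bar y$ and adjoint state $\bar\varphi$, and assume $\|\bar y(\cdot,T)-y_\Omega\|_{L^2(0,1)}>0$. Let $\bar t\in(0,T)$ be such that $\bar\varphi(1,\bar t)=\mu$, and let $n$ be the smallest positive integer such that $\frac{d^n}{dt^n}\bar\varphi(1,\bar t)\neq0$. Then there are $\nu_0>0$ and $\tau>0$ with $(\bar t-\tau,\bar t+\tau)\subset(0,T)$ such that: (i) For all $\nu\in(0,\nu_0)$, each of the equations $\varphi_\nu(1,t)-\mu=0$ and $\varphi_\nu(1,t)-\mu+\nu a=0$ has at most $n$ solutions $t$ in $(\bar t-\tau,\bar t+\tau)$, and the equations $\varphi_\nu(1,t)+\mu+\nu b=0$ and $\varphi_\nu(1,t)+\mu=0$ have no solutions in $(\bar t-\tau,\bar t+\tau)$. (ii) There is $c>0$ such that $$|\bar t-t_\nu|\le c\,\nu^{\frac1{2n}},\qquad |\bar t-t_\nu|\le c\left(\|y_{u_\nu}(\cdot,T)-\bar y(\cdot,T)\|_{L^2(0,1)}^{\frac1n}+\nu^{\frac1n}\right)$$ for all $\nu\in(0,\nu_0)$ and all $t_\nu\in(\bar t-\tau,\bar t+\tau)$ solving one of the equations $\varphi_\nu(1,t)-\mu=0$, $\varphi_\nu(1,t)-\mu+\nu a=0$. (iii) If $n$ is odd, which is in particular the case if $\bar t$ is a switching point of $\bar u$, then there is $\nu_1\in(0,\nu_0)$ such that for all $\nu\in(0,\nu_1)$ there exist switching points of $u_\nu$ in $(\bar t-\tau,\bar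 t+\tau)$ that solve one of the equations $\varphi_\nu(1,t)-\mu=0$, $\varphi_\nu(1,t)-\mu+\nu a=0$. Analogous results hold for $\bar t\in(0,T)$ with $\bar\varphi(1,\bar t)=-\mu$: the same statements hold with the pair of equations $\varphi_\nu(1,t)-\mu=0$, $\varphi_\nu(1,t)-\mu+\nu a=0$ and the pair $\varphi_\nu(1,t)+\mu=0$, $\varphi_\nu(1,t)+\mu+\nu b=0$ interchanged.
   Context: Fix $T>0$, $\alpha>0$, $\mu>0$, $a<0<b$ and $y_\Omega\in C[0,1]$; $Q=(0,1)\times(0,T)$. Let $U_{ad}=\{u\in L^2(0,T): a\le u(t)\le b \text{ for a.a. } t\in[0,T]\}$. For $u\in U_{ad}$, $y_u\in C(\bar Q)$ denotes the weak solution of $y_t-y_{xx}=0$ in $Q$, $y_x(0,t)=0$, $y_x(1,t)+\alpha y(1,t)=u(t)$ for $t\in(0,T)$, $y(x,0)=0$; and $\varphi_u\in C(\bar Q)$ denotes the weak solution of the adjoint equation $-\varphi_t-\varphi_{xx}=0$ in $Q$, $\varphi_x(0,t)=0$, $\varphi_x(1,t)+\alpha\varphi(1,t)=0$ for $t\in(0,T)$, $\varphi(x,T)=y_u(x,T)-y_\Omega(x)$. The function $t\mapsto\varphi_u(1,t)$ is real analytic on $(0,T)$. Problem $(P_\nu)$, $\nu\ge0$: minimize $F_\nu(u)=\frac12\int_0^1|y_u(x,T)-y_\Omega(x)|^2\,dx+\frac\nu2\int_0^T|u(t)|^2\,dt+\mu\int_0^T|u(t)|\,dt$ over $u\in U_{ad}$.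 For $\nu>0$ it has a unique solution $u_\nu$; write $\varphi_\nu=\varphi_{u_\nu}$. For $\nu=0$ it has at least one solution $\bar u$; write $\bar y=y_{\bar u}$, $\bar\varphi=\varphi_{\bar u}$. The optimal state of $(P_0)$ does not depend on the choice of the optimal control. A switching point of $\bar u$ is a point $t\in(0,T)$ at which one of the functions $\bar\varphi(1,t)-\mu$, $\bar\varphi(1,t)+\mu$ of $t$ changes its sign. For $\nu>0$, a switching point of $u_\nu$ is a point $t\in(0,T)$ at which one of the four functions $\varphi_\nu(1,t)+\mu+\nu b$, $\varphi_\nu(1,t)+\mu$, $\varphi_\nu(1,t)-\mu$, $\varphi_\nu(1,t)-\mu+\nu a$ of $t$ changes its sign. *)

(* Defs.v *)
From mathcomp Require Import all_boot all_order all_algebra.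
From mathcomp Require Import all_classical all_reals all_analysis.
Set Implicit Arguments.
Unset Strict Implicit.
Unset Printing Implicit Defensive.
Import Order.TTheory GRing.Theory Num.Theory.
Import numFieldNormedType.Exports.
Local Open Scope classical_set_scope.
Local Open Scope ring_scope.

(* Functions of (x, t) are total functions on R * R; only their values on the
   closed cylinder are ever constrained or used. *)
Definition cylinder (R : realType) (T : R) : set (R * R) :=
  `]0, 1[ `*` `]0, T[.

Definition closed_cylinder (R : realType) (T : R) : set (R * R) :=
  `[0, 1] `*` `[0, T].

Definition lebesgue2 (R : realType) :
    {measure set (measurableTypeR R * measurableTypeR R) -> \bar R} :=
  (@lebesgue_measure R \x @lebesgue_measure R)%E.
Arguments lebesgue2 R : clear implicits.

Definition square_integrable d (X : measurableType d) (R : realType)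
    (m : {measure set X -> \bar R}) (D : set X) (f : X -> R) : Prop :=
  measurable_fun D f /\ m.-integrable D (fun x => (f x ^+ 2)%:E).

(* The norm of L^2(0,1). *)
Definition L2norm01 (R : realType) (f : R -> R) : R :=
  Num.sqrt (\int[lebesgue_measure]_(x in `]0, 1[) (f x ^+ 2)).

Definition dx (R : realType) (v : R * R -> R) (z : R * R) : R :=
  derive1 (fun x => v (x, z.2)) z.1.

Definition dt (R : realType) (v : R * R -> R) (z : R * R) : R :=
  derive1 (fun t => v (z.1, t)) z.2.

(* Since C^1 functions on a closed rectangle extend to the plane, the
   restrictions to the closed cylinder of functions satisfying this predicate
   are exactly the C^1 functions there. *)
Definition C1 (R : realType) (v : R * R -> R) : Prop :=
  [/\ forall x t, derivable (fun s => v (s, t)) x 1,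
      forall x t, derivable (fun s => v (x, s)) t 1,
      continuous (dx v) & continuous (dt v)].

(* g is the weak derivative y_x in L^2(Q). The closure of the support is
   bounded, hence compact, as a closed subset of the bounded set Q. *)
Definition weak_dx (R : realType) (T : R) (y g : R * R -> R) : Prop :=
  square_integrable (lebesgue2 R) (cylinder T) g /\
  forall psi : R * R -> R, C1 psi ->
    closure [set z | psi z != 0] `<=` cylinder T ->
    (\int[lebesgue2 R]_(z in cylinder T) (y z * dx psi z)) =
    - (\int[lebesgue2 R]_(z in cylinder T) (g z * psi z)).

(* y in C(cl Q) is a weak solution, with y_x in L^2(Q), of
     y_t - y_xx = 0,  y_x(0,t) = 0,  y_x(1,t) + alpha y(1,t) = u(t),  y(x,0) = 0.
   The variational identity is obtained by multiplying by v with v(.,T) = 0 and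
   integrating by parts once in each variable. *)
Definition weak_state (R : realType) (T alpha : R) (u : R -> R)
    (y : R * R -> R) : Prop :=
  {within closed_cylinder T, continuous y} /\
  exists2 yx : R * R -> R, weak_dx T y yx &
  forall v : R * R -> R, C1 v -> (forall x, x \in `[0, 1] -> v (x, T) = 0) ->
    - (\int[lebesgue2 R]_(z in cylinder T) (y z * dt v z))
    + (\int[lebesgue2 R]_(z in cylinder T) (yx z * dx v z))
    + alpha * (\int[lebesgue_measure]_(t in `]0, T[) (y (1, t) * v (1, t)))
    = (\int[lebesgue_measure]_(t in `]0, T[) (u t * v (1, t))).

(* phi in C(cl Q) is a weak solution, with phi_x in L^2(Q), of
     - phi_t - phi_xx = 0,  phi_x(0,t) = 0,  phi_x(1,t) + alpha phi(1,t) = 0,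
     phi(x,T) = y(x,T) - yO(x);
   here the test functions vanish at t = 0. *)
Definition weak_adjoint (R : realType) (T alpha : R) (yO : R -> R)
    (y phi : R * R -> R) : Prop :=
  {within closed_cylinder T, continuous phi} /\
  exists2 phix : R * R -> R, weak_dx T phi phix &
  forall v : R * R -> R, C1 v -> (forall x, x \in `[0, 1] -> v (x, 0) = 0) ->
    (\int[lebesgue2 R]_(z in cylinder T) (phi z * dt v z))
    + (\int[lebesgue2 R]_(z in cylinder T) (phix z * dx v z))
    + alpha * (\int[lebesgue_measure]_(t in `]0, T[) (phi (1, t) * v (1, t)))
    = (\int[lebesgue_measure]_(x in `]0, 1[) ((y (x, T) - yO x) * v (x, T))).

(* Elements of L^2(0,T) are given by measurable representatives. *)
Definition admissible (R : realType) (T a b : R) (u : R -> R) : Prop :=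
  square_integrable lebesgue_measure `[0, T] u /\
  {ae @lebesgue_measure R, forall t, t \in `[0, T] -> a <= u t <= b}.

Definition cost (R : realType) (T mu nu : R) (yO : R -> R) (u : R -> R)
    (y : R * R -> R) : R :=
  2^-1 * (\int[lebesgue_measure]_(x in `]0, 1[) (`|y (x, T) - yO x| ^+ 2))
  + nu / 2 * (\int[lebesgue_measure]_(t in `]0, T[) (`|u t| ^+ 2))
  + mu * (\int[lebesgue_measure]_(t in `]0, T[) `|u t|).

(* u solves (P_nu) and y is its state. Each admissible control has exactly one
   state on the closed cylinder, so comparing with all admissible
   control-state pairs is the same as minimizing the reduced functional
   w |-> F_nu(w). *)
Definition optimal (R : realType) (T alpha mu a b : R) (yO : R -> R) (nu : R)
    (u : R -> R) (y : R * R -> R) : Prop :=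
  [/\ admissible T a b u, weak_state T alpha u y &
      forall (w : R -> R) (z : R * R -> R),
        admissible T a b w -> weak_state T alpha w z ->
        cost T mu nu yO u y <= cost T mu nu yO w z].

Definition changes_sign (R : realType) (f : R -> R) (t : R) : Prop :=
  exists2 e : R, 0 < e &
    forall r s, r \in `]t - e, t[ -> s \in `]t, t + e[ -> f r * f s < 0.

(* Switching points of an optimal control of (P_0) with adjoint state phi. *)
Definition switching_point0 (R : realType) (T mu : R) (phi : R * R -> R)
    (t : R) : Prop :=
  (t \in `]0, T[) /\
  (changes_sign (fun s => phi (1, s) - mu) t \/
   changes_sign (fun s => phi (1, s) + mu) t).

(* Switching points of the solution of (P_nu), nu > 0, with adjoint state phi. *)
Definition switching_point (R : realType) (T mu a b nu : R)
    (phi : R * R -> R) (t : R) : Prop :=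
  (t \in `]0, T[) /\
  [\/ changes_sign (fun s => phi (1, s) + mu + nu * b) t,
      changes_sign (fun s => phi (1, s) + mu) t,
      changes_sign (fun s => phi (1, s) - mu) t |
      changes_sign (fun s => phi (1, s) - mu + nu * a) t].

(* Main.v *)
Require Import Defs.
From mathcomp Require Import all_boot all_order all_algebra.
From mathcomp Require Import all_classical all_reals all_analysis.
From mathcomp Require Import measurable_realfun finmap ring lra.
Import Order.TTheory GRing.Theory Num.Theory.
Import numFieldNormedType.Exports.
Local Open Scope classical_set_scope.
Local Open Scope card_scope.
Local Open Scope ring_scope.

(* The trace of the adjoint state is an exponential series: testing the weak
   form with theta(t) cos(w x) turns the Fourier modes of phi into scalar ODEs.
   With w = 0 one gets alpha phi(1,t) = m'(t) for the mean m of phi(.,t), and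
   with the Robin frequencies w_k tan w_k = alpha one gets
   m(t) = sum_k beta_k d_k exp(- w_k^2 (T - t)), where d_k and beta_k are the
   Robin coefficients of y(.,T) - yO and of the constant 1. Hence every time
   derivative of phi_nu(1,.) - phibar(1,.) is bounded on compact subsets of
   (0,T) by |y_nu(T) - ybar(T)|, and the variational inequality for (P_0) bounds
   the latter by a constant times sqrt nu. Rolle's theorem, the Taylor lower
   bound |phibar(1,t) -/+ mu| >= c |t - tbar|^n and the sign of phibar(1,.) -/+ mu
   on both sides of tbar then give (i), (ii) and (iii). The second case follows
   from the first applied to - phi, with (a, b) replaced by (- b, - a). *)

(** * Pointwise calculus *)

(** The Fourier modes of phi(.,t) are integrals over (0,1), and a Robin series evaluated at x = 1
    would need convergence up to the boundary. The frequency w = 0 circumvents this: it expresses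
    the trace through the mean, so that only one function, the constant 1, has to be expanded. Its
    expansion error is bounded at rate 1/N by weighing a dimension count against a Poincare
    inequality. Differentiating the mean is harmless, because the factors exp(- w_k^2 (T - t)) make
    the series smooth for t < T. A weak x-derivative is tested only with functions supported inside
    Q, so the boundary terms have to be recovered as limits of cutoffs. In (ii), the exponent 1/(2n)
    is the n-th root of sqrt nu, and the term nu^(1/n) stems from the shift nu a in the second
    equation. In (iii), a zero alone is not a switching point; since the zeros are finitely many,
    one with a change of sign can be singled out. *)

Section pointwise_derivatives.
Variable R : realType.
Implicit Types (f g : R -> R) (t a b c : R).

Lemma is_derive_cstE c t : is_derive t 1 (fun=> c) (0 : R).
Proof. exact: is_derive_cst. Qed.

Lemma is_derive_addE f g t a b :
  is_derive t 1 f a -> is_derive t 1 g b -> is_derive t 1 (fun x => f x + g x) (a + b).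
Proof. exact: is_deriveD. Qed.

Lemma is_derive_subE f g t a b :
  is_derive t 1 f a -> is_derive t 1 g b -> is_derive t 1 (fun x => f x - g x) (a - b).
Proof. exact: is_deriveB. Qed.

Lemma is_derive_mulE f g t a b :
  is_derive t 1 f a -> is_derive t 1 g b ->
  is_derive t 1 (fun x => f x * g x) (a * g t + f t * b).
Proof.
by move=> fa gb; apply: (is_derive_eq (is_deriveM fa gb)); rewrite /GRing.scale/= addrC (mulrC a).
Qed.

Lemma is_derive_scaleE c f t a :
  is_derive t 1 f a -> is_derive t 1 (fun x => c * f x) (c * a).
Proof. exact: is_deriveZ. Qed.

Lemma is_derive_compE f g t a b :
  is_derive (g t) 1 f a -> is_derive t 1 g b -> is_derive t 1 (fun x => f (g x)) (a * b).
Proof.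
by move=> fa gb; have := is_derive1_comp fa gb.
Qed.

Lemma is_derive_expE f t a n :
  is_derive t 1 f a -> is_derive t 1 (fun x => f x ^+ n.+1) (n.+1%:R * f t ^+ n * a).
Proof.
move=> fa.
elim: n => [|n IHn]; first by rewrite /= expr0 !mul1r.
under eq_fun do rewrite exprS.
apply: (is_derive_eq (is_derive_mulE _ _ _ _ _ fa IHn)).
by rewrite exprS -(natr1 n.+1); ring.
Qed.

Lemma is_derive_affine c b t : is_derive t 1 (fun x => c * x + b) c.
Proof.
have := is_derive_addE _ _ t _ _ (is_derive_scaleE c _ t _ (is_derive_id t 1)) (is_derive_cstE b t).
by rewrite mulr1 addr0.
Qed.

Lemma is_derive_mulc c t : is_derive t 1 (fun x => c * x) c.
Proof. by have := is_derive_affine c 0 t; under eq_fun do rewrite addr0. Qed.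

Lemma is_derive_sum_seq (I : Type) (s : seq I) (F : I -> R -> R) (dF : I -> R) t :
  (forall i, is_derive t 1 (F i) (dF i)) ->
  is_derive t 1 (fun x => \sum_(i <- s) F i x) (\sum_(i <- s) dF i).
Proof.
move=> FD; elim: s => [|i s IHs].
  by rewrite big_nil; under eq_fun do rewrite big_nil; exact: is_derive_cst.
rewrite big_cons; under eq_fun do rewrite big_cons.
exact: is_derive_addE.
Qed.

Lemma continuous_addE f g : continuous f -> continuous g -> continuous (fun x => f x + g x).
Proof. by move=> cf cg x; apply: continuousD; [exact: cf|exact: cg]. Qed.

Lemma continuous_subE f g : continuous f -> continuous g -> continuous (fun x => f x - g x).
Proof. by move=> cf cg x; apply: continuousB; [exact: cf|exact: cg]. Qed.

Lemma continuous_mulE f g : continuous f -> continuous g -> continuous (fun x => f x * g x).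
Proof. by move=> cf cg x; apply: continuousM; [exact: cf|exact: cg]. Qed.

Lemma continuous_scaleE c f : continuous f -> continuous (fun x => c * f x).
Proof. by move=> cf; apply: continuous_mulE => //; exact: cst_continuous. Qed.

Lemma continuous_sqrE f : continuous f -> continuous (fun x => f x ^+ 2).
Proof. by move=> cf; exact: continuous_mulE. Qed.

End pointwise_derivatives.

(** * Zeros and sign changes *)

Section real_analysis.
Variable R : realType.
Implicit Types (f df : R -> R) (l r t : R).

Lemma is_derive_continuous f t (d : R) : is_derive t 1 f d -> {for t, continuous f}.
Proof. by case=> /derivable1_diffP/differentiable_continuous. Qed.

Lemma is_derive_within_continuous f df l r :
  (forall t, t \in `]l, r[ -> is_derive t 1 f (df t)) ->
  forall x y, l < x -> y < r -> {within `[x, y], continuous f}.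
Proof.
move=> fD x y lx yr; apply: derivable_within_continuous => t.
rewrite in_itv/= => /andP[xt ty].
have /fD[] // : t \in `]l, r[ by rewrite in_itv/= (lt_le_trans lx)// (le_lt_trans ty).
Qed.

(** Rolle's theorem gives one zero of [df] in each gap. That the new list starts above [x], and is
    not merely sorted, is what lets the induction prepend the zero from the gap to the left. *)
Lemma Rolle_path f df l r :
  (forall t, t \in `]l, r[ -> is_derive t 1 f (df t)) ->
  forall s x, path <%R x s ->
    all (fun t => (t \in `]l, r[) && (f t == 0)) (x :: s) ->
  exists s', [/\ path <%R x s', size s' = size s &
    all (fun t => (t \in `]l, r[) && (df t == 0)) s'].
Proof.
move=> fD; elim=> [|y s IHs] x /=; first by exists [::].
move=> /andP[xy ys] /and3P[/andP[xI /eqP fx] /andP[yI /eqP fy] sI].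
have [|s' [ys' ss' s'I]] := IHs y ys; first by rewrite /= yI fy eqxx.
have sub t : t \in `]x, y[ -> t \in `]l, r[.
  move: xI yI; rewrite !in_itv/= => /andP[lx _] /andP[_ yr] /andP[xt ty].
  by rewrite (lt_trans lx)// (lt_trans ty).
have [||z zxy [_ fz]] := @Rolle R f x y xy _ _ (etrans fx (esym fy)).
- by move=> t /sub /fD[].
- apply: (is_derive_within_continuous f df l r) => //.
    by move: xI; rewrite in_itv/= => /andP[].
  by move: yI; rewrite in_itv/= => /andP[].
exists (z :: s') => /=; split; last 1 first.
- have [_ <-] := fD _ (sub _ zxy).
  by rewrite sub//= fz eqxx.
- move: zxy; rewrite in_itv/= => /andP[-> zy] /=.
  by apply: path_le ys' => //; exact: lt_trans.
- by rewrite ss'.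
Qed.

(** The derivatives are carried along as explicit functions, since the traces come with their
    derivatives as series. *)
Definition derivative_chain (F : nat -> R -> R) l r :=
  forall k t, t \in `]l, r[ -> is_derive t 1 (F k) (F k.+1 t).

Lemma size_zeros (F : nat -> R -> R) l r n s :
  derivative_chain F l r -> (forall t, t \in `]l, r[ -> F n t != 0) ->
  sorted <%R s -> all (fun t => (t \in `]l, r[) && (F 0%N t == 0)) s ->
  (size s <= n)%N.
Proof.
elim: n F s => [|n IHn] F s FD nz.
  case: s => // x s _ /= /andP[/andP[/nz/negbTE]].
  by move=> ->.
case: s => // x s /= ps sI; rewrite ltnS.
have [s' [ps' <- s'I]] := Rolle_path (F 0%N) (F 1%N) l r (FD 0%N) s x ps sI.
apply: (IHn (fun k => F k.+1)) => //; last exact: path_sorted ps'.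
by move=> k t /FD.
Qed.

(** Sorting a finite set of zeros makes the iterated Rolle bound applicable; an infinite set of
    zeros would contain a finite one with more than [n] elements, so finiteness comes with the
    bound. *)
Lemma card_zeros (F : nat -> R -> R) l r n :
  derivative_chain F l r -> (forall t, t \in `]l, r[ -> F n t != 0) ->
  [set t | (t \in `]l, r[) /\ F 0%N t = 0] #<= `I_n.
Proof.
move=> FD nz; set A := [set t | _].
have bd (B : {fset R}) : [set` B] `<=` A -> (#|` B| <= n)%N.
  move=> BA; rewrite -(size_sort <=%R).
  apply: (size_zeros F l r) => //.
    rewrite lt_sorted_uniq_le sort_uniq fset_uniq/=.
    exact/sort_sorted/le_total.
  apply/allP => t; rewrite mem_sort => /BA[tI /eqP ->].
  by rewrite tI.
have fA : finite_set A.
  apply: contrapT => /(infinite_set_fset n.+1) [B BA].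
  by rewrite leqNgt ltnS bd.
have [B AB] := finite_fsetP.1 fA.
have : (#|` B| <= n)%N by apply: bd; rewrite AB.
rewrite -card_le_II; apply: card_le_trans.
by rewrite AB; have /card_eq_fsetP := erefl #|` B|; rewrite card_eq_le => /andP[].
Qed.

(** Induction on [n] takes the place of a Taylor remainder: [F 0] minus the claimed lower bound
    vanishes at [t0] and has a nonnegative derivative, by the induction hypothesis for the chain
    starting at [F 1]. *)
Lemma taylor_lower_right (F : nat -> R -> R) l r t0 m n :
  derivative_chain F l r -> t0 \in `]l, r[ ->
  (forall k, (k < n)%N -> F k t0 = 0) ->
  (forall t, t \in `]l, r[ -> m <= F n t) ->
  forall t, t \in `[t0, r[ -> m / n`!%:R * (t - t0) ^+ n <= F 0%N t.
Proof.
move=> + t0I; elim: n F => [|n IHn] F FD F0 Fm t tI.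
  rewrite expr0 mulr1 fact0 divr1; apply: Fm.
  by move: t0I tI; rewrite !in_itv/= => /andP[lt0 _] /andP[t0t ->]; rewrite (lt_le_trans lt0).
pose c : R := m / n.+1`!%:R.
pose G (t : R) : R := F 0%N t - c * (t - t0) ^+ n.+1.
have GD s : s \in `]l, r[ -> is_derive s 1 G (F 1%N s - m / n`!%:R * (s - t0) ^+ n).
  move=> sI; rewrite /G; apply: is_derive_eq.
    apply: is_derive_subE; first exact: FD.
    apply/is_derive_scaleE/is_derive_expE.
  rewrite subr0 mulr1 /= /c factS natrM; field.
  by rewrite nat1r !pnatr_eq0 -!lt0n fact_gt0.
have [<-|t0t] := eqVneq t0 t; first by rewrite subrr expr0n/= mulr0 F0.
move: t0I tI; rewrite !in_itv/= => /andP[lt0 t0r] /andP[t0t' tr].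
have {t0t'}t0t : t0 < t by rewrite lt_neqAle t0t.
pose dG s : R := F 1%N s - m / n`!%:R * (s - t0) ^+ n.
have cG : {within `[t0, t], continuous G}.
  exact: (is_derive_within_continuous G dG l r GD).
have dGI x : x \in `]t0, t[ -> is_derive x 1 G (dG x).
  rewrite in_itv/= => /andP[t0x xt]; apply: GD.
  by rewrite in_itv/= (lt_trans lt0)// (lt_trans xt).
have [c0 c0I] := MVT t0t dGI cG.
move: c0I; rewrite in_itv/= => /andP[t0c0 c0t].
have := IHn (fun k => F k.+1) (fun k s => FD k.+1 s) (fun k kn => F0 k.+1 kn) Fm c0.
rewrite in_itv/= ltW//= (lt_trans c0t)// => /(_ isT) h.
rewrite /G subrr expr0n/= F0// mulr0 subrr subr0 => /eqP.
rewrite subr_eq -/c => /eqP ->; rewrite lerDr mulr_ge0 ?subr_ge0//.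
exact: ltW.
Qed.

Lemma taylor_lower_left (F : nat -> R -> R) l r t0 m n :
  derivative_chain F l r -> t0 \in `]l, r[ ->
  (forall k, (k < n)%N -> F k t0 = 0) ->
  (forall t, t \in `]l, r[ -> m <= F n t) ->
  forall t, t \in `]l, t0] -> m / n`!%:R * (t0 - t) ^+ n <= (-1) ^+ n * F 0%N t.
Proof.
move=> FD t0I F0 Fm t tI.
have oppI s : s \in `](- r), (- l)[ -> - s \in `]l, r[.
  by rewrite !in_itv/= => /andP[? ?]; apply/andP; split; lra.
(* The sign absorbs the factor -1 that each differentiation of the reflection produces and makes the
   [n]-th member equal to [F n (- s)], so the lower bound [m] carries over. *)
pose G k (s : R) : R := (-1) ^+ (n + k) * F k (- s).
have GD : derivative_chain G (- r) (- l).
  move=> k s /oppI sI; have Fks := FD k _ sI.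
  have dopp : is_derive s 1 -%R (- 1 : R) by exact: is_deriveNid.
  apply: (is_derive_eq (is_derive_scaleE _ ((-1) ^+ (n + k)) _ _ _
    (is_derive_compE _ (F k) -%R s _ _ Fks dopp))).
  by rewrite /G addnS exprS; ring.
have := @taylor_lower_right G (- r) (- l) (- t0) m n GD.
have -> : - t0 \in `](- r), (- l)[.
  by move: t0I; rewrite !in_itv/= => /andP[? ?]; apply/andP; split; lra.
have -> : t0 - t = - t - - t0 by ring.
have -> : (-1) ^+ n * F 0%N t = G 0%N (- t) by rewrite /G addn0 opprK.
apply => //.
- by move=> k kn; rewrite /G opprK F0// mulr0.
- by move=> s sI; rewrite /G addnn -mul2n exprM sqrrN !expr1n mul1r; apply/Fm/oppI.
- by move: tI; rewrite !in_itv/= => /andP[? ?]; apply/andP; split; lra.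
Qed.

Lemma IVT_zero f x y : x <= y -> {within `[x, y], continuous f} ->
  f x * f y <= 0 -> exists2 z, z \in `[x, y] & f z = 0.
Proof.
move=> xy cf fxy; apply: IVT => //.
rewrite ge_min le_max; apply/andP; split; apply/orP.
- by case: (lerP (f x) 0) => fx; [left|right; rewrite -(pmulr_rle0 _ fx)].
- by case: (lerP 0 (f x)) => fx; [left|right; rewrite -(nmulr_rle0 _ fx)].
Qed.

Lemma isolated_from_seq (s : seq R) t :
  exists2 e, 0 < e & forall z, z \in s -> z != t -> e <= `|z - t|.
Proof.
elim: s => [|x s [e e0 es]]; first by exists 1.
have [->|xt] := eqVneq x t.
  by exists e => // z; rewrite inE => /predU1P[->|/es//]; rewrite eqxx.
exists (Num.min e `|x - t|); first by rewrite lt_min e0 normr_gt0 subr_eq0.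
move=> z; rewrite inE => /predU1P[-> _|zs zt]; first by rewrite ge_min lexx orbT.
by rewrite ge_min es.
Qed.

(** The intermediate value theorem gives a zero, but possibly one without a change of sign. The
    supremum [t] of the points between [x] and [y] where [F 0] is negative is better: to its right
    [F 0] is nonnegative, and negative values accumulate at it from the left. The zeros are finitely
    many, hence isolated, so both signs are strict near [t]. *)
Lemma exists_changes_sign (F : nat -> R -> R) l r n x y :
  derivative_chain F l r -> (forall t, t \in `]l, r[ -> F n t != 0) ->
  l < x -> x < y -> y < r -> F 0%N x < 0 -> 0 < F 0%N y ->
  exists t, [/\ t \in `]x, y[, F 0%N t = 0 & changes_sign (F 0%N) t].
Proof.
move=> FD nz lx xy yr; set f := F 0%N => fx fy.
have /finite_fsetP[B AB] : finite_set [set t | (t \in `]l, r[) /\ f t = 0].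
  by apply: card_le_finite (card_zeros _ _ _ _ FD nz) _; exact: finite_II.
have cf u v : x <= u -> v <= y -> {within `[u, v], continuous f}.
  move=> xu vy; apply: (is_derive_within_continuous f (F 1%N) l r (FD 0%N)).
    exact: lt_le_trans xu.
  exact: le_lt_trans yr.
have same u v : x <= u -> u <= v -> v <= y ->
    (forall z, z \in `[u, v] -> z \notin B) -> 0 < f u * f v.
  move=> xu uv vy nB; rewrite ltNge; apply/negP => /(IVT_zero f u v uv (cf _ _ xu vy)).
  move=> [z zI fz]; have : [set` B] z.
    rewrite -AB/=; split => //.
    move: zI; rewrite !in_itv/= => /andP[uz zv].
    by rewrite (lt_le_trans lx) ?(le_trans xu)//= (le_lt_trans zv)// (le_lt_trans vy).
  by rewrite /= => zB; have := nB _ zI; rewrite zB.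
pose S := [set t | [/\ x <= t, t <= y & f t < 0]].
have Sx : S x by split => //; exact: ltW.
have supS : has_sup S by split; [exists x|exists y => t []].
pose t := sup S.
have xt : x <= t by apply: ub_le_sup => //; case: supS.
have ty : t <= y by apply: sup_le_ub; [exists x|move=> s []].
have tI : t \in `]l, r[ by rewrite in_itv/= (lt_le_trans lx)// (le_lt_trans ty).
have ct : {for t, continuous f} by exact: is_derive_continuous (FD 0%N t tI).
have posr s : t < s -> s <= y -> 0 <= f s.
  move=> ts sy; rewrite leNgt; apply/negP => fs.
  have : s <= t by apply: ub_le_sup; [case: supS|split=> //; exact/ltW/(le_lt_trans xt)].
  by rewrite leNgt ts.
have ft_le0 : f t <= 0.
  rewrite leNgt; apply/negP => ft.
  have /nbhs_ballP[e /= e0 be] : \forall z \near t, 0 < f z by exact: (cvgr_gt _ ct).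
  have [s [xs sy fs] ts] := sup_adherent e0 supS.
  have st : s <= t by apply: ub_le_sup => //; case: supS.
  have : 0 < f s by apply: be; rewrite /ball/= ger0_norm ?subr_ge0// ltrBlDr -ltrBlDl.
  by rewrite ltNge ltW.
have ft_ge0 : 0 <= f t.
  rewrite leNgt; apply/negP => ft.
  have {}ty : t < y.
    by rewrite lt_neqAle ty andbT; apply: contraTneq fy => <-; rewrite -leNgt ltW.
  have /nbhs_ballP[e /= e0 be] : \forall z \near t, f z < 0 by exact: (cvgr_lt _ ct).
  pose s := t + Num.min (e / 2) (y - t).
  have m0 : 0 < Num.min (e / 2) (y - t) by rewrite lt_min divr_gt0//= subr_gt0.
  have : f s < 0.
    apply: be; rewrite /ball/= /s opprD addNKr normrN gtr0_norm// gt_min.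
    by rewrite ltr_pdivrMr// ltr_pMr// ltr1n.
  apply/negP; rewrite -leNgt; apply: posr; first by rewrite ltrDl.
  by rewrite /s -lerBrDl ge_min lexx orbT.
have ft : f t = 0 by apply/eqP; rewrite eq_le ft_le0.
have {}xt : x < t by rewrite lt_neqAle xt andbT; apply: contraTneq fx => ->; rewrite ft ltxx.
have {}ty : t < y by rewrite lt_neqAle ty andbT; apply: contraTneq fy => <-; rewrite ft ltxx.
exists t; split => //; first by rewrite in_itv/= xt.
have [e1 e10 eB] := isolated_from_seq B t.
pose e := Num.min e1 (Num.min (t - x) (y - t)).
have e0 : 0 < e by rewrite !lt_min e10 !subr_gt0 xt.
exists e => // u v; rewrite !in_itv/= => /andP[eu ut] /andP[tv ve].
have ee1 : e <= e1 by rewrite ge_min lexx.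
have etx : e <= t - x by rewrite !ge_min lexx orbT.
have eyt : e <= y - t by rewrite !ge_min lexx !orbT.
have nB z : z != t -> t - e < z -> z < t + e -> z \notin B.
  move=> zt ez ze; apply/negP => /eB /(_ zt); apply/negP; rewrite -ltNge.
  by rewrite (lt_le_trans _ ee1)// ltr_norml; lra.
have [s [xs sy fs]] := sup_adherent e0 supS; rewrite -/t => es.
have st : s < t.
  rewrite lt_neqAle ub_le_sup//; last by case: supS.
  by rewrite andbT; apply: contraTneq fs => ->; rewrite ft ltxx.
(* [u] and the negative point [s] lie in the same zero-free interval to the left of [t]. *)
have fu : f u < 0.
  have [us|su] := leP u s.
    have := same u s; rewrite nmulr_lgt0//; apply => //; first by lra.
    move=> z; rewrite in_itv/= => /andP[uz zs]; apply: nB; lra.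
  have := same s u; rewrite nmulr_rgt0//; apply => //; [exact: ltW|lra|].
  by move=> z; rewrite in_itv/= => /andP[sz zu]; apply: nB; lra.
rewrite nmulr_rlt0// lt_neqAle posr; [|by []|lra].
rewrite andbT eq_sym; apply/negP => /eqP fv.
have : v \notin B by apply: nB; lra.
suff : [set` B] v by move=> /= ->.
by rewrite -AB/=; split => //; rewrite in_itv/=; lra.
Qed.

End real_analysis.

(** * Zeros of small perturbations near a point of finite order *)

Section perturbed_zeros.
Variable R : realType.
Implicit Types (l r t c : R).

Lemma derivative_chain_scale (F : nat -> R -> R) l r c :
  derivative_chain R F l r -> derivative_chain R (fun k t => c * F k t) l r.
Proof. by move=> FD k t tI; exact/is_derive_scaleE/FD. Qed.

Lemma derivative_chain_shift (F : nat -> R -> R) l r c :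
  derivative_chain R F l r ->
  derivative_chain R (fun k t => F k t - (if k is 0%N then c else 0)) l r.
Proof.
move=> FD k t tI; rewrite [X in is_derive _ _ _ (_ - X)]/=.
exact: is_derive_subE (FD k t tI) (is_derive_cstE _ _ _).
Qed.

Lemma derivative_chain_sub (F : nat -> R -> R) l r l' r' :
  derivative_chain R F l r -> (forall t, t \in `]l', r'[ -> t \in `]l, r[) ->
  derivative_chain R F l' r'.
Proof. by move=> FD sub k t /sub; exact: FD. Qed.

Lemma changes_sign_scale (f : R -> R) c t : c != 0 ->
  changes_sign (fun s => c * f s) t -> changes_sign f t.
Proof.
move=> c0 [e e0 fe]; exists e => // r s rI sI.
have := fe r s rI sI; rewrite mulrACA pmulr_rlt0//.
by rewrite -expr2 exprn_even_gt0.
Qed.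

Lemma changes_sign_eq (f g : R -> R) l r t : t \in `]l, r[ ->
  (forall s, s \in `]l, r[ -> f s = g s) -> changes_sign f t -> changes_sign g t.
Proof.
rewrite in_itv/= => /andP[lt tr] fg [e e0 fe].
exists (Num.min e (Num.min (t - l) (r - t))).
  by rewrite !lt_min e0 !subr_gt0 lt.
move=> u v; rewrite !in_itv/= => /andP[u1 u2] /andP[v1 v2].
have e1 : Num.min e (Num.min (t - l) (r - t)) <= e by rewrite ge_min lexx.
have e2 : Num.min e (Num.min (t - l) (r - t)) <= t - l by rewrite !ge_min lexx orbT.
have e3 : Num.min e (Num.min (t - l) (r - t)) <= r - t by rewrite !ge_min lexx !orbT.
by rewrite -!fg; [apply: fe| |]; rewrite in_itv/=; lra.
Qed.

Lemma powR_rootK (x : R) n : 0 <= x -> (0 < n)%N -> (x `^ n%:R^-1) ^+ n = x.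
Proof.
move=> x0 n0; rewrite -powR_mulrn ?powR_ge0// -powRrM mulVf ?powRr1//.
by rewrite pnatr_eq0 -lt0n.
Qed.

(** A root of [D] is avoided: [D <= (D + 1) ^+ n] already yields an admissible constant. *)
Lemma le_rootM (X D Y : R) n : (0 < n)%N -> 0 <= X -> 0 <= D -> 0 <= Y ->
  X ^+ n <= D * Y ^+ n -> X <= (D + 1) * Y.
Proof.
move=> n0 X0 D0 Y0 h; rewrite -(@ler_pXn2r _ n)//; last first.
  by rewrite nnegrE mulr_ge0// addr_ge0.
apply: (le_trans h); rewrite exprMn ler_wpM2r ?exprn_ge0//.
case: n n0 {h} => // n _; rewrite exprS.
rewrite (@le_trans _ _ (D + 1)) ?lerDl// ler_peMr ?addr_ge0//.
by apply: exprn_ege1; rewrite lerDr.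
Qed.

(** With n-th roots as [x] and [y] this is the subadditivity of the n-th root, which splits [E + nu]
    in the second estimate of (ii). *)
Lemma leD_expr (x y : R) n : (0 < n)%N -> 0 <= x -> 0 <= y ->
  x ^+ n + y ^+ n <= (x + y) ^+ n.
Proof.
case: n => // n _ x0 y0; elim: n => [|n IHn]; first by rewrite !expr1.
rewrite [leRHS]exprS mulrDl lerD// [leLHS]exprS; apply: ler_wpM2l => //.
  by apply: (le_trans _ IHn); rewrite lerDl exprn_ge0.
by apply: (le_trans _ IHn); rewrite lerDr exprn_ge0.
Qed.

Lemma bound_sqrt_lt (K delta : R) : 0 <= K -> 0 < delta ->
  exists2 nu1, 0 < nu1 & forall nu, 0 < nu < nu1 -> K * Num.sqrt nu < delta.
Proof.
move=> K0 d0; exists ((delta / (K + 1)) ^+ 2).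
  by rewrite exprn_gt0// divr_gt0// ltr_wpDl.
move=> nu /andP[nu0 nu1].
have K1 : 0 < K + 1 by rewrite ltr_wpDl.
have h : Num.sqrt nu < delta / (K + 1).
  have := nu1; rewrite -ltr_sqrt; last by rewrite exprn_gt0// divr_gt0.
  by rewrite sqrtr_sqr gtr0_norm// divr_gt0.
rewrite ltr_pdivlMr// in h; apply: le_lt_trans h.
by rewrite mulrC ler_wpM2l ?sqrtr_ge0// lerDl.
Qed.

(* [F] stands for the derivatives of [phibar(1,.)] or [- phibar(1,.)], and
   [Adm nu P E] says that [P] are those of an adjoint trace of (P_nu) whose
   final state is at distance [E] from the optimal one of (P_0). *)
Lemma perturbed_zeros (T mu tb a' b' K : R) n (F : nat -> R -> R)
    (Adm : R -> (nat -> R -> R) -> R -> Prop) :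
  0 < mu -> tb \in `]0, T[ -> (0 < n)%N -> 0 <= K ->
  derivative_chain R F 0 T -> F 0%N tb = mu ->
  (forall k, (0 < k < n)%N -> F k tb = 0) -> F n tb != 0 ->
  (forall nu P E, 0 < nu -> Adm nu P E ->
    [/\ derivative_chain R P 0 T, 0 <= E & E <= K * Num.sqrt nu]) ->
  (forall k l r, 0 < l -> r < T -> exists2 C, 0 <= C &
    forall nu P E, 0 < nu -> Adm nu P E ->
    forall t, t \in `[l, r] -> `|P k t - F k t| <= C * E) ->
  exists nu0 tau : R,
  [/\ 0 < nu0, 0 < tau,
      (forall t, t \in `]tb - tau, tb + tau[ -> t \in `]0, T[) &
  [/\ (forall nu P E, 0 < nu < nu0 -> Adm nu P E ->
        [/\ [set t | (t \in `]tb - tau, tb + tau[) /\ P 0%N t - mu = 0] #<= `I_n,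
            [set t | (t \in `]tb - tau, tb + tau[) /\ P 0%N t - mu + nu * a' = 0] #<= `I_n &
            forall t, t \in `]tb - tau, tb + tau[ ->
              P 0%N t + mu + nu * b' <> 0 /\ P 0%N t + mu <> 0]),
      (exists2 c, 0 < c & forall nu P E t, 0 < nu < nu0 -> Adm nu P E ->
        t \in `]tb - tau, tb + tau[ ->
        P 0%N t - mu = 0 \/ P 0%N t - mu + nu * a' = 0 ->
        `|tb - t| <= c * nu `^ ((2 * n)%:R^-1) /\
        `|tb - t| <= c * (E `^ (n%:R^-1) + nu `^ (n%:R^-1))),
      ((changes_sign (fun s => F 0%N s - mu) tb \/
        changes_sign (fun s => F 0%N s + mu) tb) -> odd n) &
      (odd n -> exists2 nu1, 0 < nu1 < nu0 & forall nu P E, 0 < nu < nu1 ->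
        Adm nu P E -> exists t, [/\ t \in `]tb - tau, tb + tau[,
          changes_sign (fun s => P 0%N s - mu) t & P 0%N t - mu = 0])]].
Proof.
move=> mu0 tbI n0 K0 FD Fmu Fk Fn Adm1 Adm2.
(* Multiplication by this sign makes the first nonzero derivative positive at [tb], so that the
   one-sided Taylor bounds apply. *)
pose s0 : R := Num.sg (F n tb).
have s01 : s0 ^+ 2 = 1 by rewrite /s0 sqr_sg Fn.
have s00 : s0 != 0 by rewrite /s0 sgr_eq0.
have ns0 x : `|s0 * x| = `|x| by rewrite normrM normr_sg Fn mul1r.
pose m : R := `|F n tb| / 2.
have m0 : 0 < m by rewrite divr_gt0// normr_gt0.
(* The bound [mu / 2 < F 0] keeps the trace away from [- mu], which excludes the other pair of
   equations. The conditions hold up to the endpoints, so that the closed interval lies inside []0,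
   T[], as the closeness hypothesis requires. *)
have [tau tau0 tauP] : exists2 tau : R, 0 < tau & forall t, `|tb - t| <= tau ->
    [/\ 0 < t < T, m < s0 * F n t & mu / 2 < F 0%N t].
  have cF k : {for tb, continuous (F k)} by exact: is_derive_continuous (FD k tb tbI).
  have csF : {for tb, continuous (fun t => s0 * F n t)}.
    by exact: is_derive_continuous (is_derive_scaleE _ _ _ _ _ (FD n tb tbI)).
  have h1 : \forall t \near tb, m < s0 * F n t.
    apply: (cvgr_gt _ csF); rewrite /= /s0 -normrEsg.
    by rewrite /m ltr_pdivrMr// ltr_pMr ?ltr1n// normr_gt0.
  have h2 : \forall t \near tb, mu / 2 < F 0%N t.
    apply: (cvgr_gt _ (cF 0%N)); rewrite Fmu.
    by rewrite ltr_pdivrMr// ltr_pMr ?ltr1n// normr_gt0.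
  have h3 : \forall t \near tb, t \in `]0, T[ by exact: near_in_itvoo.
  have /nbhs_ballP[e /= e0 eb] : \forall t \near tb, m < s0 * F n t /\ (mu / 2 < F 0%N t /\ t \in `]0, T[).
    exact: filterI h1 (filterI h2 h3).
  exists (e / 2); first by rewrite divr_gt0.
  move=> t te; have [] := eb t _; last by move=> ? [? /[!in_itv]].
  rewrite /ball/=; apply: (le_lt_trans te).
  by rewrite ltr_pdivrMr// ltr_pMr// ltr1n.
pose l := tb - tau; pose r := tb + tau.
have Iab t : t \in `]l, r[ -> `|tb - t| <= tau.
  by rewrite /l /r in_itv/= ler_norml => ?; lra.
have lT : 0 < l.
  by have [] := tauP l _; [rewrite /l opprB addrC subrK gtr0_norm//|case/andP].
have rT : r < T.
  by have [] := tauP r _; [rewrite /r opprD addNKr normrN gtr0_norm//|case/andP].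
have subI t : t \in `]l, r[ -> t \in `]0, T[.
  by move/Iab => /tauP[? _ _]; rewrite in_itv.
have tbI' : tb \in `]l, r[ by rewrite /l /r in_itv/=; lra.
have oc t : t \in `]l, r[ -> t \in `[l, r].
  by rewrite !in_itv/= => /andP[? ?]; rewrite !ltW.
pose G k t := s0 * (F k t - (if k is 0%N then mu else 0)).
have GD : derivative_chain R G l r.
  exact/derivative_chain_scale/derivative_chain_shift/(derivative_chain_sub _ 0 T).
have Gm t : t \in `]l, r[ -> m <= G n t.
  move=> /Iab/tauP[_ h _]; apply/ltW; rewrite /G; case: (n) n0 h => // k _.
  by rewrite subr0.
have G0 k : (k < n)%N -> G k tb = 0.
  case: k => [|k] kn; first by rewrite /G Fmu subrr mulr0.
  by rewrite /G Fk// subr0 mulr0.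
have [C0 C00 C0P] := Adm2 0%N l r lT rT.
have [Cn Cn0 CnP] := Adm2 n l r lT rT.
have [nuA nuA0 nuAP] := bound_sqrt_lt (C0 * K) (mu / 2) (mulr_ge0 C00 K0) (divr_gt0 mu0 (ltr0n _ 2)).
have [nuB nuB0 nuBP] := bound_sqrt_lt (Cn * K) m (mulr_ge0 Cn0 K0) m0.
pose nuC := mu / (`|b'| + 1).
have b1 : 0 < `|b'| + 1 by rewrite ltr_wpDl.
have nuC0 : 0 < nuC by rewrite divr_gt0.
(* [nuA] keeps [P 0] positive, [nuB] keeps the sign of [P n], [nuC] makes nu |b'| smaller than [mu],
   and the bound 1 gives nu <= sqrt nu. *)
pose nu0 := Num.min 1 (Num.min nuC (Num.min nuA nuB)).
have nu00 : 0 < nu0 by rewrite !lt_min ltr01 nuC0 nuA0.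
have lt_nu0 nu : nu < nu0 -> [/\ nu < 1, nu < nuC, nu < nuA & nu < nuB].
  by rewrite !lt_min => /and4P[].
have closeP nu P E t : 0 < nu < nu0 -> Adm nu P E -> t \in `]l, r[ ->
    0 < s0 * P n t /\ 0 < P 0%N t.
  move=> /andP[nu_gt0 /lt_nu0[_ _ nA nB]] A tI.
  have [_ E0 EK] := Adm1 _ _ _ nu_gt0 A.
  have [_ h1 h2] := tauP _ (Iab _ tI).
  have := CnP _ _ _ nu_gt0 A t (oc _ tI); have := C0P _ _ _ nu_gt0 A t (oc _ tI).
  have := nuAP nu; rewrite nu_gt0 nA => /(_ isT).
  have := nuBP nu; rewrite nu_gt0 nB => /(_ isT).
  have := ler_wpM2l C00 EK; have := ler_wpM2l Cn0 EK; rewrite !mulrA.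
  move=> k1 k2 k3 k4 k5; rewrite -(ns0 (P n t - F n t)) => k6.
  move: k5 k6; rewrite !ler_norml => /andP[k5 _] /andP[k6 _].
  split; last by lra.
  have -> : s0 * P n t = s0 * F n t + s0 * (P n t - F n t) by ring.
  lra.
exists nu0, tau; split => //; split.
- move=> nu P E nuI A; have [PD E0 EK] := Adm1 _ _ _ (andP nuI).1 A.
  have PD' := derivative_chain_sub _ _ _ _ _ PD subI.
  have Pn t : t \in `]l, r[ -> P n t != 0.
    move=> tI; have [+ _] := closeP _ _ _ _ nuI A tI.
    by apply: contraTneq => ->; rewrite mulr0 ltxx.
  (* Both equations have the form [P 0 = c]; as n > 0, subtracting a constant leaves [P n] unchanged
     and the same count applies. *)
  have cardP c : [set t | (t \in `]l, r[) /\ P 0%N t - c = 0] #<= `I_n.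
    apply: (card_zeros _ _ _ _ _ (derivative_chain_shift _ _ _ c PD')).
    by move=> t /Pn; case: (n) n0 => // k _; rewrite subr0.
  split; first exact: cardP.
    have := cardP (mu - nu * a'); congr (is_true (_ #<= _)).
    by apply: eq_set => t; rewrite opprB addrA addrAC.
  move=> t tI; have [_ P0] := closeP _ _ _ _ nuI A tI.
  split; last by apply/eqP; rewrite gt_eqF// addr_gt0.
  apply/eqP; rewrite gt_eqF//.
  move: nuI => /andP[nu_gt0 /lt_nu0[_ nC _ _]].
  move: nC; rewrite /nuC ltr_pdivlMr// => nC.
  have : - (nu * b') <= nu * (`|b'| + 1).
    by rewrite -mulrN ler_pM2l// (le_trans (ler_norm _))// normrN lerDl.
  lra.
(* The Taylor bound m / n! |tb - t|^n <= |F 0 - mu| and the perturbation bound |F 0 - mu| <= C0 E +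
   nu |a'| give |tb - t|^n <= D (E + nu). The first estimate then inserts E <= K sqrt nu and nu <=
   sqrt nu; the witness adds the constants of both estimates. *)
- pose D := n`!%:R / m * (C0 + `|a'|).
  have nf0 : 0 < n`!%:R :> R by rewrite ltr0n fact_gt0.
  have D0 : 0 <= D by rewrite mulr_ge0 ?addr_ge0// divr_ge0// ltW.
  exists ((D * (K + 1) + 1) + (D + 1)).
    by rewrite addr_gt0// ltr_wpDl// mulr_ge0// addr_ge0.
  move=> nu P E t nuI A tI tz.
  move: (nuI) => /andP[nu_gt0 /lt_nu0[nu1 _ _ _]].
  have [PD E0 EK] := Adm1 _ _ _ nu_gt0 A.
  have hX : `|tb - t| ^+ n <= D * (E + nu).
    have h1 : m / n`!%:R * `|tb - t| ^+ n <= `|F 0%N t - mu|.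
      move: (tI); rewrite in_itv/= -/l -/r => /andP[lt tr].
      have -> : `|F 0%N t - mu| = `|G 0%N t| by rewrite /G ns0.
      have [tt|tt] := leP tb t.
        rewrite -normrN opprB ger0_norm ?subr_ge0//; apply: le_trans (ler_norm _).
        by apply: (taylor_lower_right _ G l r) => //; rewrite in_itv/= tt.
      rewrite gtr0_norm ?subr_gt0//.
      apply: (@le_trans _ _ ((-1) ^+ n * G 0%N t)).
        by apply: (taylor_lower_left _ G l r) => //; rewrite in_itv/= lt ltW.
      by apply: (le_trans (ler_norm _)); rewrite normrM normrX normrN1 expr1n mul1r.
    have h2 : `|F 0%N t - mu| <= C0 * E + nu * `|a'|.
      have k1 := C0P _ _ _ nu_gt0 A t (oc _ tI).
      have k2 : `|P 0%N t - mu| <= nu * `|a'|.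
        case: tz => [->|/eqP]; first by rewrite normr0 mulr_ge0// ltW.
        by rewrite addr_eq0 => /eqP ->; rewrite normrN normrM gtr0_norm.
      have -> : F 0%N t - mu = (P 0%N t - mu) - (P 0%N t - F 0%N t) by ring.
      apply: (le_trans (ler_normB _ _)); lra.
    have h3 : C0 * E + nu * `|a'| <= (C0 + `|a'|) * (E + nu).
      rewrite mulrDl !mulrDr (mulrC nu) -addrA lerD2l.
      rewrite addrA lerDr addr_ge0// mulr_ge0// ltW//.
    have := le_trans h1 (le_trans h2 h3).
    by rewrite -(ler_pdivlMl _ _ (divr_gt0 m0 nf0)) invf_div mulrA.
  have c1 : D + 1 <= D * (K + 1) + 1 + (D + 1) by rewrite lerDr addr_ge0// mulr_ge0// addr_ge0.
  have c2 : D * (K + 1) + 1 <= D * (K + 1) + 1 + (D + 1) by rewrite lerDl addr_ge0.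
  split.
    apply: (@le_trans _ _ ((D * (K + 1) + 1) * nu `^ ((2 * n)%:R^-1))); last first.
      by rewrite ler_wpM2r ?powR_ge0.
    apply: (le_rootM _ _ _ n) => //; [by rewrite mulr_ge0// addr_ge0|exact: powR_ge0|].
    apply: (le_trans hX); rewrite -[leRHS]mulrA ler_wpM2l//.
    have -> : (nu `^ ((2 * n)%:R^-1)) ^+ n = Num.sqrt nu.
      rewrite -powR_mulrn ?powR_ge0// -powRrM natrM invfM -mulrA mulVf.
        by rewrite mulr1 powR12_sqrt// ltW.
      by rewrite pnatr_eq0 -lt0n.
    rewrite mulrDl mul1r lerD//.
    rewrite -{1}(sqr_sqrtr (ltW nu_gt0)) expr2 ler_piMr ?sqrtr_ge0//.
    by rewrite -sqrtr1 ler_wsqrtr// ltW.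
  apply: (@le_trans _ _ ((D + 1) * (E `^ n%:R^-1 + nu `^ n%:R^-1))); last first.
    by rewrite ler_wpM2r// addr_ge0 ?powR_ge0.
  apply: (le_rootM _ _ _ n) => //; first by rewrite addr_ge0 ?powR_ge0.
  apply: (le_trans hX); rewrite ler_wpM2l//.
  rewrite -{1}(powR_rootK E n)// -{1}(powR_rootK nu n)//; last exact: ltW.
  by apply: leD_expr; rewrite ?powR_ge0.
- have nf0 : 0 < n`!%:R :> R by rewrite ltr0n fact_gt0.
  have pair (f : R -> R) : changes_sign f tb ->
      exists2 h, 0 < h < tau & f (tb - h) * f (tb + h) < 0.
    move=> [e e0 fe]; pose h := Num.min e tau / 2.
    have h0 : 0 < Num.min e tau by rewrite lt_min e0.
    have he : Num.min e tau <= e by rewrite ge_min lexx.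
    have ht : Num.min e tau <= tau by rewrite ge_min lexx orbT.
    by exists h; [rewrite /h; lra|apply: fe; rewrite /h in_itv/=; lra].
  (* [F 0 + mu] is positive near [tb] and cannot change sign there. For even n the Taylor bounds
     would make [G 0] positive on both sides of [tb], so [F 0 - mu] could not change sign either. *)
  move=> [/pair[h /andP[h0 ht]]|/pair[h /andP[h0 ht]]]; last first.
    have [|_ _ f1] := tauP (tb - h); first by rewrite opprB addrC subrK gtr0_norm// ltW.
    have [|_ _ f2] := tauP (tb + h); first by rewrite opprD addNKr normrN gtr0_norm// ltW.
    by rewrite ltNge mulr_ge0//; lra.
  apply: contraTT => en; rewrite -leNgt.
  have h1 : 0 < G 0%N (tb + h).
    apply: lt_le_trans (taylor_lower_right _ G l r tb m n GD tbI' G0 Gm _ _).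
      by apply: mulr_gt0; [exact: divr_gt0|apply: exprn_gt0; lra].
    by rewrite /l /r in_itv/=; lra.
  have h2 : 0 < G 0%N (tb - h).
    have := taylor_lower_left _ G l r tb m n GD tbI' G0 Gm (tb - h).
    rewrite -signr_odd (negbTE en) expr0 mul1r => H.
    apply: lt_le_trans (H _).
      by apply: mulr_gt0; [exact: divr_gt0|apply: exprn_gt0; lra].
    by rewrite /l /r in_itv/=; lra.
  have := mulr_gt0 h2 h1; rewrite /G mulrACA -expr2 s01 mul1r; exact: ltW.
move=> on.
have nf0 : 0 < n`!%:R :> R by rewrite ltr0n fact_gt0.
pose h := tau / 2.
have h0 : 0 < h by rewrite divr_gt0.
have ht : h < tau by rewrite /h; lra.
(* The Taylor lower bound for |F 0 - mu| at [tb - h] and [tb + h], where for odd n the signs are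
   opposite; a perturbation smaller than [eta] preserves them. *)
pose eta := m / n`!%:R * h ^+ n.
have eta0 : 0 < eta by apply: mulr_gt0; [exact: divr_gt0|exact: exprn_gt0].
have [nuD nuD0 nuDP] := bound_sqrt_lt (C0 * K) eta (mulr_ge0 C00 K0) eta0.
exists (Num.min (nu0 / 2) nuD).
  by rewrite lt_min divr_gt0//= nuD0/= gt_min ltr_pdivrMr// ltr_pMr// ltr1n.
move=> nu P E /andP[nu_gt0]; rewrite lt_min => /andP[nu_lt nuD_lt] A.
have nuI : 0 < nu < nu0 by rewrite nu_gt0/=; lra.
have [PD E0 EK] := Adm1 _ _ _ nu_gt0 A.
have CE : C0 * E < eta.
  have := nuDP nu; rewrite nu_gt0 => /(_ nuD_lt); apply: le_lt_trans.
  by rewrite -mulrA ler_wpM2l.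
pose Q k t := s0 * (P k t - (if k is 0%N then mu else 0)).
have QD : derivative_chain R Q l r.
  exact/derivative_chain_scale/derivative_chain_shift/(derivative_chain_sub _ 0 T).
have Qn t : t \in `]l, r[ -> Q n t != 0.
  move=> tI; have [+ _] := closeP _ _ _ _ nuI A tI.
  by rewrite /Q; case: (n) n0 => // k _; rewrite subr0; move/gt_eqF ->.
have QG t : t \in `]l, r[ -> `|Q 0%N t - G 0%N t| <= C0 * E.
  move=> tI; rewrite /Q /G -mulrBr ns0 opprB addrA subrK.
  exact: (C0P _ _ _ nu_gt0 A t (oc _ tI)).
have hrI : tb + h \in `]l, r[ by rewrite /l /r in_itv/=; lra.
have hlI : tb - h \in `]l, r[ by rewrite /l /r in_itv/=; lra.
have hr' : tb + h \in `[tb, r[.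
  by rewrite in_itv/= lerDl (ltW h0)/= /r ltrD2l.
have hl' : tb - h \in `]l, tb].
  by rewrite in_itv/= /l ltrD2l ltrN2 ht/= gerDl oppr_le0 ltW.
have er : tb + h - tb = h by rewrite addrAC subrr add0r.
have el : tb - (tb - h) = h by rewrite opprB addrC subrK.
have Gr : eta <= G 0%N (tb + h).
  by have := taylor_lower_right _ G l r tb m n GD tbI' G0 Gm _ hr'; rewrite er.
have Gl : eta <= - G 0%N (tb - h).
  have := taylor_lower_left _ G l r tb m n GD tbI' G0 Gm _ hl'.
  by rewrite el -signr_odd on expr1 mulN1r.
have := QG _ hrI; have := QG _ hlI; rewrite !ler_norml => /andP[_ kl] /andP[kr _].
have Qr : 0 < Q 0%N (tb + h) by clear -kr Gr CE; lra.
have Ql : Q 0%N (tb - h) < 0 by clear -kl Gl CE; lra.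
have [|||t [tI Qt ct]] := exists_changes_sign _ Q l r n (tb - h) (tb + h) QD Qn _ _ _ Ql Qr.
- by rewrite /l; lra.
- by lra.
- by rewrite /r; lra.
exists t; split.
- by move: tI; rewrite /h !in_itv/= => /andP[? ?]; apply/andP; split; lra.
- exact: changes_sign_scale ct.
- by move/eqP: Qt; rewrite /Q mulf_eq0 (negbTE s00) => /eqP.
Qed.

End perturbed_zeros.

(** * Integrals of continuous functions on an interval *)

Section interval_integrals.
Variable R : realType.
Implicit Types (f g F : R -> R) (a b c : R).
Notation leb := (@lebesgue_measure R).

(** Continuity is asked for on the whole line; functions known only on a closed interval or on the
    closed cylinder are composed with [clamp] before they enter such integrals. *)
Lemma continuous_integrable_oo f a b : continuous f ->
  leb.-integrable `]a, b[ (EFin \o f).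
Proof.
move=> cf; have h : leb.-integrable `[a, b] (EFin \o f).
  apply: continuous_compact_integrable; first exact: segment_compact.
  exact: continuous_subspaceT.
by apply: integrableS h => //; exact: subset_itv_oo_cc.
Qed.

Lemma Rintegral_ooD f g a b : continuous f -> continuous g ->
  \int[leb]_(x in `]a, b[) (f x + g x) =
  \int[leb]_(x in `]a, b[) f x + \int[leb]_(x in `]a, b[) g x.
Proof. by move=> cf cg; apply: RintegralD => //; exact: continuous_integrable_oo. Qed.

Lemma Rintegral_ooB f g a b : continuous f -> continuous g ->
  \int[leb]_(x in `]a, b[) (f x - g x) =
  \int[leb]_(x in `]a, b[) f x - \int[leb]_(x in `]a, b[) g x.
Proof. by move=> cf cg; apply: RintegralB => //; exact: continuous_integrable_oo. Qed.

Lemma Rintegral_ooZ c f a b : continuous f ->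
  \int[leb]_(x in `]a, b[) (c * f x) = c * \int[leb]_(x in `]a, b[) f x.
Proof. by move=> cf; apply: RintegralZl => //; exact: continuous_integrable_oo. Qed.

Lemma continuous_sum_seq (I : Type) (s : seq I) (F : I -> R -> R) :
  (forall i, continuous (F i)) -> continuous (fun x => \sum_(i <- s) F i x).
Proof.
move=> cF; elim: s => [|i s IHs].
  by under eq_fun do rewrite big_nil; exact: cst_continuous.
under eq_fun do rewrite big_cons.
by move=> x; apply: continuousD; [exact: cF|exact: IHs].
Qed.

Lemma Rintegral_oo_sum (I : Type) (s : seq I) (F : I -> R -> R) a b :
  (forall i, continuous (F i)) ->
  \int[leb]_(x in `]a, b[) (\sum_(i <- s) F i x) =
  \sum_(i <- s) \int[leb]_(x in `]a, b[) F i x.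
Proof.
move=> cF; elim: s => [|i s IHs].
  rewrite big_nil; under eq_Rintegral do rewrite big_nil.
  by rewrite Rintegral_cst// mul0r.
rewrite big_cons; under eq_Rintegral do rewrite big_cons.
by rewrite Rintegral_ooD// ?IHs//; exact: continuous_sum_seq.
Qed.

Lemma le_Rintegral_oo f g a b : continuous f -> continuous g ->
  (forall x, x \in `]a, b[ -> f x <= g x) ->
  \int[leb]_(x in `]a, b[) f x <= \int[leb]_(x in `]a, b[) g x.
Proof. by move=> cf cg fg; apply: le_Rintegral => //; exact: continuous_integrable_oo. Qed.

Lemma Rintegral_oo_cc f a b : continuous f ->
  \int[leb]_(x in `]a, b[) f x = \int[leb]_(x in `[a, b]) f x.
Proof.
move=> cf.
have h : leb.-integrable `[a, b] (EFin \o f).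
  apply: continuous_compact_integrable; first exact: segment_compact.
  exact: continuous_subspaceT.
rewrite Rintegral_itv_obnd_cbnd; last exact: continuous_integrable_oo.
by apply: Rintegral_itv_bndo_bndc; apply: integrableS h => //; exact: subset_itv_co_cc.
Qed.

Lemma Rintegral_oo_FTC F f a b : a < b -> continuous f ->
  (forall t : R, is_derive t 1 F (f t)) ->
  \int[leb]_(x in `]a, b[) f x = F b - F a.
Proof.
move=> ab cf FD; rewrite Rintegral_oo_cc// /Rintegral (@continuous_FTC2 R f F)//.
- exact: continuous_subspaceT.
- have cF t : {for t, continuous F} by exact: is_derive_continuous (FD t).
  split.
  + by move=> t _; case: (FD t).
  + exact/cvg_at_right_filter/cF.
  + exact/cvg_at_left_filter/cF.
- by move=> t _; rewrite derive1E; case: (FD t).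
Qed.

Lemma Rintegral_oo_parts F G f g a b : a < b -> continuous f -> continuous g ->
  (forall t : R, is_derive t 1 F (f t)) -> (forall t : R, is_derive t 1 G (g t)) ->
  \int[leb]_(x in `]a, b[) (f x * G x) =
  F b * G b - F a * G a - \int[leb]_(x in `]a, b[) (F x * g x).
Proof.
move=> ab cf cg FD GD.
have cF : continuous F by move=> t; exact: is_derive_continuous (FD t).
have cG : continuous G by move=> t; exact: is_derive_continuous (GD t).
have c1 := continuous_mulE _ _ _ cf cG.
have c2 := continuous_mulE _ _ _ cF cg.
have c3 := continuous_addE _ _ _ c1 c2.
apply/eqP; rewrite eq_sym subr_eq -Rintegral_ooD//; apply/eqP/esym.
apply: (Rintegral_oo_FTC (fun x => F x * G x)) => //.
by move=> t; exact: is_derive_mulE (FD t) (GD t).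
Qed.

Lemma exists_antiderivative f a b : continuous f -> a < b ->
  exists F, forall t : R, t \in `]a, b[ -> is_derive t 1 F (f t).
Proof.
move=> cf ab; exists (fun x => \int[leb]_(t in `[a, x]) f t) => t.
rewrite in_itv/= => /andP[at' tb].
have [] := @continuous_FTC1_closed R f a t b tb _ at' (cf t).
  apply: continuous_compact_integrable; first exact: segment_compact.
  exact: continuous_subspaceT.
by rewrite derive1E => ? ?; exact: DeriveDef.
Qed.

Lemma Cauchy_Schwarz_oo f g a b : continuous f -> continuous g ->
  (\int[leb]_(x in `]a, b[) (f x * g x)) ^+ 2 <=
  \int[leb]_(x in `]a, b[) (f x ^+ 2) * \int[leb]_(x in `]a, b[) (g x ^+ 2).
Proof.
move=> cf cg.
have cfg := continuous_mulE _ _ _ cf cg.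
have cff := continuous_sqrE _ _ cf.
have cgg := continuous_sqrE _ _ cg.
set A := Rintegral _ _ _; set B := Rintegral _ _ _; set C := Rintegral _ _ _.
have A2 : A ^+ 2 = 0 -> A ^+ 2 <= B * C.
  by move=> ->; rewrite mulr_ge0// Rintegral_ge0// => x _; exact: sqr_ge0.
have B0 : 0 <= B by apply: Rintegral_ge0 => x _; exact: sqr_ge0.
have C0 : 0 <= C by apply: Rintegral_ge0 => x _; exact: sqr_ge0.
have quad s : 0 <= B - 2 * s * A + s ^+ 2 * C.
  have : 0 <= \int[leb]_(x in `]a, b[) ((f x - s * g x) ^+ 2).
    by apply: Rintegral_ge0 => x _; exact: sqr_ge0.
  rewrite (_ : Rintegral _ _ _ = \int[leb]_(x in `]a, b[) (f x ^+ 2 - (2 * s) * (f x * g x) + s ^+ 2 * g x ^+ 2)); last first.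
    by congr Rintegral; apply/funext => x; ring.
  have c1 := continuous_scaleE _ (2 * s) _ cfg.
  have c2 := continuous_scaleE _ (s ^+ 2) _ cgg.
  have c3 := continuous_subE _ _ _ cff c1.
  by rewrite Rintegral_ooD// Rintegral_ooB// !Rintegral_ooZ.
have [C00|C00] := eqVneq C 0.
  have [->|A0] := eqVneq A 0; first by rewrite expr0n/= mulr_ge0.
  (* For C = 0 the quadratic is affine in [s], and at this [s] its value is -1. *)
  have := quad ((B + 1) / (2 * A)).
  rewrite C00 mulr0 addr0 (_ : 2 * _ * A = B + 1); last by field; rewrite A0.
  lra.
have {}C0 : 0 < C by rewrite lt_neqAle eq_sym C00.
have := quad (A / C).
rewrite (_ : B - _ + _ = B - A ^+ 2 / C); last by field.
by rewrite subr_ge0 ler_pdivrMr.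
Qed.

End interval_integrals.

(** * Completeness of the Robin eigenfunctions *)

Section poincare.
Variable R : realType.
Implicit Types (h dh : R -> R).
Notation leb := (@lebesgue_measure R).

(* Completing the square: with [b] the far end of the half interval,
   [H - kappa * tan (kappa * (b - x)) * h ^ 2] is nondecreasing; the tangent
   vanishes at [b] and [h] vanishes at [z]. *)
Lemma half_interval_right h dh (H : R -> R) (kappa z b : R) :
  (forall t : R, is_derive t 1 h (dh t)) ->
  0 <= kappa -> z < b -> kappa * (b - z) < pi / 2 ->
  (forall t : R, t \in `[z, b] -> is_derive t 1 H (dh t ^+ 2 - kappa ^+ 2 * h t ^+ 2)) ->
  h z = 0 -> H z <= H b.
Proof.
move=> hD k0 zb kb HD hz.
have cos0 (t : R) : t \in `[z, b] -> cos (kappa * (b - t)) != 0.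
  rewrite in_itv/= => /andP[zt tb].
  rewrite gt_eqF// cos_gt0_pihalf//; apply/andP; split.
    by rewrite (@lt_le_trans _ _ 0)// ?oppr_lt0 ?divr_gt0 ?pi_gt0// mulr_ge0// subr_ge0.
  by apply: le_lt_trans kb; rewrite ler_wpM2l// lerD2l lerN2.
pose tn t : R := tan (kappa * (b - t)).
pose Psi t : R := H t - kappa * (tn t * h t ^+ 2).
have PD (t : R) : t \in `[z, b] -> is_derive t 1 Psi ((dh t - kappa * tn t * h t) ^+ 2).
  move=> tI.
  have d1 : is_derive t 1 (fun t => kappa * (b - t)) (- kappa).
    by apply: (is_derive_eq (is_derive_scaleE _ _ _ _ _ (is_derive_subE _ _ _ _ _ _
      (is_derive_cstE _ b t) (is_derive_id t 1)))); rewrite sub0r mulrN1.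
  have d2 : is_derive t 1 tn ((cos (kappa * (b - t))) ^-2 * - kappa).
    exact: is_derive_compE _ (@tan R) (fun t => kappa * (b - t)) t _ _ (is_derive_tan (cos0 t tI)) d1.
  have d3 := is_derive_mulE _ tn _ t _ _ d2 (is_derive_expE _ h t _ 1 (hD t)).
  have d4 := is_derive_subE _ H _ t _ _ (HD t tI) (is_derive_scaleE _ kappa _ t _ d3).
  apply: (is_derive_eq d4).
  by rewrite cos2_tan2 ?cos0// -/(tn t); ring.
have Pcont : {within `[z, b], continuous Psi}.
  by apply: derivable_within_continuous => t tI; case: (PD t tI).
have PDo (t : R) : t \in `]z, b[ -> is_derive t 1 Psi ((dh t - kappa * tn t * h t) ^+ 2).
  by move=> tI; apply/PD/subset_itv_oo_cc.
have [c _ hc] := MVT zb PDo Pcont.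
have : Psi z <= Psi b by rewrite -subr_ge0 hc mulr_ge0 ?sqr_ge0// subr_ge0 ltW.
by rewrite /Psi /tn hz expr0n/= !mulr0 subr0 subrr mulr0 tan0 mul0r mulr0 subr0.
Qed.

Lemma half_interval_left h dh (H : R -> R) (kappa a z : R) :
  (forall t : R, is_derive t 1 h (dh t)) ->
  0 <= kappa -> a < z -> kappa * (z - a) < pi / 2 ->
  (forall t : R, t \in `[a, z] -> is_derive t 1 H (dh t ^+ 2 - kappa ^+ 2 * h t ^+ 2)) ->
  h z = 0 -> H a <= H z.
Proof.
move=> hD k0 az kz HD hz.
pose g t : R := h (- t); pose dg t : R := - dh (- t); pose G t : R := - H (- t).
have dopp (t : R) : is_derive t 1 -%R (- 1 : R) by exact: is_deriveNid.
have gD (t : R) : is_derive t 1 g (dg t).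
  by apply: (is_derive_eq (is_derive_compE _ h -%R t _ _ (hD _) (dopp t))); rewrite mulrN1.
have GD (t : R) : t \in `[- z, - a] -> is_derive t 1 G (dg t ^+ 2 - kappa ^+ 2 * g t ^+ 2).
  move=> tI; have tI' : - t \in `[a, z].
    by move: tI; rewrite !in_itv/= => /andP[? ?]; apply/andP; split; lra.
  have d1 := is_derive_compE _ H -%R t _ _ (HD _ tI') (dopp t).
  have := is_derive_scaleE _ (-1) _ _ _ d1.
  rewrite (_ : (fun x : R => -1 * H (- x)) = G); last by apply/funext => s; rewrite mulN1r.
  by move=> d2; apply: (is_derive_eq d2); rewrite /dg /g; ring.
have := @half_interval_right g dg G kappa (- z) (- a) gD k0.
rewrite ltrN2 opprK addrC az /G /g !opprK hz lerN2; exact.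
Qed.

(** The zeros are the midpoints of N equal cells, so each of the 2N half cells has a zero at one
    end. Its length is 1/(2N), and the bound on [kappa] says exactly that kappa / (2N) < pi / 2, as
    the half-interval estimates require. The ends of the cells are free, because the tangent
    vanishes there. *)
Lemma poincare_midpoints h dh (kappa : R) N : (0 < N)%N ->
  (forall t : R, is_derive t 1 h (dh t)) -> continuous dh ->
  0 <= kappa -> kappa < N%:R * pi ->
  (forall i, (i < N)%N -> h ((2 * i).+1%:R / (2 * N)%:R) = 0) ->
  kappa ^+ 2 * \int[leb]_(x in `]0, 1[) (h x ^+ 2) <=
  \int[leb]_(x in `]0, 1[) (dh x ^+ 2).
Proof.
move=> N0 hD cdh k0 kN hz.
have ch : continuous h by move=> t; exact: is_derive_continuous (hD t).
pose f x : R := dh x ^+ 2 - kappa ^+ 2 * h x ^+ 2.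
have cf : continuous f.
  apply: continuous_subE; first exact: continuous_sqrE.
  exact/continuous_scaleE/continuous_sqrE.
(* An interval larger than [0,1] makes [H] differentiable at 0 and 1 as well. *)
have [H HD] := exists_antiderivative R f (-1) 2 cf (ltac:(lra) : -1 < 2 :> R).
pose x k : R := k%:R / (2 * N)%:R.
have N20 : 0 < (2 * N)%:R :> R by rewrite ltr0n muln_gt0.
have xI k (t : R) : (k < 2 * N)%N -> t \in `[x k, x k.+1] -> t \in `]-1, 2[.
  move=> kN2; rewrite /x !in_itv/= => /andP[h1 h2].
  have : 0 <= k%:R / (2 * N)%:R :> R by rewrite divr_ge0.
  have : k.+1%:R / (2 * N)%:R <= 1 :> R by rewrite ler_pdivrMr// mul1r ler_nat.
  by move=> ? ?; apply/andP; split; lra.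
have xlt k : x k < x k.+1 by rewrite /x ltr_pM2r ?invr_gt0// ltr_nat.
have klt k : kappa * (x k.+1 - x k) < pi / 2.
  rewrite /x -mulrBl -natrB// subSnn mul1r ltr_pdivrMr// natrM.
  by rewrite (_ : pi / 2 * _ = N%:R * pi)//; field.
have step k : (k < 2 * N)%N -> H (x k) <= H (x k.+1).
  move=> kN2; have HD' (t : R) : t \in `[x k, x k.+1] -> is_derive t 1 H (f t).
    by move=> /(xI k t kN2)/HD.
  (* For odd [k] the zero is the left end [x k] of the half cell, for even [k] the right end
     [x k.+1]. *)
  have [ek|ok] := boolP (odd k).
    apply: (half_interval_right h dh H kappa) => //.
    rewrite /x -(odd_double_half k) ek add1n -mul2n hz//.
    by rewrite -(ltn_pmul2l (isT : (0 < 2)%N)) (leq_ltn_trans _ kN2)// mul2n -[leqRHS]odd_double_half leq_addl.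
  apply: (half_interval_left h dh H kappa) => //.
  rewrite /x -(odd_double_half k) (negbTE ok) add0n -mul2n hz//.
  by rewrite -(ltn_pmul2l (isT : (0 < 2)%N)) (leq_ltn_trans _ kN2)// mul2n -[leqRHS]odd_double_half leq_addl.
have mono k : (k <= 2 * N)%N -> H (x 0%N) <= H (x k).
  elim: k => // k IHk kN2; apply: (le_trans (IHk _)); first exact: ltnW.
  exact: step.
have := mono (2 * N)%N (leqnn _).
rewrite /x mul0r divff ?gt_eqF// -subr_ge0 => H01.
have If : \int[leb]_(t in `]0, 1[) f t = H 1 - H 0.
  rewrite Rintegral_oo_cc// /Rintegral (@continuous_FTC2 R f H)//.
  - exact: continuous_subspaceT.
  - have HDt (t : R) : 0 <= t <= 1 -> is_derive t 1 H (f t).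
      by move=> /andP[? ?]; apply: HD; rewrite in_itv/=; apply/andP; split; lra.
    split.
    + by move=> t; rewrite in_itv/= => /andP[? ?]; have [] := HDt t _; first by rewrite !ltW.
    + by apply/cvg_at_right_filter/(is_derive_continuous _ _ _ _ (HDt 0 _)); rewrite lexx ler01.
    + by apply/cvg_at_left_filter/(is_derive_continuous _ _ _ _ (HDt 1 _)); rewrite lexx ler01.
  - move=> t; rewrite in_itv/= derive1E => /andP[? ?]; have [] := HD t _ => //.
    by rewrite in_itv/=; apply/andP; split; lra.
rewrite -subr_ge0 -Rintegral_ooZ; last exact: continuous_sqrE.
rewrite -Rintegral_ooB; [|exact: continuous_sqrE|exact/continuous_scaleE/continuous_sqrE].
by rewrite If.
Qed.

End poincare.

(** * Robin eigenfunctions and the expansion of the constant 1 *)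

Section robin_eigenfunctions.
Variables (R : realType) (alpha : R).
Hypothesis alpha_gt0 : 0 < alpha.
Implicit Types (f df : R -> R).
Notation leb := (@lebesgue_measure R).

(** This is the Robin condition at x = 1 for cos(w x), written without the tangent and its poles. At
    the two ends alpha cos w - w sin w equals alpha (-1)^k and - (k pi + pi / 2) (-1)^k, of opposite
    signs. Confining w to the first half of each interval of length pi orders the frequencies. *)
Lemma robin_frequency_exists k : exists w : R,
  (k%:R * pi < w < k%:R * pi + pi / 2) && (w * sin w == alpha * cos w).
Proof.
pose f w : R := alpha * cos w - w * sin w.
have cf : continuous f.
  apply: continuous_subE; first exact/continuous_scaleE/continuous_cos.
  by apply: continuous_mulE; [by move=> ?; exact: cvg_id|exact: continuous_sin].
pose u : R := k%:R * pi; pose v := u + pi / 2.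
have pi0 : 0 < pi :> R := pi_gt0 R.
have u0 : 0 <= u by rewrite mulr_ge0// ltW.
have uv : u <= v by rewrite lerDl divr_ge0// ltW.
have su : sin u = 0 by rewrite /u mulrC mulr_natr -(add0r (_ *+ _)) (alternatingn (@sinDpi R)) sin0 mulr0.
have cu : cos u = (-1) ^+ k.
  by rewrite /u mulrC mulr_natr -(add0r (_ *+ _)) (alternatingn (@cosDpi R)) cos0 mulr1.
have fu : f u = alpha * (-1) ^+ k by rewrite /f su cu mulr0 subr0.
have fv : f v = - v * (-1) ^+ k.
  by rewrite /f /v sinDpihalf cosDpihalf su cu oppr0 mulr0 sub0r mulNr.
have fuv : f u * f v < 0.
  rewrite fu fv mulrACA -expr2 -exprM mulnC exprM sqrrN !expr1n mulr1 mulrN oppr_lt0.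
  by rewrite mulr_gt0// /v; lra.
have [w wI fw] := IVT_zero R f u v uv (continuous_subspaceT cf) (ltW fuv).
exists w; apply/andP; split; last by move/eqP: fw; rewrite /f subr_eq0 eq_sym.
move: wI; rewrite in_itv/= => /andP[uw wv]; apply/andP; split.
  have uw' : u != w by apply: contraTneq fuv => ->; rewrite fw mul0r ltxx.
  by rewrite lt_neqAle uw'.
have wv' : w != v by apply: contraTneq fuv => <-; rewrite fw mulr0 ltxx.
by rewrite lt_neqAle wv'.
Qed.

Definition freq k : R := xchoose (robin_frequency_exists k).

Lemma freq_bounds k : k%:R * pi < freq k < k%:R * pi + pi / 2.
Proof. by have /andP[] := xchooseP (robin_frequency_exists k). Qed.

Lemma freq_eq k : freq k * sin (freq k) = alpha * cos (freq k).
Proof. by have /andP[_ /eqP] := xchooseP (robin_frequency_exists k). Qed.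

Lemma freq_gt0 k : 0 < freq k.
Proof.
have /andP[+ _] := freq_bounds k; apply: le_lt_trans.
by rewrite mulr_ge0// pi_ge0.
Qed.

Lemma freq_lt j k : (j < k)%N -> freq j < freq k.
Proof.
move=> jk; have /andP[_ h1] := freq_bounds j; have /andP[h2 _] := freq_bounds k.
apply: (lt_trans h1); apply: le_lt_trans h2.
apply: (@le_trans _ _ (j.+1%:R * pi)).
  have -> : j.+1%:R = j%:R + 1 :> R by rewrite natr1.
  by have := pi_ge0 R; lra.
by rewrite ler_wpM2r ?pi_ge0// ler_nat.
Qed.

Definition robin_eigenvalue k : R := freq k ^+ 2.
Definition robin_eigenfun k (x : R) : R := cos (freq k * x).
Let deigenfun k (x : R) : R := - freq k * sin (freq k * x).
Notation lam := robin_eigenvalue.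
Notation e := robin_eigenfun.
Notation de := deigenfun.

Lemma is_derive_cosM (c t : R) : is_derive t 1 (fun x => cos (c * x)) (- c * sin (c * t)).
Proof.
have := is_derive_compE _ (@cos R) (fun x => c * x) t _ _ (is_derive_cos _) (is_derive_mulc R c t).
by move=> d; apply: (is_derive_eq d); rewrite mulNr mulrC mulNr.
Qed.

Lemma is_derive_sinM (c t : R) : is_derive t 1 (fun x => sin (c * x)) (c * cos (c * t)).
Proof.
have := is_derive_compE _ (@sin R) (fun x => c * x) t _ _ (is_derive_sin _) (is_derive_mulc R c t).
by move=> d; apply: (is_derive_eq d); rewrite mulrC.
Qed.

Lemma continuous_cosM (c : R) : continuous (fun x => cos (c * x)).
Proof. by move=> t; exact: is_derive_continuous (is_derive_cosM c t). Qed.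

Lemma continuous_sinM (c : R) : continuous (fun x => sin (c * x)).
Proof. by move=> t; exact: is_derive_continuous (is_derive_sinM c t). Qed.

Lemma continuous_eigenfun k : continuous (e k).
Proof. exact: continuous_cosM. Qed.

Let continuous_deigenfun k : continuous (de k).
Proof. exact/continuous_scaleE/continuous_sinM. Qed.

Let is_derive_eigenfun k (t : R) : is_derive t 1 (e k) (de k t).
Proof. exact: is_derive_cosM. Qed.

(** The left-hand side is the energy form of the Robin problem. No boundary condition on [f] enters:
    sin 0 = 0 removes the boundary term at 0, and the frequency equation turns the one at 1 into the
    Robin term. *)
Lemma eigenfun_weak k f df : (forall t : R, is_derive t 1 f (df t)) -> continuous df ->
  \int[leb]_(x in `]0, 1[) (df x * de k x) + alpha * (f 1 * e k 1) =
  lam k * \int[leb]_(x in `]0, 1[) (f x * e k x).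
Proof.
move=> fD cdf.
have cf : continuous f by move=> t; exact: is_derive_continuous (fD t).
have dde (t : R) : is_derive t 1 (de k) (- lam k * e k t).
  apply: (is_derive_eq (is_derive_scaleE _ (- freq k) _ t _ (is_derive_sinM (freq k) t))).
  by rewrite /lam /e; ring.
have ce : continuous (fun t => - lam k * e k t) by exact/continuous_scaleE/continuous_eigenfun.
have cfe := continuous_mulE _ _ _ cf (continuous_eigenfun k).
rewrite (Rintegral_oo_parts _ f (de k) df _ 0 1 _ cdf ce fD dde)//.
have -> : \int[leb]_(x in `]0, 1[) (f x * (- lam k * e k x)) =
    - lam k * \int[leb]_(x in `]0, 1[) (f x * e k x).
  by rewrite -Rintegral_ooZ//; congr Rintegral; apply/funext => x; ring.
rewrite /de /e !mulr0 sin0 !mulr0 !mulr1 subr0.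
have := freq_eq k; set s := sin _; set c := cos _ => h.
have -> : f 1 * (- freq k * s) = - (f 1 * (freq k * s)) by ring.
by rewrite h; ring.
Qed.

Lemma eigenfun_orthogonal j k : j != k ->
  \int[leb]_(x in `]0, 1[) (e j x * e k x) = 0.
Proof.
move=> jk.
have h1 := eigenfun_weak k (e j) (de j) (is_derive_eigenfun j) (@continuous_deigenfun j).
have := eigenfun_weak j (e k) (de k) (is_derive_eigenfun k) (@continuous_deigenfun k).
have -> : \int[leb]_(x in `]0, 1[) (de k x * de j x) = \int[leb]_(x in `]0, 1[) (de j x * de k x).
  by congr Rintegral; apply/funext => x; rewrite mulrC.
have -> : \int[leb]_(x in `]0, 1[) (e k x * e j x) = \int[leb]_(x in `]0, 1[) (e j x * e k x).
  by congr Rintegral; apply/funext => x; rewrite mulrC.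
rewrite (mulrC (e k 1)) h1 => /eqP; rewrite -subr_eq0 -mulrBl mulf_eq0 => /orP[|/eqP//].
rewrite subr_eq0 /lam eqrXn2 ?ltW ?freq_gt0// => /eqP ejk.
by move: jk; rewrite neq_ltn => /orP[] /freq_lt; rewrite ejk ltxx.
Qed.

Definition eigenfun_norm2 k : R := \int[leb]_(x in `]0, 1[) (e k x * e k x).
Notation nn := eigenfun_norm2.

(** The squared norm is 1/2 + cos w sin w / (2 w), and by the frequency equation cos w sin w = alpha
    cos^2 w / w is nonnegative. *)
Lemma eigenfun_norm2_ge k : 2^-1 <= nn k.
Proof.
pose w := freq k.
have w0 : w != 0 by rewrite gt_eqF// freq_gt0.
pose F x : R := 2^-1 * x + (2 * w)^-1 * (cos (w * x) * sin (w * x)).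
have FD (t : R) : is_derive t 1 F (e k t * e k t).
  have d1 := is_derive_mulE _ _ _ t _ _ (is_derive_cosM w t) (is_derive_sinM w t).
  have d2 := is_derive_addE _ _ _ t _ _ (is_derive_mulc R 2^-1 t)
    (is_derive_scaleE _ (2 * w)^-1 _ t _ d1).
  apply: (is_derive_eq d2); rewrite /e -/w.
  have := sin2cos2 (w * t); set c := cos _; set s := sin _ => h.
  have -> : - w * s * s + c * (w * c) = w * (c ^+ 2 - s ^+ 2) by ring.
  by rewrite h; field.
rewrite /nn (Rintegral_oo_FTC R F) //; last first.
  by apply: continuous_mulE; exact: continuous_eigenfun.
rewrite /F !mulr0 sin0 !mulr0 addr0 subr0 !mulr1 lerDl.
have -> : cos w * sin w = alpha * cos w ^+ 2 / w.
  by apply: (mulIf w0); rewrite divfK// -mulrA (mulrC (sin w)) freq_eq; ring.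
have w1 : 0 <= w by exact/ltW/freq_gt0.
apply: mulr_ge0; first by rewrite invr_ge0 mulr_ge0.
by rewrite divr_ge0// mulr_ge0 ?sqr_ge0// ltW.
Qed.

Lemma eigenfun_norm2_gt0 k : 0 < nn k.
Proof. by apply: lt_le_trans (eigenfun_norm2_ge k); rewrite invr_gt0. Qed.

Lemma eigenfun_norm2_le1 k : nn k <= 1.
Proof.
have -> : 1 = \int[leb]_(x in `]0, 1[) (1 : R).
  by rewrite Rintegral_cst//= lebesgue_measure_itv/= lte_fin ltr01 oppr0 adde0 mulr1.
apply: le_Rintegral_oo.
- by apply: continuous_mulE; exact: continuous_eigenfun.
- exact: cst_continuous.
- move=> x _; rewrite -expr2 -real_normK ?num_real// expr_le1//.
  exact: cos_max.
Qed.

Definition one_coef k : R := (\int[leb]_(x in `]0, 1[) (e k x)) / nn k.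

Definition one_remainder N (x : R) : R := 1 - \sum_(k < N) one_coef k * e k x.
Let done_remainder N (x : R) : R := - \sum_(k < N) one_coef k * de k x.
Notation r := one_remainder.
Notation dr := done_remainder.

Let is_derive_comb N (v : 'I_N -> R) (t : R) :
  is_derive t 1 (fun x => \sum_(k < N) v k * e k x) (\sum_(k < N) v k * de k t).
Proof. by apply: is_derive_sum_seq => i; exact: is_derive_scaleE. Qed.

Let continuous_comb N (v : 'I_N -> R) : continuous (fun x => \sum_(k < N) v k * e k x).
Proof. by apply: continuous_sum_seq => i; exact/continuous_scaleE/continuous_eigenfun. Qed.

Let continuous_dcomb N (v : 'I_N -> R) : continuous (fun x => \sum_(k < N) v k * de k x).
Proof. by apply: continuous_sum_seq => i; exact/continuous_scaleE/continuous_deigenfun. Qed.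

Let is_derive_remainder N (t : R) : is_derive t 1 (r N) (dr N t).
Proof.
apply: (is_derive_eq (is_derive_subE _ _ _ t _ _ (is_derive_cstE _ 1 t) (is_derive_comb N one_coef t))).
by rewrite sub0r.
Qed.

Lemma continuous_remainder N : continuous (r N).
Proof. by move=> t; exact: is_derive_continuous (is_derive_remainder N t). Qed.

Let continuous_dremainder N : continuous (dr N).
Proof. by move=> t; apply: continuousN; exact: continuous_dcomb. Qed.

Lemma Rintegral_comb N (v : 'I_N -> R) f : continuous f ->
  \int[leb]_(x in `]0, 1[) (f x * \sum_(k < N) v k * e k x) =
  \sum_(k < N) v k * \int[leb]_(x in `]0, 1[) (f x * e k x).
Proof.
move=> cf; transitivity (\int[leb]_(x in `]0, 1[) (\sum_(k < N) v k * (f x * e k x))).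
  by congr Rintegral; apply/funext => x; rewrite big_distrr/=; apply: eq_bigr => k _; ring.
have cfe k := continuous_mulE _ _ _ cf (continuous_eigenfun k).
rewrite Rintegral_oo_sum; last by move=> i; exact/continuous_scaleE/cfe.
by apply: eq_bigr => k _; rewrite Rintegral_ooZ.
Qed.

Let Rintegral_dcomb N (v : 'I_N -> R) f : continuous f ->
  \int[leb]_(x in `]0, 1[) (f x * \sum_(k < N) v k * de k x) =
  \sum_(k < N) v k * \int[leb]_(x in `]0, 1[) (f x * de k x).
Proof.
move=> cf; transitivity (\int[leb]_(x in `]0, 1[) (\sum_(k < N) v k * (f x * de k x))).
  by congr Rintegral; apply/funext => x; rewrite big_distrr/=; apply: eq_bigr => k _; ring.
have cfe k := continuous_mulE _ _ _ cf (@continuous_deigenfun k).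
rewrite Rintegral_oo_sum; last by move=> i; exact/continuous_scaleE/cfe.
by apply: eq_bigr => k _; rewrite Rintegral_ooZ.
Qed.

Lemma eigenfun_comb N (v : 'I_N -> R) (j : 'I_N) :
  \int[leb]_(x in `]0, 1[) ((\sum_(k < N) v k * e k x) * e j x) = v j * nn j.
Proof.
transitivity (\int[leb]_(x in `]0, 1[) (e j x * \sum_(k < N) v k * e k x)).
  by congr Rintegral; apply/funext => x; rewrite mulrC.
rewrite Rintegral_comb; last exact: continuous_eigenfun.
rewrite (bigD1 j)//= -/(nn j) big1 ?addr0// => i ij.
by rewrite eigenfun_orthogonal ?mulr0// eq_sym.
Qed.

Lemma remainder_orthogonal N (j : 'I_N) :
  \int[leb]_(x in `]0, 1[) (r N x * e j x) = 0.
Proof.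
transitivity (\int[leb]_(x in `]0, 1[) (e j x - (\sum_(k < N) one_coef k * e k x) * e j x)).
  by congr Rintegral; apply/funext => x; rewrite /r mulrBl mul1r.
rewrite Rintegral_ooB.
- rewrite (eigenfun_comb N (fun k => one_coef k)) /one_coef divfK ?subrr//.
  by rewrite gt_eqF// eigenfun_norm2_gt0.
- exact: continuous_eigenfun.
- by apply: continuous_mulE; [exact: continuous_comb|exact: continuous_eigenfun].
Qed.

Let comb_norm2 N c (v : 'I_N -> R) :
  \int[leb]_(x in `]0, 1[) ((c * r N x + \sum_(k < N) v k * e k x) ^+ 2) =
  c ^+ 2 * \int[leb]_(x in `]0, 1[) (r N x ^+ 2) + \sum_(k < N) v k ^+ 2 * nn k.
Proof.
have cr := continuous_remainder N; have cv := continuous_comb N v.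
pose V x := \sum_(k < N) v k * e k x.
have c1 := continuous_scaleE _ (c ^+ 2) _ (continuous_sqrE _ _ cr).
have c2 := continuous_mulE _ _ _ cr cv.
have c3 := continuous_scaleE _ (2 * c) _ c2.
have c4 := continuous_mulE _ _ _ cv cv.
have c5 := continuous_addE _ _ _ c1 c3.
transitivity (\int[leb]_(x in `]0, 1[) (c ^+ 2 * r N x ^+ 2 + 2 * c * (r N x * V x) + V x * V x)).
  by congr Rintegral; apply/funext => x; rewrite /V; ring.
rewrite Rintegral_ooD// Rintegral_ooD// Rintegral_ooZ; last exact: continuous_sqrE.
rewrite Rintegral_ooZ// Rintegral_comb// big1 ?mulr0 ?addr0; last first.
  by move=> k _; rewrite remainder_orthogonal mulr0.
congr (_ + _); rewrite Rintegral_comb//; apply: eq_bigr => k _.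
by rewrite eigenfun_comb; ring.
Qed.

(** Pythagoras in the energy form: by [eigenfun_weak], a function orthogonal to the eigenfunctions
    in L^2 is orthogonal to them in energy, so the cross terms vanish. *)
Let comb_energy N c (v : 'I_N -> R) :
  \int[leb]_(x in `]0, 1[) ((c * dr N x + \sum_(k < N) v k * de k x) ^+ 2) +
    alpha * (c * r N 1 + \sum_(k < N) v k * e k 1) ^+ 2 =
  c ^+ 2 * (\int[leb]_(x in `]0, 1[) (dr N x ^+ 2) + alpha * r N 1 ^+ 2) +
  \sum_(k < N) v k ^+ 2 * (lam k * nn k).
Proof.
have cr := @continuous_dremainder N; have cv := @continuous_dcomb N v.
pose V x := \sum_(k < N) v k * de k x.
have c1 := continuous_scaleE _ (c ^+ 2) _ (continuous_sqrE _ _ cr).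
have c2 := continuous_mulE _ _ _ cr cv.
have c3 := continuous_scaleE _ (2 * c) _ c2.
have c4 := continuous_mulE _ _ _ cv cv.
have c5 := continuous_addE _ _ _ c1 c3.
have -> : \int[leb]_(x in `]0, 1[) ((c * dr N x + \sum_(k < N) v k * de k x) ^+ 2) =
   \int[leb]_(x in `]0, 1[) (c ^+ 2 * dr N x ^+ 2 + 2 * c * (dr N x * V x) + V x * V x).
  by congr Rintegral; apply/funext => x; rewrite /V; ring.
rewrite Rintegral_ooD// Rintegral_ooD// Rintegral_ooZ; last exact: continuous_sqrE.
rewrite Rintegral_ooZ// !Rintegral_dcomb//.
have weak f df : (forall t : R, is_derive t 1 f (df t)) -> continuous df ->
  \sum_(k < N) v k * \int[leb]_(x in `]0, 1[) (df x * de k x) =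
  \sum_(k < N) v k * (lam k * \int[leb]_(x in `]0, 1[) (f x * e k x)) -
  alpha * (f 1 * \sum_(k < N) v k * e k 1).
  move=> fD cdf; apply/eqP; rewrite eq_sym subr_eq eq_sym; apply/eqP.
  rewrite !big_distrr/= -big_split/=; apply: eq_bigr => k _.
  by rewrite -(eigenfun_weak k f df fD cdf); ring.
rewrite (weak _ _ (is_derive_remainder N))// (weak _ _ (is_derive_comb N v))//.
rewrite [X in _ * (X - _)]big1; last by move=> k _; rewrite remainder_orthogonal !mulr0.
have -> : \sum_(k < N) v k * (lam k * \int[leb]_(x in `]0, 1[) ((\sum_(i < N) v i * e i x) * e k x)) =
   \sum_(k < N) v k ^+ 2 * (lam k * nn k).
  by apply: eq_bigr => k _; rewrite eigenfun_comb; ring.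
by ring.
Qed.

(** The constant 1 has energy [alpha], and an orthogonal component has at most the energy of the
    whole. *)
Lemma remainder_energy N :
  \int[leb]_(x in `]0, 1[) (dr N x ^+ 2) + alpha * r N 1 ^+ 2 <= alpha.
Proof.
have := comb_energy N 1 (fun k => one_coef k).
have -> : \int[leb]_(x in `]0, 1[) ((1 * dr N x + \sum_(k < N) one_coef k * de k x) ^+ 2) = 0.
  transitivity (\int[leb]_(x in `]0, 1[) (0 : R)); last by rewrite Rintegral_cst// mul0r.
  by congr Rintegral; apply/funext => x; rewrite mul1r /dr addNr expr0n.
rewrite mul1r /r subrK expr1n mulr1 add0r mul1r => {2}->; rewrite lerDl.
apply: sumr_ge0 => k _; rewrite mulr_ge0 ?sqr_ge0// mulr_ge0 ?sqr_ge0//.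
exact/ltW/eigenfun_norm2_gt0.
Qed.

(* The span of [r N] and the first N eigenfunctions has dimension N + 1, so
   some nonzero [h] in it vanishes at the N midpoints; comparing the Poincare
   inequality for [h] with the eigenvalues below [kappa ^ 2] isolates [r N]. *)
Lemma remainder_bound N : (0 < N)%N ->
  (pi * (N%:R - 2^-1)) ^+ 2 * \int[leb]_(x in `]0, 1[) (r N x ^+ 2) <= alpha.
Proof.
(* This is (N - 1) pi + pi / 2, the upper bound for the N-th frequency: [kappa] exceeds the first N
   frequencies and stays below N pi, the limit in the Poincare inequality. *)
move=> N0; pose kappa : R := pi * (N%:R - 2^-1).
have pi0 : 0 < pi :> R := pi_gt0 R.
have N1 : 1 <= N%:R :> R by rewrite ler1n.
have k0 : 0 <= kappa by apply: mulr_ge0; [exact: ltW|lra].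
have kN : kappa < N%:R * pi by rewrite /kappa mulrC ltr_pM2r//; lra.
have lamk (k : 'I_N) : lam k < kappa ^+ 2.
  rewrite ltrXn2r// ?nnegrE ?ltW ?freq_gt0//.
  have /andP[_] := freq_bounds k; move/lt_le_trans; apply.
  have : k.+1%:R <= N%:R :> R by rewrite ler_nat.
  rewrite -natr1 /kappa => h.
  have -> : k%:R * pi + pi / 2 = pi * (k%:R + 2^-1) :> R by field.
  by apply: ler_wpM2l; [exact: ltW|lra].
pose z (j : nat) : R := (2 * j).+1%:R / (2 * N)%:R.
pose A : 'M[R]_(N.+1, N) := \matrix_(i, j)
  if unlift ord0 i is Some k then e k (z j) else r N (z j).
have /rowV0Pn[u /sub_kermxP uA u0] : kermx A != 0.
  rewrite kermx_eq0 /row_free; apply: contraTN (rank_leq_col A) => /eqP ->.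
  by rewrite ltnn.
pose c := u ord0 ord0; pose v (k : 'I_N) := u ord0 (lift ord0 k).
pose h x := c * r N x + \sum_(k < N) v k * e k x.
pose dh x := c * dr N x + \sum_(k < N) v k * de k x.
have hz (j : nat) : (j < N)%N -> h (z j) = 0.
  move=> jN; have /matrixP/(_ ord0 (Ordinal jN)) := uA.
  rewrite !mxE big_ord_recl/= !mxE unlift_none => <-; congr (_ + _).
  by apply: eq_bigr => k _; rewrite mxE liftK.
have hD (t : R) : is_derive t 1 h (dh t).
  exact: is_derive_addE _ _ _ t _ _ (is_derive_scaleE _ c _ t _ (is_derive_remainder N t)) (is_derive_comb N v t).
have cdh : continuous dh.
  apply: continuous_addE; last exact: continuous_dcomb.
  exact/continuous_scaleE/continuous_dremainder.
have := poincare_midpoints R h dh kappa N N0 hD cdh k0 kN hz.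
rewrite /h comb_norm2.
have h1 : 0 <= alpha * (c * r N 1 + \sum_(k < N) v k * e k 1) ^+ 2.
  by rewrite mulr_ge0 ?sqr_ge0// ltW.
have := comb_energy N c v; rewrite -/(dh _).
set E := \int[leb]_(x in _) _; set Q := \int[leb]_(x in _) _ + alpha * r N 1 ^+ 2.
set I0 := \int[leb]_(x in _) _ => h2 h3.
have QA : Q <= alpha := remainder_energy N.
have key : \sum_(k < N) v k ^+ 2 * nn k * (kappa ^+ 2 - lam k) <= c ^+ 2 * (Q - kappa ^+ 2 * I0).
  have -> : \sum_(k < N) v k ^+ 2 * nn k * (kappa ^+ 2 - lam k) =
    kappa ^+ 2 * (\sum_(k < N) v k ^+ 2 * nn k) - \sum_(k < N) v k ^+ 2 * (lam k * nn k).
    by rewrite big_distrr/= -sumrB; apply: eq_bigr => k _; ring.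
  lra.
have pos (k : 'I_N) : 0 <= v k ^+ 2 * nn k * (kappa ^+ 2 - lam k).
  rewrite mulr_ge0//; last by rewrite subr_ge0 ltW.
  by rewrite mulr_ge0 ?sqr_ge0// ltW// eigenfun_norm2_gt0.
apply: le_trans QA; rewrite -subr_ge0.
(* For c = 0 the nonnegative terms in [key] sum to zero, so every [v k] vanishes and [u] is zero, a
   contradiction. Otherwise [key] can be divided by c^2. *)
have [c0|c0] := eqVneq c 0; last first.
  by rewrite -(pmulr_rge0 _ (_ : 0 < c ^+ 2)) ?exprn_even_gt0//; apply: le_trans key; exact: sumr_ge0.
have : \sum_(k < N) v k ^+ 2 * nn k * (kappa ^+ 2 - lam k) = 0.
  apply/eqP; rewrite eq_le sumr_ge0// andbT.
  by move: key; rewrite c0 expr0n/= mul0r.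
move/eqP; rewrite psumr_eq0// => /allP v0.
case/eqP: u0; apply/rowP => i; rewrite mxE.
case: (unliftP ord0 i) => [k|] -> //.
have := v0 k; rewrite mem_index_enum => /(_ isT); rewrite /= !mulf_eq0 orbb.
by rewrite (gt_eqF (eigenfun_norm2_gt0 k)) subr_eq0 (gt_eqF (lamk k)) !orbF => /eqP.
Qed.

(** The error is the integral of [f] times the remainder of 1, so Cauchy-Schwarz and
    [remainder_bound] give the rate 1/N. *)
Lemma integral_one_expansion N f : (0 < N)%N -> continuous f ->
  `|\int[leb]_(x in `]0, 1[) f x -
    \sum_(k < N) one_coef k * \int[leb]_(x in `]0, 1[) (f x * e k x)| *
    (pi * (N%:R - 2^-1)) <=
  Num.sqrt (alpha * \int[leb]_(x in `]0, 1[) (f x ^+ 2)).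
Proof.
move=> N0 cf.
have -> : \int[leb]_(x in `]0, 1[) f x -
    \sum_(k < N) one_coef k * \int[leb]_(x in `]0, 1[) (f x * e k x) =
    \int[leb]_(x in `]0, 1[) (f x * r N x).
  rewrite -Rintegral_comb// -Rintegral_ooB//; last exact: continuous_mulE.
  by congr Rintegral; apply/funext => x; rewrite /r; ring.
have CS := Cauchy_Schwarz_oo R f (r N) 0 1 cf (continuous_remainder N).
have RB := remainder_bound N N0.
set X := Rintegral _ _ _ in CS *; set I2 := Rintegral _ _ _ in CS *.
set J := Rintegral _ _ _ in CS RB.
set K := pi * _ in RB *.
have N1 : 1 <= N%:R :> R by rewrite ler1n.
have K0 : 0 <= K by apply: mulr_ge0; [exact: pi_ge0|lra].
have I20 : 0 <= I2 by apply: Rintegral_ge0 => x _; exact: sqr_ge0.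
rewrite -(@ler_pXn2r _ 2)//; last 2 first.
- by rewrite nnegrE mulr_ge0.
- by rewrite nnegrE sqrtr_ge0.
rewrite exprMn real_normK ?num_real// sqr_sqrtr ?mulr_ge0 ?(ltW alpha_gt0)//.
apply: (le_trans (ler_wpM2r (sqr_ge0 K) CS)).
by rewrite (mulrC alpha) -mulrA ler_wpM2l// mulrC.
Qed.

(** Cauchy-Schwarz bounds the integral by 1, and the squared norm in the denominator is at least
    1/2. *)
Lemma one_coef_le k : `|one_coef k| <= 2.
Proof.
rewrite /one_coef normrM normfV (gtr0_norm (eigenfun_norm2_gt0 k)).
rewrite ler_pdivrMr ?eigenfun_norm2_gt0//.
apply: (@le_trans _ _ 1); last by have := eigenfun_norm2_ge k; lra.
rewrite -(@ler_pXn2r _ 2)// ?nnegrE// expr1n real_normK ?num_real//.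
have c1 : continuous (fun _ : R => 1 : R) by move=> ?; exact: cvg_cst.
have := Cauchy_Schwarz_oo R _ (e k) 0 1 c1 (continuous_eigenfun k).
have -> : \int[leb]_(x in `]0, 1[) (1 * e k x) = \int[leb]_(x in `]0, 1[) (e k x).
  by congr Rintegral; apply/funext => x; rewrite mul1r.
move/le_trans; apply; under eq_Rintegral do rewrite expr1n.
rewrite Rintegral_cst//= lebesgue_measure_itv/= lte_fin ltr01 oppr0 adde0 !mul1r.
exact: eigenfun_norm2_le1.
Qed.

End robin_eigenfunctions.

(** * Exponential series *)

Section dirichlet_series.
Variable R : realType.
Implicit Types (u a : nat -> R) (A B d s : R).

Lemma series_geometric_bound u (C q : R) : 0 <= q < 1 -> (forall k, `|u k| <= C * q ^+ k) ->
  cvgn (series u) /\ `|limn (series u)| <= C / (1 - q).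
Proof.
move=> /andP[q0 q1] uC.
have cg : cvgn (series (geometric C q)).
  by apply: is_cvg_geometric_series; rewrite ger0_norm.
have lg : limn (series (geometric C q)) = C / (1 - q).
  by apply/cvg_lim => //; apply: cvg_geometric_series; rewrite ger0_norm.
have cn : cvgn [normed series u].
  apply: series_le_cvg cg => //= k; first by rewrite (le_trans _ (uC k)).
split; first exact: normed_cvg.
by rewrite -lg; apply: (le_trans (lim_series_norm cn)); exact: lim_series_le.
Qed.

(** Everything follows from 1 + z <= e^z: at - z it reads e^z - 1 <= z e^z, that is e^z - 1 - z <= z
    (e^z - 1). *)
Lemma expR_sub1_bound (z : R) : `|expR z - 1 - z| <= z ^+ 2 * expR `|z|.
Proof.
have h1 := expR_ge1Dx z; have h2 := expR_ge1Dx (- z).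
have e0 := expR_gt0 z.
have h3 : expR z - 1 <= z * expR z.
  have := ler_wpM2r (ltW e0) h2; rewrite expRN mulVf ?gt_eqF//; lra.
rewrite ger0_norm; last by lra.
have [z0|z0] := leP 0 z.
  have : z * (expR z - 1) <= z * (z * expR z) by rewrite ler_wpM2l.
  by rewrite mulrA -expr2 ger0_norm//; lra.
apply: (@le_trans _ _ (z ^+ 2)); last first.
  by rewrite ler_peMr ?sqr_ge0// -expR0 ler_expR.
have : (- z) * (1 - expR z) <= (- z) * (- z) by rewrite ler_wpM2l; lra.
by rewrite expr2; lra.
Qed.

(** A second-order remainder at the single point [t] determines the derivative, so termwise
    differentiation of a series reduces to one summable bound. *)
Lemma is_derive_quadratic (f : R -> R) (t l B d : R) : 0 < d ->
  (forall h, `|h| < d -> `|f (t + h) - f t - h * l| <= B * h ^+ 2) ->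
  is_derive t 1 f l.
Proof.
move=> d0 hB.
have B0 : 0 <= B.
  have := hB (d / 2); rewrite gtr0_norm ?divr_gt0// => /(_ (ltac:(lra) : d / 2 < d)).
  by move/(le_trans (normr_ge0 _)); rewrite pmulr_lge0// exprn_gt0// divr_gt0.
have lim : (fun h => h^-1 *: ((f \o shift t) (h *: (1 : R)) - f t)) @ 0^' --> l.
  apply/cvgrPdist_le => e e0.
  have ed : 0 < Num.min d (e / (B + 1)) by rewrite lt_min d0 divr_gt0// ltr_wpDl.
  near=> h.
  have h0 : h != 0 by near: h; exact: nbhs_dnbhs_neq.
  have : `|h| < Num.min d (e / (B + 1)) by near: h; apply: dnbhs0_lt.
  rewrite lt_min => /andP[hd he].
  have := hB h hd; rewrite /= /GRing.scale/= mulr1 (addrC h).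
  have -> : l - h^-1 * (f (t + h) - f t) = - h^-1 * (f (t + h) - f t - h * l) by field.
  rewrite normrM normrN normfV => hb.
  rewrite ler_pdivrMl ?normr_gt0//; apply: (le_trans hb).
  rewrite -real_normK ?num_real// expr2 mulrA mulrC ler_wpM2l//.
  apply/ltW/(@le_lt_trans _ _ ((B + 1) * `|h|)); first by rewrite ler_wpM2r// lerDl.
  by rewrite mulrC -ltr_pdivlMr// ltr_wpDl.
by apply: DeriveDef; [exact: cvgP lim|apply: cvg_lim lim].
Unshelve. all: by end_near. Qed.

Variable lam : nat -> R.
Hypothesis lam_ge : forall k, k%:R <= lam k.

Let lam0 k : 0 <= lam k. Proof. exact: le_trans (lam_ge k). Qed.

Let Cj j (s : R) : R := (2 / s) ^+ j * j`!%:R.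
Let q (s : R) : R := expR (- (s / 2)).

Let q01 s : 0 < s -> 0 <= q s < 1.
Proof. by move=> s0; rewrite expR_ge0/= expR_lt1 oppr_lt0 divr_gt0. Qed.

Lemma exprn_le_expR (x : R) j : 0 <= x -> x ^+ j <= j`!%:R * expR x.
Proof.
move=> x0; case: j => [|j]; first by rewrite expr0 fact0 mul1r -expR0 ler_expR.
have := expR_ge1Dxn j x0; have f0 : 0 < j.+1`!%:R :> R by rewrite ltr0n fact_gt0.
rewrite -(ler_pdivrMl _ _ f0) mulrC; lra.
Qed.

(** Half of the exponent absorbs the power, by x^j <= j! e^x at x = lam k s / 2; the other half
    yields the geometric ratio [q s], since k <= lam k. *)
Let term_bound j s k : 0 < s ->
  lam k ^+ j * expR (- (lam k * s)) <= Cj j s * q s ^+ k.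
Proof.
move=> s0.
have h1 : lam k ^+ j <= Cj j s * expR (lam k * s / 2).
  have ls0 : 0 <= lam k * s / 2 by rewrite divr_ge0// mulr_ge0// ltW.
  have := exprn_le_expR _ j ls0.
  have -> : lam k * s / 2 = lam k * (s / 2) by rewrite mulrA.
  rewrite exprMn => h; rewrite /Cj.
  have -> : (2 / s) ^+ j = ((s / 2) ^+ j)^-1 by rewrite -exprVn invf_div.
  by rewrite -mulrA ler_pdivlMl ?exprn_gt0 ?divr_gt0// mulrC.
apply: (le_trans (ler_wpM2r (expR_ge0 _) h1)).
rewrite -[leLHS]mulrA -expRD ler_wpM2l//.
  by rewrite mulr_ge0// exprn_ge0// divr_ge0// ltW.
rewrite /q -expRM_natl ler_expR.
have := ler_wpM2r (ltW s0) (lam_ge k); lra.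
Qed.

(** The argument is s = T - t, so each derivative in t brings down a factor + lam k; [j] counts
    these derivatives. *)
Definition dirichlet_term a j (s : R) k : R := a k * (lam k ^+ j * expR (- (lam k * s))).
Definition dirichlet_series a j (s : R) : R := limn (series (dirichlet_term a j s)).
Definition dirichlet_bound j (s : R) : R := Cj j s / (1 - q s).
Notation S := dirichlet_series.
Notation M := dirichlet_bound.

Lemma dirichlet_bound_ge0 j s : 0 < s -> 0 <= M j s.
Proof.
move=> s0; have /andP[_ h] := q01 s s0.
apply: divr_ge0; last by rewrite subr_ge0 ltW.
by apply: mulr_ge0 => //; apply: exprn_ge0; rewrite divr_ge0// ltW.
Qed.

Let series_bound u B j d : 0 < d -> 0 <= B ->
  (forall k, `|u k| <= B * (lam k ^+ j * expR (- (lam k * d)))) ->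
  cvgn (series u) /\ `|limn (series u)| <= B * M j d.
Proof.
move=> d0 B0 uB; rewrite /M mulrA; apply: series_geometric_bound; first exact: q01.
by move=> k; apply: (le_trans (uB k)); rewrite -mulrA ler_wpM2l// term_bound.
Qed.

Lemma dirichlet_series_bound a A j d s : 0 < d -> d <= s -> (forall k, `|a k| <= A) ->
  cvgn (series (dirichlet_term a j s)) /\ `|S a j s| <= A * M j d.
Proof.
move=> d0 ds aA; have A0 : 0 <= A := le_trans (normr_ge0 _) (aA 0%N).
apply: series_bound => // k; rewrite normrM ler_pM//.
rewrite ger0_norm ?mulr_ge0 ?exprn_ge0 ?expR_ge0//.
by rewrite ler_wpM2l ?exprn_ge0// ler_expR lerN2 ler_wpM2l.
Qed.

Lemma dirichlet_seriesB a b A j s : 0 < s -> (forall k, `|a k| <= A) ->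
  (forall k, `|b k| <= A) ->
  S (fun k => a k - b k) j s = S a j s - S b j s.
Proof.
move=> s0 aA bA.
have [ca _] := dirichlet_series_bound a A j s s s0 (lexx _) aA.
have [cb _] := dirichlet_series_bound b A j s s s0 (lexx _) bA.
rewrite /S -lim_seriesB//; congr (limn (series _)); apply/funext => k.
by rewrite /dirichlet_term mulrBl.
Qed.

Lemma is_derive_dirichlet_series a A j (T t : R) : t < T -> (forall k, `|a k| <= A) ->
  is_derive t 1 (fun t => S a j (T - t)) (S a j.+1 (T - t)).
Proof.
move=> tT aA; have A0 : 0 <= A := le_trans (normr_ge0 _) (aA 0%N).
(* An increment |h| < d costs at most a factor exp(lam k d), which leaves exp(- lam k d) of the
   decay exp(- 2 lam k d). The remainders then sum to h^2 times a series with exponent j + 2. *)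
pose d := (T - t) / 2.
have d0 : 0 < d by rewrite divr_gt0// subr_gt0.
have s0 : 0 < T - t by rewrite subr_gt0.
apply: (is_derive_quadratic _ t _ (A * M j.+2 d) d d0) => h hd.
have sh : 0 < T - (t + h).
  by move: hd; rewrite ltr_norml /d => /andP[? ?]; lra.
have [c1 _] := dirichlet_series_bound a A j _ _ sh (lexx _) aA.
have [c2 _] := dirichlet_series_bound a A j _ _ s0 (lexx _) aA.
have [c3 _] := dirichlet_series_bound a A j.+1 _ _ s0 (lexx _) aA.
have c4 : cvgn (series (h *: dirichlet_term a j.+1 (T - t))) by exact: is_cvg_seriesZ.
have c5 := is_cvg_seriesB c1 c2.
rewrite /S -lim_seriesB// (_ : h * _ = h *: limn (series (dirichlet_term a j.+1 (T - t))))//.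
rewrite -lim_seriesZ// -lim_seriesB//.
set u : nat -> R := (X in series X).
have [|_] := series_bound u (A * h ^+ 2) j.+2 d d0 (mulr_ge0 A0 (sqr_ge0 h)); last first.
  by move/le_trans; apply; rewrite mulrAC.
move=> k.
have -> : u k = dirichlet_term a j (T - (t + h)) k - dirichlet_term a j (T - t) k -
    h * dirichlet_term a j.+1 (T - t) k by [].
rewrite /dirichlet_term.
set l := lam k; set E := expR (- (l * (T - t))).
have l0 : 0 <= l := lam0 k.
set X := (X in `|X|).
have -> : X = a k * (l ^+ j * E) * (expR (l * h) - 1 - l * h).
  rewrite /X; have -> : expR (- (l * (T - (t + h)))) = E * expR (l * h).
    by rewrite /E -expRD; congr expR; ring.
  by rewrite exprS; ring.
rewrite !normrM (ger0_norm (expR_ge0 _)) normrX (ger0_norm l0).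
have lh := expR_sub1_bound (l * h).
have H1 : `|expR (l * h) - 1 - l * h| <= l ^+ 2 * h ^+ 2 * expR (l * d).
  apply: (le_trans lh); rewrite exprMn; apply: ler_wpM2l.
    by apply: mulr_ge0; exact: sqr_ge0.
  by rewrite ler_expR normrM (ger0_norm l0) ler_wpM2l// ltW.
have E0 : 0 <= E := expR_ge0 _.
have lj : 0 <= l ^+ j by rewrite exprn_ge0.
have H2 : `|a k| * (l ^+ j * E) <= A * (l ^+ j * E) by rewrite ler_wpM2r ?mulr_ge0.
have H3 := ler_pM (mulr_ge0 (normr_ge0 (a k)) (mulr_ge0 lj E0)) (normr_ge0 _) H2 H1.
apply: (le_trans H3).
have -> : expR (- (l * d)) = E * expR (l * d).
  by rewrite /E -expRD; congr expR; rewrite /d; field.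
by rewrite le_eqVlt; apply/orP; left; apply/eqP; rewrite !exprS; ring.
Qed.

End dirichlet_series.

(** * Integration over the space-time cylinder *)

Section continuity.
Variables X Y Z : topologicalType.

Lemma continuous_pairE (f : X -> Y) (g : X -> Z) :
  continuous f -> continuous g -> continuous (fun x => (f x, g x)).
Proof. by move=> cf cg x; apply: (@cvg_pair _ _ _ _ (nbhs (f x)) (nbhs (g x))); [exact: cf|exact: cg]. Qed.

Lemma continuous_compE (f : X -> Y) (g : Y -> Z) :
  continuous f -> continuous g -> continuous (fun x => g (f x)).
Proof. by move=> cf cg x; apply: (@continuous_comp _ _ _ f g); [exact: cf|exact: cg]. Qed.

End continuity.

(** * Continuous extension from intervals and rectangles *)

Section clamp.
Variable R : realType.
Implicit Types (a b x t T : R).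

Definition clamp a b x : R := Num.max a (Num.min x b).

Lemma clamp_in a b x : a <= b -> a <= clamp a b x <= b.
Proof. by move=> ab; rewrite /clamp le_max lexx/= ge_max ab ge_min lexx orbT. Qed.

Lemma clamp_id a b x : a <= x <= b -> clamp a b x = x.
Proof. by move=> /andP[ax xb]; rewrite /clamp (min_idPl xb) (max_idPr ax). Qed.

Lemma continuous_clamp a b : continuous (clamp a b).
Proof.
move=> x.
have cmin : {for x, continuous ((fun y : R => y) \min (fun=> b))}.
  by apply: continuous_min; [exact: cvg_id|exact: cvg_cst].
have -> : clamp a b = (fun=> a) \max ((fun y : R => y) \min (fun=> b)) by [].
by apply: continuous_max; [exact: cvg_cst|exact: cmin].
Qed.

Lemma continuous_comp_within (X Y Z : topologicalType) (A : set Y) (f : Y -> Z) (g : X -> Y) :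
  {within A, continuous f} -> continuous g -> (forall x : X, A (g x)) -> continuous (f \o g).
Proof.
move=> /subspace_continuousP cf cg Ag x.
apply: (@cvg_trans _ (f @ within A (nbhs (g x)))); last exact: cf.
move=> B /= h; have : nbhs x (g @^-1` [set y | A y -> B (f y)]) := cg x _ h.
by apply: filterS => z /=; apply.
Qed.

(* Functions continuous on the closed cylinder become continuous on the plane
   when composed with the projection onto the cylinder. *)
Definition extend2 T (f : R * R -> R) (z : R * R) : R := f (clamp 0 1 z.1, clamp 0 T z.2).

Lemma continuous_fst2 : continuous (fun z : R * R => z.1).
Proof. by move=> z; exact: cvg_fst. Qed.

Lemma continuous_snd2 : continuous (fun z : R * R => z.2).
Proof. by move=> z; exact: cvg_snd. Qed.

Lemma continuous_extend2 T (f : R * R -> R) : 0 <= T ->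
  {within closed_cylinder T, continuous f} -> continuous (extend2 T f).
Proof.
move=> T0 cf; apply: (continuous_comp_within _ _ _ _ f
  (fun z : R * R => (clamp 0 1 z.1, clamp 0 T z.2)) cf).
  apply: continuous_pairE.
    by apply: (continuous_compE _ _ _ fst); [exact: continuous_fst2|exact: continuous_clamp].
  by apply: (continuous_compE _ _ _ snd); [exact: continuous_snd2|exact: continuous_clamp].
by move=> z; split; rewrite /= in_itv/=; apply: clamp_in.
Qed.

Lemma extend2_id T f x t : 0 <= x <= 1 -> 0 <= t <= T -> extend2 T f (x, t) = f (x, t).
Proof. by move=> xI tI; rewrite /extend2/= !clamp_id. Qed.

Lemma continuous_clampE a b (f : R -> R) : a <= b ->
  {within `[a, b], continuous f} -> continuous (fun x => f (clamp a b x)).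
Proof.
move=> ab cf; apply: (continuous_comp_within _ _ _ _ f (clamp a b) cf).
  exact: continuous_clamp.
by move=> x; rewrite /= in_itv/=; exact: clamp_in.
Qed.

End clamp.

(** * Measurability, Fubini and dominated convergence *)

Section plane_integrals.
Variable R : realType.
Implicit Types (f : R * R -> R) (T : R).
Notation leb := (@lebesgue_measure R).

(** The measurable structure on pairs is the product sigma-algebra, which has to be linked to the
    product topology: an open set is the union of the rational boxes that it contains. *)
Lemma open_measurable2 (U : set (R * R)) : open U ->
  measurable (U : set (measurableTypeR R * measurableTypeR R)).
Proof.
move=> oU.
pose box (p : rat * rat * (rat * rat)) : set (R * R) :=
  `]ratr p.1.1, ratr p.1.2[ `*` `]ratr p.2.1, ratr p.2.2[.
pose F p : set (measurableTypeR R * measurableTypeR R) :=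
  if `[< box p `<=` U >] then box p else set0.
have -> : U = \bigcup_p F p.
  apply/seteqP; split => [[x t] Uxt|[x t] [p _]]; last first.
    by rewrite /F; case: asboolP => // h; exact: h.
  have /nbhs_ballP[e /= e0 eU] : nbhs (x, t) U by exact: open_nbhs_nbhs.
  have rat_near (y : R) : exists p : rat * rat,
      [/\ ratr p.1 < y, y < ratr p.2, y - e < ratr p.1 & ratr p.2 < y + e].
    have [q1 q1I] : exists q, ratr q \in `]y - e, y[ by apply: rat_in_itvoo; rewrite ltrBlDr ltrDl.
    have [q2 q2I] : exists q, ratr q \in `]y, y + e[ by apply: rat_in_itvoo; rewrite ltrDl.
    by move: q1I q2I; rewrite !in_itv/= => /andP[? ?] /andP[? ?]; exists (q1, q2).
  have [p [p1 p2 p3 p4]] := rat_near x; have [q [q1 q2 q3 q4]] := rat_near t.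
  exists (p, q) => //; rewrite /F; case: asboolP => [_|].
    by split; rewrite /= in_itv/= ?p1 ?q1.
  case=> -[x' t'] []/=; rewrite !in_itv/= => /andP[? ?] /andP[? ?].
  by apply: eU; split; rewrite /ball/= ltr_norml; lra.
apply: countable_bigcupT_measurable => [|p]; first exact: countableP.
rewrite /F; case: asboolP => _; last exact: measurable0.
by apply: measurableX; exact: measurable_itv.
Qed.

Lemma continuous_measurable2 f : continuous f ->
  measurable_fun setT (f : measurableTypeR R * measurableTypeR R -> R).
Proof.
move=> /continuousP cf; apply: (measurability _ (RGenOpens.measurableE R)).
move=> _ [_ [a [b ->] <-]]; rewrite setTI.
apply: open_measurable2; apply: cf; exact: interval_open.
Qed.

Lemma measurable_cylinder T : measurable (cylinder T : set (measurableTypeR R * measurableTypeR R)).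
Proof. by apply: measurableX; exact: measurable_itv. Qed.

Lemma lebesgue2_cylinder_lty T : (lebesgue2 R (cylinder T) < +oo)%E.
Proof.
have -> : lebesgue2 R (cylinder T) = (leb [set` `]0%R, 1%R[] * leb [set` `]0%R, T[])%E.
  by apply: product_measure1E; exact: measurable_itv.
rewrite !lebesgue_measure_itv/=.
by case: ifP => _; case: ifP => _; rewrite -?EFinB -?EFinM ?mule0 ?mul0e ltry.
Qed.

Lemma cylinder_closed T : cylinder T `<=` closed_cylinder T.
Proof. by move=> z [/subset_itv_oo_cc ? /subset_itv_oo_cc ?]. Qed.

Lemma bounded_closed_cylinder T f : continuous f ->
  exists2 M, 0 <= M & forall z, closed_cylinder T z -> `|f z| <= M.
Proof.
move=> cf; have cpt : compact (closed_cylinder T).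
  by apply: compact_setX; exact: segment_compact.
have /compact_bounded[M [_ Mb]] := continuous_compact (continuous_subspaceT cf) cpt.
exists (`|M| + 1); first by rewrite addr_ge0.
move=> z zI; apply: (Mb (`|M| + 1)) => /=; last by exists z.
by rewrite (le_lt_trans (ler_norm M))// ltrDl.
Qed.

Lemma continuous_integrable2 T f : continuous f ->
  (lebesgue2 R).-integrable (cylinder T) (EFin \o f).
Proof.
move=> cf; apply: measurable_bounded_integrable.
- exact: measurable_cylinder.
- exact: lebesgue2_cylinder_lty.
- by apply: measurable_funS (continuous_measurable2 f cf).
- have [M M0 fM] := bounded_closed_cylinder T f cf.
  exists M; split; rewrite ?num_real// => K MK z zI.
  by apply: le_trans (ltW MK); apply: fM; exact: cylinder_closed.
Qed.

Lemma Fubini_cylinder T f : continuous f ->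
  \int[lebesgue2 R]_(z in cylinder T) f z =
  \int[leb]_(t in `]0, T[) \int[leb]_(x in `]0, 1[) f (x, t).
Proof.
move=> cf.
have i2 := continuous_integrable2 T f cf.
have /integrable_mkcond i2' := i2.
rewrite /Rintegral integral_mkcond [in RHS]integral_mkcond.
rewrite -(integral21_prod_meas1 (i2' (measurable_cylinder T))).
congr fine; apply: eq_integral => t _; rewrite /fubini_G patchE.
have cft : continuous (fun x : R => f (x, t)).
  apply: (continuous_compE _ _ _ (fun x : R => (x, t))) => //.
  by apply: continuous_pairE => ?; [exact: cvg_id|exact: cvg_cst].
case: ifPn => [|] tI.
  rewrite fineK; last first.
    apply: integrable_fin_num => //; exact: continuous_integrable_oo.
  rewrite [RHS]integral_mkcond; apply: eq_integral => x _; rewrite !patchE /cylinder.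
  by rewrite in_setX tI andbT.
rewrite integral0_eq// => x _; rewrite patchE /cylinder in_setX (negbTE tI).
by rewrite andbF.
Qed.

Lemma Rdominated_cvg d (X : measurableType d) (mu : {measure set X -> \bar R})
    (D : set X) (f_ : (X -> R)^nat) (f g : X -> R) : measurable D ->
  (forall n, measurable_fun D (f_ n)) -> (forall x, D x -> f_ n x @[n --> \oo] --> f x) ->
  mu.-integrable D (EFin \o g) -> (forall n x, D x -> `|f_ n x| <= g x) ->
  mu.-integrable D (EFin \o f) /\
  \int[mu]_(x in D) f_ n x @[n --> \oo] --> \int[mu]_(x in D) f x.
Proof.
move=> mD mf_ f_f ig fg.
have mf : measurable_fun D f by exact: (measurable_fun_cvg mf_ f_f).
have [||||intf _ h] := @dominated_convergence _ X R mu D mD (fun n x => (f_ n x)%:E)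
  (EFin \o f) (EFin \o g) _ _ _ ig.
- by move=> n; exact/measurable_EFinP.
- exact/measurable_EFinP.
- by apply: aeW => x Dx; apply: cvg_EFin; [exact: nearW|exact: f_f].
- by apply: aeW => x n Dx; rewrite lee_fin; exact: fg.
split => //; apply: fine_cvg; rewrite fineK; last exact: integrable_fin_num.
exact: h.
Qed.

End plane_integrals.

(** * Integration by parts up to the boundary *)

Section cutoff.
Variable R : realType.
Implicit Types (x z h t : R) (K : R -> R).
Notation leb := (@lebesgue_measure R).

Let P z : R := Num.max z 0 ^+ 2.
Let dP z : R := 2 * Num.max z 0.

Let is_derive_P z : is_derive z 1 P (dP z).
Proof.
apply: (is_derive_quadratic R P z (dP z) 1 1 ltr01) => h _; rewrite /P /dP mul1r.
rewrite ler_norml; case: (leP z 0) => z0; case: (leP (z + h) 0) => zh.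
- by rewrite expr0n/=; have h2 := sqr_ge0 h; apply/andP; split; lra.
- by rewrite expr0n/=; apply/andP; split; nra.
- by rewrite expr0n/=; apply/andP; split; nra.
- by have h2 := sqr_ge0 h; apply/andP; split; nra.
Qed.

Let continuous_dP : continuous dP.
Proof.
apply: continuous_scaleE => z.
have -> : (fun x => Num.max x 0) = (fun x : R => x) \max (fun=> 0) by [].
by apply: continuous_max; [exact: cvg_id|exact: cvg_cst].
Qed.

(** A C^1 step from 0 on z <= 0 to 1 on z >= 1: the inner [P] flattens it at 0, the outer one at
    1. *)
Let q z : R := 1 - P (1 - P z).
Let dq z : R := dP (1 - P z) * dP z.

Let is_derive_q z : is_derive z 1 q (dq z).
Proof.
have d1 := is_derive_subE R _ P z _ _ (is_derive_cstE R 1 z) (is_derive_P z).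
have d2 := is_derive_compE R P (fun z => 1 - P z) z _ _ (is_derive_P _) d1.
have d3 := is_derive_subE R _ _ z _ _ (is_derive_cstE R 1 z) d2.
by apply: (is_derive_eq d3); rewrite /dq; ring.
Qed.

Let continuous_P : continuous P.
Proof. by move=> z; exact: is_derive_continuous (is_derive_P z). Qed.

Let continuous_q : continuous q.
Proof. by move=> z; exact: is_derive_continuous (is_derive_q z). Qed.

Let continuous_dq : continuous dq.
Proof.
apply: continuous_mulE => //; apply: (continuous_compE _ _ _ (fun z => 1 - P z)) => //.
by apply: continuous_subE => //; move=> ?; exact: cvg_cst.
Qed.

Let P_le0 z : z <= 0 -> P z = 0.
Proof. by move=> z0; rewrite /P (max_idPr z0) expr0n. Qed.

Let P_ge1 z : 1 <= z -> 1 <= P z.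
Proof.
move=> z1; rewrite /P (max_idPl _) ?(le_trans ler01 z1)//.
by apply: exprn_ege1.
Qed.

Let P_ge0 z : 0 <= P z. Proof. exact: sqr_ge0. Qed.

Let q_le0 z : z <= 0 -> q z = 0.
Proof.
move=> z0; rewrite /q (P_le0 _ z0) subr0 /P (max_idPl _) ?ler01//.
by rewrite expr1n subrr.
Qed.

Let q_ge1 z : 1 <= z -> q z = 1.
Proof.
move=> z1; have h : 1 - P z <= 0 by rewrite subr_le0; exact: P_ge1.
by rewrite /q (P_le0 _ h) subr0.
Qed.

Let q_01 z : 0 <= q z <= 1.
Proof.
have P01 : P (1 - P z) <= 1.
  rewrite /P; have := P_ge0 z; set u := P z => u0.
  case: (leP (1 - u) 0) => h; first by rewrite expr0n.
  by rewrite -(expr1n _ 2) ler_pXn2r ?nnegrE//; lra.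
by have h1 := P_ge0 (1 - P z); rewrite /q; apply/andP; split; lra.
Qed.

Let dq_ge0 z : 0 <= dq z.
Proof.
have m0 u : 0 <= dP u by rewrite /dP mulr_ge0// le_max lexx orbT.
exact: mulr_ge0.
Qed.

Let dq_neq0 z : dq z != 0 -> 0 < z < 1.
Proof.
rewrite /dq mulf_eq0 negb_or => /andP[h1 h2]; apply/andP; split; rewrite ltNge; apply/negP => h.
  by move: h2; rewrite /dP (max_idPr h) mulr0 eqxx.
have : 1 - P z <= 0 by rewrite subr_le0; exact: P_ge1.
by move=> h'; move: h1; rewrite /dP (max_idPr h') mulr0 eqxx.
Qed.

Let affine_continuous (m c : R) : continuous (fun x : R => m * x + c).
Proof. by move=> x; exact: is_derive_continuous (is_derive_affine R m c x). Qed.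

(** The derivative of the rescaled step q(m x + c): nonnegative for m >= 0 and of mass one on (0,1)
    once the whole rise takes place there. *)
Let kernel (m c x : R) : R := m * dq (m * x + c).

Let continuous_kernel (m c : R) : continuous (kernel m c).
Proof. by apply: continuous_scaleE; apply: (continuous_compE _ _ _ (fun x : R => m * x + c)). Qed.

Let is_derive_q_affine (m c x : R) : is_derive x 1 (fun x => q (m * x + c)) (kernel m c x).
Proof.
have := is_derive_compE R q (fun x => m * x + c) x _ _ (is_derive_q _) (is_derive_affine R m c x).
by rewrite /kernel mulrC.
Qed.

Let kernel_mass (m c : R) : c <= 0 -> 1 <= m + c ->
  \int[leb]_(x in `]0, 1[) kernel m c x = 1.
Proof.
move=> c0 mc; rewrite (Rintegral_oo_FTC R (fun x => q (m * x + c)) (kernel m c) 0 1 ltr01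
  (@continuous_kernel m c) (is_derive_q_affine m c)).
by rewrite mulr1 mulr0 add0r q_ge1// q_le0// subr0.
Qed.

Let kernel_ge0 (m c x : R) : 0 <= m -> 0 <= kernel m c x.
Proof. by move=> m0; rewrite mulr_ge0. Qed.

(** The bound on [K] is weighted by the kernel, so that it concerns only points where the kernel is
    nonzero. *)
Let kernel_bound (m c : R) K M : 0 <= m -> c <= 0 -> 1 <= m + c -> continuous K ->
  (forall x, x \in `]0, 1[ -> kernel m c x * `|K x| <= kernel m c x * M) ->
  `|\int[leb]_(x in `]0, 1[) (kernel m c x * K x)| <= M.
Proof.
move=> m0 c0 mc cK KM.
have ck := continuous_kernel m c.
have cn : continuous (fun x => `|K x|).
  by apply: (continuous_compE _ _ _ K Num.norm) => //; exact: norm_continuous.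
have ckK := continuous_mulE R _ _ ck cK.
apply: (le_trans (le_normr_Rintegral _ (continuous_integrable_oo R _ 0 1 ckK))) => //.
have -> : M = \int[leb]_(x in `]0, 1[) (M * kernel m c x).
  by rewrite Rintegral_ooZ// kernel_mass// mulr1.
apply: le_Rintegral_oo.
- apply: (continuous_compE _ _ _ (fun x => kernel m c x * K x) Num.norm) => //; exact: norm_continuous.
- exact: continuous_scaleE.
- by move=> x xI; rewrite normrM ger0_norm ?kernel_ge0// mulrC (mulrC M) mulrC; exact: KM.
Qed.

(** The kernels form an approximate identity: mass one, and support within 2 / m n of [x0]. *)
Let kernel_cvg (m c : nat -> R) (x0 : R) K : continuous K ->
  (forall n, n%:R <= m n) -> (forall n, c n <= 0) -> (forall n, 1 <= m n + c n) ->
  (forall n x, 0 < m n * x + c n < 1 -> m n * `|x - x0| <= 2) ->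
  \int[leb]_(x in `]0, 1[) (kernel (m n) (c n) x * K x) @[n --> \oo] --> K x0.
Proof.
move=> cK mn c0 mc near0; apply/cvgrPdist_le => e e0.
have /cvgrPdist_le/(_ e e0)/nbhs_ballP[d /= d0 dK] := cK x0.
near=> n.
have m0 : 0 <= m n by apply: le_trans (mn n).
have nd : 2 / d < n%:R by near: n; exact: nbhs_infty_gtr.
have ck := continuous_kernel (m n) (c n).
have cD : continuous (fun x => K x0 - K x).
  by apply: continuous_subE => //; move=> ?; exact: cvg_cst.
have -> : K x0 - \int[leb]_(x in `]0, 1[) (kernel (m n) (c n) x * K x) =
    \int[leb]_(x in `]0, 1[) (kernel (m n) (c n) x * (K x0 - K x)).
  transitivity (\int[leb]_(x in `]0, 1[) (K x0 * kernel (m n) (c n) x - kernel (m n) (c n) x * K x)).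
    rewrite Rintegral_ooB; [|exact: continuous_scaleE|exact: continuous_mulE].
    by rewrite Rintegral_ooZ// kernel_mass// mulr1.
  by congr Rintegral; apply/funext => x; ring.
apply: kernel_bound => // x _.
have [->|k0] := eqVneq (kernel (m n) (c n) x) 0; first by rewrite !mul0r.
rewrite ler_wpM2l ?kernel_ge0//; apply: dK; rewrite /ball/= distrC.
have /near0 : 0 < m n * x + c n < 1.
  by apply: dq_neq0; apply: contraNneq k0; rewrite /kernel => ->; rewrite mulr0.
move: nd; rewrite ltr_pdivrMr// => nd h.
have md : n%:R * d <= m n * d by rewrite ler_wpM2r// ltW.
have mp : 0 < m n by rewrite -(pmulr_lgt0 _ d0); lra.
by rewrite -(ltr_pM2l mp); lra.
Unshelve. all: by end_near. Qed.

(** The cutoff rises on [1/N, 2/N] and falls on [1 - 2/N, 1 - 1/N]; the shift by 4 keeps the rise to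
    the left of the fall for every n. *)
Let N (n : nat) : R := n.+4%:R.

Let N_ge n : n%:R <= N n. Proof. by rewrite /N -(addn4 n) natrD lerDl. Qed.
Let N_ge4 n : 4 <= N n. Proof. by rewrite /N -(addn4 n) natrD lerDr. Qed.

(* The difference of a step near 0 and a step near 1: its derivative is an
   approximation of [delta_0 - delta_1]. *)
Definition cutoff (n : nat) (x : R) : R := q (N n * x + (- 1)) - q (N n * x + (2 - N n)).
Definition dcutoff (n : nat) (x : R) : R := kernel (N n) (- 1) x - kernel (N n) (2 - N n) x.

Lemma is_derive_cutoff n x : is_derive x 1 (cutoff n) (dcutoff n x).
Proof. exact: is_derive_subE (is_derive_q_affine _ _ x) (is_derive_q_affine _ _ x). Qed.

Lemma continuous_dcutoff n : continuous (dcutoff n).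
Proof. exact: continuous_subE. Qed.

Lemma continuous_cutoff n : continuous (cutoff n).
Proof. by move=> x; exact: is_derive_continuous (is_derive_cutoff n x). Qed.

Lemma cutoff_le1 n x : `|cutoff n x| <= 1.
Proof.
rewrite /cutoff ler_norml; have /andP[? ?] := q_01 (N n * x + - 1).
by have /andP[? ?] := q_01 (N n * x + (2 - N n)); apply/andP; split; lra.
Qed.

Lemma cutoff_support n x : cutoff n x != 0 -> (N n)^-1 <= x <= 1 - (N n)^-1.
Proof.
have n4 := N_ge4 n; have n0 : 0 < N n by lra.
have inv : N n * (N n)^-1 = 1 by rewrite divff// gt_eqF.
apply: contraNT; rewrite negb_and -!ltNge => /orP[h|h]; rewrite /cutoff.
  have := h; rewrite -(ltr_pM2l n0) inv => h'.
  by rewrite !q_le0 ?subrr//; lra.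
have := h; rewrite -(ltr_pM2l n0) mulrBr inv mulr1 => h'.
by rewrite !q_ge1 ?subrr//; lra.
Qed.

Lemma cutoff_inv_bounds n : 0 < (N n)^-1 /\ (N n)^-1 < 1.
Proof.
have n4 := N_ge4 n; have n0 : 0 < N n by lra.
by split; [rewrite invr_gt0|rewrite invf_lt1//; lra].
Qed.

Lemma cutoff_cvg x : 0 < x < 1 -> cutoff n x @[n --> \oo] --> (1 : R).
Proof.
move=> /andP[x0 x1]; apply: cvg_near_cst; near=> n.
have h1 : 2 / x < n%:R by near: n; exact: nbhs_infty_gtr.
have h2 : 2 / (1 - x) < n%:R by near: n; exact: nbhs_infty_gtr.
move: h1 h2; rewrite !ltr_pdivrMr ?subr_gt0// => h1 h2.
have nN := N_ge n.
have k1 : n%:R * x <= N n * x by rewrite ler_wpM2r// ltW.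
have k2 : n%:R * (1 - x) <= N n * (1 - x) by rewrite ler_wpM2r// subr_ge0 ltW.
by rewrite /cutoff q_ge1 ?q_le0 ?subr0//; lra.
Unshelve. all: by end_near. Qed.

Lemma dcutoff_split n K : continuous K ->
  \int[leb]_(x in `]0, 1[) (dcutoff n x * K x) =
  \int[leb]_(x in `]0, 1[) (kernel (N n) (- 1) x * K x) -
  \int[leb]_(x in `]0, 1[) (kernel (N n) (2 - N n) x * K x).
Proof.
move=> cK; rewrite -Rintegral_ooB; [|exact: continuous_mulE|exact: continuous_mulE].
by congr Rintegral; apply/funext => x; rewrite /dcutoff mulrBl.
Qed.

Lemma dcutoff_bound n K M : continuous K -> (forall x, x \in `]0, 1[ -> `|K x| <= M) ->
  `|\int[leb]_(x in `]0, 1[) (dcutoff n x * K x)| <= M + M.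
Proof.
move=> cK KM; rewrite dcutoff_split//; apply: (le_trans (ler_normB _ _)).
have n4 := N_ge4 n.
by apply: lerD; apply: kernel_bound => //; try lra; move=> x xI;
  rewrite ler_wpM2l ?KM// kernel_ge0//; lra.
Qed.

Lemma dcutoff_cvg K : continuous K ->
  \int[leb]_(x in `]0, 1[) (dcutoff n x * K x) @[n --> \oo] --> K 0 - K 1.
Proof.
move=> cK; under eq_fun do rewrite dcutoff_split//.
apply: cvgB; apply: kernel_cvg => // n; have n4 := N_ge4 n; try lra.
  move=> x /andP[h1 h2]; rewrite subr0 -[N n in leLHS]gtr0_norm; last by lra.
  by rewrite -normrM ler_norml; apply/andP; split; lra.
move=> x /andP[h1 h2]; rewrite -[N n in leLHS]gtr0_norm; last by lra.
by rewrite -normrM ler_norml mulrBr mulr1; apply/andP; split; lra.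
Qed.

End cutoff.

(** * Weak x-derivatives tested with products of functions of x and t *)

Section separated_test_functions.
Variable R : realType.
Notation leb := (@lebesgue_measure R).

Lemma continuous_prodE (f g : R -> R) : continuous f -> continuous g ->
  continuous (fun z : R * R => f z.1 * g z.2).
Proof.
move=> cf cg z; apply: continuousM.
  by apply: (@continuous_comp _ _ _ fst f); [exact: continuous_fst2|exact: cf].
by apply: (@continuous_comp _ _ _ snd g); [exact: continuous_snd2|exact: cg].
Qed.

Lemma dx_prodE (A dA B : R -> R) : (forall x : R, is_derive x 1 A (dA x)) ->
  dx (fun z : R * R => A z.1 * B z.2) = (fun z => dA z.1 * B z.2).
Proof.
move=> AD; apply/funext => z; rewrite /dx derive1E/=.
have d1 := is_derive_mulE R _ _ z.1 _ _ (AD z.1) (is_derive_cstE R (B z.2) z.1).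
by case: d1 => _ ->; rewrite mulr0 addr0.
Qed.

Lemma dt_prodE (A B dB : R -> R) : (forall x : R, is_derive x 1 B (dB x)) ->
  dt (fun z : R * R => A z.1 * B z.2) = (fun z => A z.1 * dB z.2).
Proof.
move=> BD; apply/funext => z; rewrite /dt derive1E/=.
by case: (is_derive_scaleE R (A z.1) _ z.2 _ (BD z.2)) => _ ->.
Qed.

Lemma C1_prod (A dA B dB : R -> R) :
  (forall x : R, is_derive x 1 A (dA x)) -> continuous dA ->
  (forall x : R, is_derive x 1 B (dB x)) -> continuous dB ->
  C1 (fun z : R * R => A z.1 * B z.2).
Proof.
move=> AD cdA BD cdB.
have cA : continuous A by move=> x; exact: is_derive_continuous (AD x).
have cB : continuous B by move=> x; exact: is_derive_continuous (BD x).
split.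
- by move=> x t; case: (is_derive_mulE R _ _ x _ _ (AD x) (is_derive_cstE R (B t) x)).
- by move=> x t; case: (is_derive_scaleE R (A x) _ t _ (BD t)).
- by rewrite (dx_prodE _ dA)//; exact: continuous_prodE.
- by rewrite (dt_prodE _ _ dB)//; exact: continuous_prodE.
Qed.

Lemma continuous_slice (f : R * R -> R) (t : R) : continuous f -> continuous (fun x : R => f (x, t)).
Proof.
move=> cf; apply: (continuous_compE _ _ _ (fun x : R => (x, t))) => //.
by apply: continuous_pairE => ?; [exact: cvg_id|exact: cvg_cst].
Qed.

Lemma continuous_slice2 (f : R * R -> R) (x : R) : continuous f -> continuous (fun t : R => f (x, t)).
Proof.
move=> cf; apply: (continuous_compE _ _ _ (fun t : R => (x, t))) => //.
by apply: continuous_pairE => ?; [exact: cvg_cst|exact: cvg_id].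
Qed.

Lemma continuous_slice_integral (f : R * R -> R) : continuous f ->
  continuous (fun t => \int[leb]_(x in `]0, 1[) f (x, t)).
Proof.
move=> cf t0.
have cpt : compact (`[0, 1]%classic `*` `[t0 - 1, t0 + 1]%classic : set (R * R)).
  by apply: compact_setX; exact: segment_compact.
have /compact_bounded[M [_ Mb]] := continuous_compact (continuous_subspaceT cf) cpt.
pose M' := `|M| + 1.
have fM x t : 0 < x < 1 -> t0 - 1 < t < t0 + 1 -> `|f (x, t)| <= M'.
  move=> /andP[? ?] /andP[? ?]; apply: (Mb M').
    by rewrite /M' (le_lt_trans (ler_norm M))// ltrDl.
  by exists (x, t) => //; split; rewrite /= in_itv/= !ltW.
have t0I : t0 \in [set` `]t0 - 1, t0 + 1[].
  by apply/mem_set; rewrite /= in_itv/= ltrBlDr ltrDl ltr01.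
apply: (@continuity_under_integral R _ _ leb (fun t x => f (x, t)) `]0, 1[%classic _
  (t0 - 1) (t0 + 1) _ _ (fun=> M') _ _ t0 t0I).
- exact: measurable_itv.
- by move=> t _; apply: continuous_integrable_oo; exact: continuous_slice.
- by apply: aeW => x _ t _; exact: continuous_slice2.
- by apply: continuous_integrable_oo => ?; exact: cvg_cst.
- move=> t /=; rewrite in_itv/= => tI; apply: aeW => x; rewrite /= in_itv/= => xI.
  exact: fM.
Qed.

Lemma square_integrable_integrable d (X : measurableType d)
    (mu : {measure set X -> \bar R}) (D : set X) (f : X -> R) :
  measurable D -> (mu D < +oo)%E -> square_integrable mu D f ->
  mu.-integrable D (EFin \o (fun x => `|f x|)).
Proof.
move=> mD Dfin [mf f2].
have i1 : mu.-integrable D (EFin \o (fun x => f x ^+ 2 + 1)).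
  have -> : EFin \o (fun x => f x ^+ 2 + 1) = (fun x => (f x ^+ 2)%:E) \+ (EFin \o cst 1).
    by apply/funext => x /=.
  apply: integrableD => //; apply: measurable_bounded_integrable => //.
  exact: bounded_cst.
apply: le_integrable i1 => //.
  by apply/measurable_EFinP; exact: measurableT_comp.
move=> x _ /=; rewrite lee_fin normr_id [leRHS]ger0_norm ?addr_ge0 ?sqr_ge0//.
have := sqr_ge0 (`|f x| - 1); rewrite sqrrB1 real_normK ?num_real//.
have := normr_ge0 (f x); lra.
Qed.

(** [weak_dx] admits only tests supported inside Q, so the product is multiplied by cutoffs in x and
    t. Where the x-cutoff is differentiated, its derivative acts as an approximation of a difference
    of point masses and produces the boundary values, which make sense because [y] is continuous on
    the closed cylinder; the remaining part converges by domination. *)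
Lemma weak_dx_parts (T : R) (y g : R * R -> R) (s ds th dth : R -> R) : 0 < T ->
  {within closed_cylinder T, continuous y} -> weak_dx T y g ->
  (forall x : R, is_derive x 1 s (ds x)) -> continuous ds ->
  (forall t : R, is_derive t 1 th (dth t)) -> continuous dth ->
  \int[lebesgue2 R]_(z in cylinder T) (g z * (s z.1 * th z.2)) =
  \int[leb]_(t in `]0, T[) (th t * (extend2 R T y (1, t) * s 1 - extend2 R T y (0, t) * s 0
     - \int[leb]_(x in `]0, 1[) (extend2 R T y (x, t) * ds x))).
Proof.
move=> T0 cy [[mg g2] wg] sD cds thD cdth.
pose Y := extend2 R T y.
have cY : continuous Y by apply: continuous_extend2 => //; exact: ltW.
have cs : continuous s by move=> x; exact: is_derive_continuous (sD x).
have cth : continuous th by move=> x; exact: is_derive_continuous (thD x).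
pose chi := cutoff R; pose dchi := dcutoff R.
pose A n x := chi n x * s x.
pose dA n x := dchi n x * s x + chi n x * ds x.
(* The factor [T^-1] rescales the cutoff to (0,T). It leaves no boundary term in t, as [weak_dx]
   differentiates in x alone. *)
pose B n t := th t * chi n (T^-1 * t).
pose dB n t := dth t * chi n (T^-1 * t) + th t * (T^-1 * dchi n (T^-1 * t)).
have cchi n : continuous (chi n) by exact: continuous_cutoff.
have cdchi n : continuous (dchi n) by exact: continuous_dcutoff.
have cTm : continuous (fun t => T^-1 * t) by exact: continuous_scaleE (fun=> cvg_id).
have AD n (x : R) : is_derive x 1 (A n) (dA n x).
  exact: is_derive_mulE (is_derive_cutoff R n x) (sD x).
have cA n : continuous (A n) by exact: continuous_mulE.
have cdA n : continuous (dA n) by apply: continuous_addE; exact: continuous_mulE.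
have chiT n : continuous (fun t => chi n (T^-1 * t)).
  by apply: (continuous_compE _ _ _ (fun t => T^-1 * t)).
have BD n (t : R) : is_derive t 1 (B n) (dB n t).
  have d1 := is_derive_compE R (chi n) (fun t => T^-1 * t) t _ _ (is_derive_cutoff R n _) (is_derive_mulc R T^-1 t).
  have d2 := is_derive_mulE R _ _ t _ _ (thD t) d1.
  by apply: (is_derive_eq d2); rewrite /dB (mulrC (dcutoff _ _ _)).
have cB n : continuous (B n) by exact: continuous_mulE.
have cdB n : continuous (dB n).
  apply: continuous_addE; first exact: continuous_mulE.
  apply: continuous_mulE => //; apply: continuous_scaleE.
  by apply: (continuous_compE _ _ _ (fun t => T^-1 * t)).
have eqn n : \int[leb]_(t in `]0, T[) (B n t * \int[leb]_(x in `]0, 1[) (Y (x, t) * dA n x)) =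
    - \int[lebesgue2 R]_(z in cylinder T) (g z * (A n z.1 * B n z.2)).
  rewrite -(wg (fun z => A n z.1 * B n z.2)); first last.
  - have [N0 N1] := cutoff_inv_bounds R n.
    set c := (n.+4%:R)^-1 in N0 N1.
    have cl : closed (`[c, 1 - c]%classic `*` `[T * c, T * (1 - c)]%classic : set (R * R)).
      by apply: compact_closed; [exact: norm_hausdorff|apply: compact_setX; exact: segment_compact].
    apply: (@subset_trans _ (`[c, 1 - c]%classic `*` `[T * c, T * (1 - c)]%classic)).
      rewrite ((closure_id _).1 cl); apply: closure_subset => z /=.
      rewrite /A /B !mulf_eq0 !negb_or -!andbA => /and4P[/cutoff_support h1 _ _ /cutoff_support].
      rewrite mulrC ler_pdivlMr// ler_pdivrMr// !(mulrC _ T) => h2.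
      by split; rewrite /= in_itv.
    move=> z [/= /[!in_itv]/= /andP[h1 h2] /andP[h3 h4]].
    have c1 : 0 < T * c by exact: mulr_gt0.
    have c2 : T * (1 - c) < T by rewrite gtr_pMr//; lra.
    by split; rewrite /= in_itv/=; apply/andP; split; lra.
  - exact: C1_prod.
  rewrite (dx_prodE _ (dA n))//.
  transitivity (\int[lebesgue2 R]_(z in cylinder T) (Y z * (dA n z.1 * B n z.2))).
    rewrite Fubini_cylinder; last first.
      by move=> z; apply: continuousM; [exact: cY|exact: continuous_prodE].
    apply: eq_Rintegral => t _ /=.
    rewrite -Rintegral_ooZ; last by apply: continuous_mulE => //; exact: continuous_slice.
    by congr Rintegral; apply/funext => x; ring.
  apply: eq_Rintegral => -[x t]; move=> /set_mem[/= /[!in_itv]/= /andP[h1 h2] /andP[h3 h4]].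
  by rewrite /Y extend2_id ?(ltW h1) ?(ltW h2) ?(ltW h3) ?(ltW h4).
have [M M0 YM] := bounded_closed_cylinder R T Y cY.
have [Ms Ms0 sM] := bounded_closed_cylinder R T _ (continuous_prodE s (fun=> 1) cs (fun=> cvg_cst _)).
have [Md Md0 dM] := bounded_closed_cylinder R T _ (continuous_prodE ds (fun=> 1) cds (fun=> cvg_cst _)).
have [Mt Mt0 tM] := bounded_closed_cylinder R T _ (continuous_prodE (fun=> 1) th (fun=> cvg_cst _) cth).
have inC x t : 0 < x < 1 -> 0 < t < T -> closed_cylinder T (x, t).
  by move=> /andP[? ?] /andP[? ?]; split; rewrite /= in_itv/= !ltW.
have T20 : 0 < T / 2 < T by apply/andP; split; lra.
have h20 : 0 < (2^-1 : R) < 1 by apply/andP; split; lra.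
have sM' x : 0 < x < 1 -> `|s x| <= Ms.
  by move=> xI; have := sM _ (inC _ _ xI T20); rewrite /= mulr1.
have dM' x : 0 < x < 1 -> `|ds x| <= Md.
  by move=> xI; have := dM _ (inC _ _ xI T20); rewrite /= mulr1.
have tM' t : 0 < t < T -> `|th t| <= Mt.
  by move=> tI; have := tM _ (inC _ _ h20 tI); rewrite /= mul1r.
have chi1 n x : `|chi n x| <= 1 := cutoff_le1 R n x.
have BM n t : 0 < t < T -> `|B n t| <= Mt.
  by move=> tI; rewrite /B normrM -[leRHS]mulr1 ler_pM// ?tM'.
have Bcvg t : 0 < t < T -> B n t @[n --> \oo] --> th t.
  move=> /andP[t0 tT]; rewrite -[X in _ --> X]mulr1; apply: cvgM; first exact: cvg_cst.
  by apply: cutoff_cvg; rewrite mulr_gt0 ?invr_gt0//= mulrC ltr_pdivrMr// mul1r.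
have cK t : continuous (fun x => Y (x, t) * s x) by apply: continuous_mulE => //; exact: continuous_slice.
have cD t : continuous (fun x => Y (x, t) * ds x) by apply: continuous_mulE => //; exact: continuous_slice.
pose J n t := \int[leb]_(x in `]0, 1[) (Y (x, t) * dA n x).
have JE n t : J n t = \int[leb]_(x in `]0, 1[) (dchi n x * (Y (x, t) * s x)) +
    \int[leb]_(x in `]0, 1[) (chi n x * (Y (x, t) * ds x)).
  rewrite -Rintegral_ooD; [|exact: continuous_mulE|exact: continuous_mulE].
  by congr Rintegral; apply/funext => x; rewrite /dA; ring.
have leb01 c : \int[leb]_(x in `]0%R, 1%R[) c = c.
  by rewrite Rintegral_cst//= lebesgue_measure_itv/= lte_fin ltr01 oppr0 adde0 mulr1.
have JM n t : 0 < t < T -> `|J n t| <= (M * Ms + M * Ms) + M * Md.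
  move=> tI; rewrite JE; apply: (le_trans (ler_normD _ _)); apply: lerD.
    apply: dcutoff_bound => // x; rewrite in_itv/= => xI.
    by rewrite normrM ler_pM// ?sM'// YM//; exact: inC.
  have cc := continuous_mulE R _ _ (cchi n) (cD t).
  apply: (le_trans (le_normr_Rintegral _ (continuous_integrable_oo R _ 0 1 cc))) => //.
  rewrite -[leRHS]leb01; apply: le_Rintegral_oo.
  - by move=> x; apply: cvg_norm; exact: cc.
  - by move=> ?; exact: cvg_cst.
  - move=> x; rewrite in_itv/= => xI; rewrite normrM -[leRHS]mul1r ler_pM//.
    by rewrite normrM ler_pM// ?dM'// YM//; exact: inC.
have Jcvg t : 0 < t < T -> J n t @[n --> \oo] -->
    (Y (0, t) * s 0 - Y (1, t) * s 1) + \int[leb]_(x in `]0, 1[) (Y (x, t) * ds x).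
  move=> tI; under eq_fun do rewrite JE.
  apply: cvgD; first exact: (dcutoff_cvg R (fun x => Y (x, t) * s x)).
  have [|||||_ //] := @Rdominated_cvg R _ _ leb `]0, 1[%classic
    (fun n x => chi n x * (Y (x, t) * ds x)) (fun x => Y (x, t) * ds x) (fun=> M * Md) _ _ _ _ _.
  - exact: measurable_itv.
  - move=> n; apply: measurable_funS (continuous_measurable_fun (continuous_mulE R _ _ (cchi n) (cD t))) => //.
  - move=> x; rewrite /= in_itv/= => xI; rewrite -[X in _ --> X]mul1r.
    by apply: cvgM; [exact: cutoff_cvg|exact: cvg_cst].
  - by apply: continuous_integrable_oo => ?; exact: cvg_cst.
  - move=> n x; rewrite /= in_itv/= => xI; rewrite normrM -[leRHS]mul1r ler_pM//.
    by rewrite normrM ler_pM// ?dM'// YM//; exact: inC.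
have lim1 : \int[leb]_(t in `]0, T[) (B n t * J n t) @[n --> \oo] -->
    \int[leb]_(t in `]0, T[) (th t * ((Y (0, t) * s 0 - Y (1, t) * s 1) +
      \int[leb]_(x in `]0, 1[) (Y (x, t) * ds x))).
  have [|||||_ //] := @Rdominated_cvg R _ _ leb `]0, T[%classic (fun n t => B n t * J n t)
    (fun t => th t * ((Y (0, t) * s 0 - Y (1, t) * s 1) +
      \int[leb]_(x in `]0, 1[) (Y (x, t) * ds x)))
    (fun=> Mt * ((M * Ms + M * Ms) + M * Md)) _ _ _ _ _.
  - exact: measurable_itv.
  - move=> n; have cJ : continuous (J n).
      apply: (continuous_slice_integral (fun z => Y z * dA n z.1)) => z.
      apply: continuousM; first exact: cY.
      by apply: (@continuous_comp _ _ _ fst (dA n)); [exact: continuous_fst2|exact: cdA].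
    by apply: measurable_funS (continuous_measurable_fun (continuous_mulE R _ _ (cB n) cJ)).
  - by move=> t; rewrite /= in_itv/= => tI; apply: cvgM; [exact: Bcvg|exact: Jcvg].
  - by apply: continuous_integrable_oo => ?; exact: cvg_cst.
  - by move=> n t; rewrite /= in_itv/= => tI; rewrite normrM ler_pM// ?BM// JM.
have lim2 : \int[lebesgue2 R]_(z in cylinder T) (g z * (A n z.1 * B n z.2)) @[n --> \oo] -->
    \int[lebesgue2 R]_(z in cylinder T) (g z * (s z.1 * th z.2)).
  have gi : (lebesgue2 R).-integrable (cylinder T) (EFin \o (fun z => `|g z|)).
    apply: square_integrable_integrable => //; first exact: measurable_cylinder.
    exact: lebesgue2_cylinder_lty.
  have [|||||_ //] := @Rdominated_cvg R _ _ (lebesgue2 R) (cylinder T)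
    (fun n z => g z * (A n z.1 * B n z.2)) (fun z => g z * (s z.1 * th z.2))
    (fun z => `|g z| * (Ms * Mt)) _ _ _ _ _.
  - exact: measurable_cylinder.
  - move=> n; apply: measurable_funM => //.
    exact: measurable_funS (continuous_measurable2 R _ (continuous_prodE _ _ (cA n) (cB n))).
  - move=> z [/= /[!in_itv]/= xI tI]; apply: cvgM; first exact: cvg_cst.
    apply: cvgM; last exact: Bcvg.
    by rewrite -[X in _ --> X]mul1r; apply: cvgM; [exact: cutoff_cvg|exact: cvg_cst].
  - exact: (integrableZr (measurable_cylinder R T) (Ms * Mt) gi).
  - move=> n z [/= /[!in_itv]/= xI tI]; rewrite normrM ler_wpM2l//.
    rewrite normrM ler_pM// ?BM// /A normrM -[leRHS]mul1r.
    by rewrite ler_pM// sM'.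
have lim2' : (fun n => - \int[lebesgue2 R]_(z in cylinder T) (g z * (A n z.1 * B n z.2))) @ \oo -->
    - \int[lebesgue2 R]_(z in cylinder T) (g z * (s z.1 * th z.2)).
  by apply: cvgN.
have lim1' : (fun n => - \int[lebesgue2 R]_(z in cylinder T) (g z * (A n z.1 * B n z.2))) @ \oo -->
    \int[leb]_(t in `]0, T[) (th t * ((Y (0, t) * s 0 - Y (1, t) * s 1) +
      \int[leb]_(x in `]0, 1[) (Y (x, t) * ds x))).
  by under eq_fun do rewrite -eqn; exact: lim1.
have E := @cvg_unique _ (@Rhausdorff R) _ _ _ _ lim1' lim2'.
rewrite -[LHS]opprK -E.
rewrite -mulN1r -Rintegral_ooZ.
  by congr Rintegral; apply/funext => t; rewrite -/Y; ring.
apply: continuous_mulE => //; apply: continuous_addE.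
  by apply: continuous_subE; (apply: continuous_mulE; last by move=> ?; exact: cvg_cst);
    exact: continuous_slice2.
apply: (continuous_slice_integral (fun z => Y z * ds z.1)) => z.
apply: continuousM; first exact: cY.
by apply: (@continuous_comp _ _ _ fst ds); [exact: continuous_fst2|exact: cds].
Qed.

End separated_test_functions.

(** * The boundary trace of the adjoint state *)

Section du_bois_reymond.
Variable R : realType.
Implicit Types (f F G : R -> R) (a b T t s x w : R).
Notation leb := (@lebesgue_measure R).

Lemma Rintegral_oo_FTC_oo F f a b : a < b -> continuous f -> continuous F ->
  (forall t : R, t \in `]a, b[ -> is_derive t 1 F (f t)) ->
  \int[leb]_(x in `]a, b[) f x = F b - F a.
Proof.
move=> ab cf cF FD; rewrite Rintegral_oo_cc// /Rintegral (@continuous_FTC2 R f F)//.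
- exact: continuous_subspaceT.
- split.
  + by move=> t tI; case: (FD t tI).
  + exact/cvg_at_right_filter/cF.
  + exact/cvg_at_left_filter/cF.
- by move=> t tI; rewrite derive1E; case: (FD t tI).
Qed.

Lemma exists_continuous_antiderivative f a b : continuous f -> a < b ->
  exists2 G : R -> R, continuous G & forall t : R, t \in `]a, b[ -> is_derive t 1 G (f t).
Proof.
move=> cf ab.
have [F FD] := exists_antiderivative R f (a - 1) (b + 1) cf (ltac:(lra) : a - 1 < b + 1).
have FD' (t : R) : a <= t <= b -> is_derive t 1 F (f t).
  by move=> /andP[? ?]; apply: FD; rewrite in_itv/=; apply/andP; split; lra.
exists (fun x => F (clamp R a b x)).
  apply: continuous_clampE; first exact: ltW.
  by apply: derivable_within_continuous => t; rewrite in_itv/= => /FD'[].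
move=> t; rewrite in_itv/= => /andP[at' tb].
apply: (@near_eq_is_derive _ _ _ F); last by apply: FD'; rewrite !ltW.
have : \forall s \near t, s \in `]a, b[ by apply: near_in_itvoo; rewrite in_itv/= at'.
apply: filterS => s; rewrite in_itv/= => /andP[? ?].
by rewrite clamp_id// !ltW.
Qed.

(** The antiderivative is nondecreasing with equal values at both ends, hence constant, and its
    derivative is zero. *)
Lemma Rintegral_oo_eq0 f a b : continuous f -> (forall x, 0 <= f x) ->
  \int[leb]_(x in `]a, b[) f x = 0 -> forall x, x \in `]a, b[ -> f x = 0.
Proof.
move=> cf f0 If x xI.
have ab : a < b by move: xI; rewrite in_itv/= => /andP[]; exact: lt_trans.
have [G cG GD] := exists_continuous_antiderivative f a b cf ab.
have Gab : G b - G a = 0 by rewrite -(Rintegral_oo_FTC_oo G f).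
have mono : forall x y, a <= x -> x <= y -> y <= b -> G x <= G y.
  apply: ger0_derive1_ndecr.
  - by move=> t /GD[].
  - by move=> t /GD[_ tE]; rewrite derive1E tE.
  - exact: continuous_subspaceT.
have const t : a <= t <= b -> G t = G a.
  move=> /andP[at' tb]; apply/eqP; rewrite eq_le; apply/andP; split; last exact: mono.
  by have := mono t b at' tb (lexx _); lra.
have d0 : is_derive x 1 G 0.
  apply: (@near_eq_is_derive _ _ _ (fun=> G a)).
  have : \forall s \near x, s \in `]a, b[ by exact: near_in_itvoo.
  by apply: filterS => s; rewrite in_itv/= => /andP[? ?]; rewrite const// !ltW.
by case: (GD x xI) => _ <-; case: d0.
Qed.

(* The weak form of [c' = f], [c T = D]. If [G] solves it classically, then
   [c - G] is orthogonal to all derivatives of test functions, in particular to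
   [(c - G) w] with a weight [w] vanishing outside (0,T). *)
Lemma du_bois_reymond T (c f : R -> R) (D : R) : 0 < T -> continuous c -> continuous f ->
  (forall th dth : R -> R, (forall t : R, is_derive t 1 th (dth t)) -> continuous dth ->
    th 0 = 0 ->
    \int[leb]_(t in `]0, T[) (dth t * c t) + \int[leb]_(t in `]0, T[) (th t * f t) =
    D * th T) ->
  exists G : R -> R, [/\ continuous G, G T = D &
    forall t, t \in `]0, T[ -> c t = G t /\ is_derive t 1 G (f t)].
Proof.
move=> T0 cc cf weak.
have [F cF FD] := exists_continuous_antiderivative f 0 T cf T0.
pose G (t : R) : R := D - F T + F t.
have cG : continuous G by apply: continuous_addE => // ?; exact: cvg_cst.
have GD (t : R) : t \in `]0, T[ -> is_derive t 1 G (f t).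
  move=> tI; have := is_derive_addE R _ _ t _ _ (is_derive_cstE R (D - F T) t) (FD t tI).
  by rewrite add0r.
have GT : G T = D by rewrite /G; ring.
exists G; split => // t tI; split; last exact: GD.
pose w (t : R) : R := clamp R 0 T t * (T - clamp R 0 T t).
have cw : continuous w.
  apply: continuous_mulE; first exact: continuous_clamp.
  by apply: continuous_subE; [move=> ?; exact: cvg_cst|exact: continuous_clamp].
have w_ge0 s : 0 <= w s.
  have /andP[h1 h2] := clamp_in R 0 T s (ltW T0).
  by rewrite mulr_ge0// subr_ge0.
have w_out s : s <= 0 -> w s = 0.
  by move=> s0; rewrite /w /clamp (min_idPl (le_trans s0 (ltW T0))) (max_idPl s0) mul0r.
pose rho (s : R) : R := (c s - G s) * w s.
have crho : continuous rho by apply: continuous_mulE => //; exact: continuous_subE.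
(* Integrating from -1 makes [th] differentiable at 0 too; as [w] vanishes on the negative axis,
   [th 0 = 0], as the test class requires. *)
pose th (s : R) : R := \int[leb]_(r in `[-1, s]) rho r.
have th_out s : s <= 0 -> th s = 0.
  move=> s0; rewrite /th; transitivity (\int[leb]_(r in `[-1, s]) (0 : R)).
    apply: eq_Rintegral => r /set_mem/=; rewrite in_itv/= => /andP[_ rs].
    by rewrite /rho w_out ?mulr0// (le_trans rs).
  by rewrite Rintegral_cst// mul0r.
have thD (s : R) : is_derive s 1 th (rho s).
  have [s0|s0] := ltP s 0.
    rewrite /rho w_out ?mulr0; last exact: ltW.
    apply: (@near_eq_is_derive _ _ _ (fun=> 0)).
    have : \forall r \near s, r < 0 by exact: lt_nbhsl.
    by apply: filterS => r r0; rewrite th_out// ltW.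
  have s1 : -1 < s by lra.
  have [] := @continuous_FTC1_closed R rho (-1) s (s + 1) _ _ s1 (crho s).
  - by rewrite ltrDl.
  - apply: continuous_compact_integrable; first exact: segment_compact.
    exact: continuous_subspaceT.
  - by rewrite derive1E => ? ?; exact: DeriveDef.
have cth : continuous th by move=> s; exact: is_derive_continuous (thD s).
have th0 : th 0 = 0 by exact: th_out.
have := weak th rho thD crho th0.
(* [G] satisfies the same weak identity, because [th 0 = 0] and [G T = D]; subtraction leaves the
   integral of (c - G)^2 w, which therefore vanishes. *)
have parts : \int[leb]_(s in `]0, T[) (rho s * G s) + \int[leb]_(s in `]0, T[) (th s * f s) = D * th T.
  rewrite -Rintegral_ooD; [|exact: continuous_mulE|exact: continuous_mulE].
  have cthG : continuous (fun s => th s * G s) by exact: continuous_mulE.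
  have csum : continuous (fun s => rho s * G s + th s * f s).
    by apply: continuous_addE; exact: continuous_mulE.
  have thGD (s : R) : s \in `]0, T[ -> is_derive s 1 (fun s => th s * G s) (rho s * G s + th s * f s).
    by move=> sI; exact: is_derive_mulE (thD s) (GD s sI).
  by rewrite (Rintegral_oo_FTC_oo _ _ 0 T T0 csum cthG thGD) th0 mul0r subr0 GT mulrC.
rewrite -parts => /addIr /eqP; rewrite -subr_eq0 -Rintegral_ooB; [|exact: continuous_mulE|exact: continuous_mulE].
move=> /eqP I0.
have I0' : \int[leb]_(s in `]0, T[) ((c s - G s) ^+ 2 * w s) = 0.
  have e s : (c s - G s) ^+ 2 * w s = rho s * c s - rho s * G s by rewrite /rho; ring.
  by rewrite -[RHS]I0; apply: eq_Rintegral => s _; exact: e.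
have := Rintegral_oo_eq0 _ 0 T _ _ I0' t tI.
have tI' := tI; rewrite in_itv/= in tI'; case/andP: tI' => t0 tT.
have cs : continuous (fun s => (c s - G s) ^+ 2 * w s).
  by apply: continuous_mulE => //; apply: continuous_sqrE; exact: continuous_subE.
move=> /(_ cs) h.
have {}h : (c t - G t) ^+ 2 * w t = 0 by apply: h => s; apply: mulr_ge0; [exact: sqr_ge0|exact: w_ge0].
move/eqP: h; rewrite mulf_eq0 sqrf_eq0 subr_eq0 => /orP[/eqP//|].
rewrite /w clamp_id ?(ltW t0) ?(ltW tT)// mulf_eq0 subr_eq0.
by rewrite (gt_eqF t0) (gt_eqF tT).
Qed.

End du_bois_reymond.

(** * Fourier modes of the adjoint state and the series of its trace *)

Section adjoint_trace.
Variables (R : realType) (T alpha : R) (yO : R -> R) (y phi : R * R -> R).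
Hypotheses (T_gt0 : 0 < T) (alpha_gt0 : 0 < alpha).
Hypothesis cd : {within `[0, 1], continuous (fun x => y (x, T) - yO x)}.
Hypothesis phi_adj : weak_adjoint T alpha yO y phi.
Notation leb := (@lebesgue_measure R).
Implicit Types (t s x w : R).

Let Y := extend2 R T phi.
Let d x := y (clamp R 0 1 x, T) - yO (clamp R 0 1 x).

Let continuous_d : continuous d.
Proof. exact: (continuous_clampE R 0 1 (fun x => y (x, T) - yO x) ler01 cd). Qed.

Let continuous_Y : continuous Y.
Proof. by case: phi_adj => cphi _; apply: continuous_extend2 => //; exact: ltW. Qed.

Let mode w t := \int[leb]_(x in `]0, 1[) (Y (x, t) * cos (w * x)).

Let continuous_Ycos w : continuous (fun z : R * R => Y z * cos (w * z.1)).
Proof.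
move=> z; apply: continuousM; first exact: continuous_Y.
by apply: (@continuous_comp _ _ _ fst (fun x => cos (w * x)));
  [exact: continuous_fst2|exact: continuous_cosM].
Qed.

Let continuous_mode w : continuous (mode w).
Proof. exact: (continuous_slice_integral R _ (continuous_Ycos w)). Qed.

Let continuous_Y1 : continuous (fun t => Y (1, t)).
Proof. exact: continuous_slice2. Qed.

(** The time derivative of [mode w] for arbitrary w. Its two terms are used separately: the second
    coefficient vanishes at the Robin frequencies, and only alpha phi(1,t) survives at w = 0. *)
Let flux w t := w ^+ 2 * mode w t + (alpha * cos w - w * sin w) * Y (1, t).

Let continuous_flux w : continuous (flux w).
Proof. by apply: continuous_addE; exact: continuous_scaleE. Qed.

Let weak_separated w (th dth : R -> R) :
  (forall t : R, is_derive t 1 th (dth t)) -> continuous dth -> th 0 = 0 ->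
  \int[leb]_(t in `]0, T[) (dth t * mode w t) + \int[leb]_(t in `]0, T[) (th t * flux w t) =
  (\int[leb]_(x in `]0, 1[) (d x * cos (w * x))) * th T.
Proof.
move=> thD cdth th0.
have cth : continuous th by move=> t; exact: is_derive_continuous (thD t).
case: phi_adj => cphi [phix wphi weak].
pose e x : R := cos (w * x); pose de x : R := - w * sin (w * x).
have eD (x : R) : is_derive x 1 e (de x) by exact: is_derive_cosM.
have ce : continuous e by exact: continuous_cosM.
have cde : continuous de by exact/continuous_scaleE/continuous_sinM.
have deD (x : R) : is_derive x 1 de (- w ^+ 2 * e x).
  apply: (is_derive_eq (is_derive_scaleE _ (- w) _ x _ (is_derive_sinM R w x))).
  by rewrite /e; ring.
have := weak (fun z => e z.1 * th z.2) (C1_prod R e de th dth eD cde thD cdth) _.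
have v0 x : x \in `[0, 1] -> e x * th 0 = 0 by rewrite th0 mulr0.
move=> /(_ v0); rewrite (dt_prodE R e th dth thD) (dx_prodE R e de th eD).
have -> : \int[lebesgue2 R]_(z in cylinder T) (phi z * (e z.1 * dth z.2)) =
    \int[leb]_(t in `]0, T[) (dth t * mode w t).
  transitivity (\int[lebesgue2 R]_(z in cylinder T) (Y z * (e z.1 * dth z.2))).
    apply: eq_Rintegral => -[x t] /set_mem[/= /[!in_itv]/= /andP[h1 h2] /andP[h3 h4]].
    by rewrite /Y extend2_id ?(ltW h1) ?(ltW h2) ?(ltW h3) ?(ltW h4).
  rewrite Fubini_cylinder; last first.
    by move=> z; apply: continuousM; [exact: continuous_Y|exact: continuous_prodE].
  apply: eq_Rintegral => t _ /=; rewrite -Rintegral_ooZ; last first.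
    exact: (continuous_slice R _ t (continuous_Ycos w)).
  by congr Rintegral; apply/funext => x; rewrite /e; ring.
have cde2 : continuous (fun x => - w ^+ 2 * e x) by exact: continuous_scaleE.
(* A second integration by parts moves the derivative from phi to the cosine; the boundary term at 0
   vanishes with the sine, the one at 1 joins the Robin term in [flux]. *)
rewrite (weak_dx_parts R T phi phix de _ th dth T_gt0 cphi wphi deD cde2 thD cdth).
have -> : alpha * \int[leb]_(t in `]0, T[) (phi (1, t) * (e 1 * th t)) =
    \int[leb]_(t in `]0, T[) (alpha * cos w * (Y (1, t) * th t)).
  rewrite Rintegral_ooZ; last exact: continuous_mulE.
  rewrite -mulrA; congr (_ * _); rewrite -Rintegral_ooZ; last exact: continuous_mulE.
  apply: eq_Rintegral => t /set_mem/=; rewrite in_itv/= => /andP[t0 tT].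
  by rewrite /Y extend2_id ?ler01 ?lexx ?(ltW t0) ?(ltW tT)// /e mulr1; ring.
have -> : \int[leb]_(x in `]0, 1[) ((y (x, T) - yO x) * (e x * th T)) =
    (\int[leb]_(x in `]0, 1[) (d x * cos (w * x))) * th T.
  rewrite mulrC -Rintegral_ooZ; last by apply: continuous_mulE.
  apply: eq_Rintegral => x /set_mem/=; rewrite in_itv/= => /andP[x0 x1].
  by rewrite /d clamp_id ?(ltW x0) ?(ltW x1)// /e; ring.
move=> <-; rewrite -addrA; congr (_ + _).
rewrite -Rintegral_ooD.
- congr Rintegral; apply/funext => t; rewrite -/Y /flux.
  have -> : \int[leb]_(x in `]0, 1[) (Y (x, t) * (- w ^+ 2 * e x)) = - w ^+ 2 * mode w t.
    rewrite -Rintegral_ooZ; last exact: (continuous_slice R _ t (continuous_Ycos w)).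
    by congr Rintegral; apply/funext => x; rewrite /e; ring.
  by rewrite /de !mulr0 sin0 !mulr1; ring.
- apply: continuous_mulE => //; apply: continuous_subE.
    by apply: continuous_subE; (apply: continuous_mulE; last by move=> ?; exact: cvg_cst);
      exact: continuous_slice2.
  apply: (continuous_slice_integral R (fun z => Y z * (- w ^+ 2 * e z.1))) => z.
  apply: continuousM; first exact: continuous_Y.
  by apply: (@continuous_comp _ _ _ fst (fun x => - w ^+ 2 * e x)); [exact: continuous_fst2|exact: cde2].
- by apply: continuous_scaleE; exact: continuous_mulE.
Qed.

Let coef w := \int[leb]_(x in `]0, 1[) (d x * cos (w * x)).

Let mode_ode w : exists G : R -> R, [/\ continuous G, G T = coef w &
    forall t, t \in `]0, T[ -> mode w t = G t /\ is_derive t 1 G (flux w t)].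
Proof. by apply: du_bois_reymond => // th dth; exact: weak_separated. Qed.

Notation fr := (freq R alpha alpha_gt0).
Notation lam := (robin_eigenvalue R alpha alpha_gt0).

Let mode_exp k t : t \in `]0, T[ ->
  mode (fr k) t = coef (fr k) * expR (- (lam k * (T - t))).
Proof.
move=> tI; have [G [cG GT GD]] := mode_ode (fr k).
rewrite (GD t tI).1 -GT.
have flE s : flux (fr k) s = lam k * mode (fr k) s.
  by rewrite /flux freq_eq subrr mul0r addr0.
pose E s : R := expR (lam k * (T - s)).
have ED (s : R) : is_derive s 1 E (E s * - lam k).
  have d1 := is_derive_subE R _ _ s _ _ (is_derive_cstE R T s) (is_derive_id s 1).
  have d2 := is_derive_scaleE R (lam k) _ s _ d1.
  have d3 := is_derive_compE R (@expR R) (fun s => lam k * (T - s)) s _ _ (is_derive_expR _) d2.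
  by apply: (is_derive_eq d3); rewrite sub0r mulrN1.
(* With this integrating factor [H] is constant up to T, where it equals the terminal
   coefficient. *)
pose H s : R := G s * E s.
have HD (s : R) : s \in `]0, T[ -> is_derive s 1 H 0.
  move=> sI; have [ms Gs] := GD s sI.
  apply: (is_derive_eq (is_derive_mulE R _ _ s _ _ Gs (ED s))).
  by rewrite flE ms; ring.
have cE : continuous E by move=> s; exact: is_derive_continuous (ED s).
have cH : continuous H by exact: continuous_mulE.
move: (tI); rewrite in_itv/= => /andP[t0 tT].
have HDI (s : R) : s \in `]t, T[ -> is_derive s 1 H 0.
  by rewrite in_itv/= => /andP[ts sT]; apply: HD; rewrite in_itv/= sT (lt_trans t0).
have [c _] := @MVT R H (fun=> 0) t T tT HDI (continuous_subspaceT cH).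
rewrite mul0r => /eqP; rewrite subr_eq0 /H /E subrr mulr0 expR0 mulr1 => /eqP ->.
by rewrite expRN mulfK// gt_eqF// expR_gt0.
Qed.

Lemma freq_ge k : k%:R <= fr k.
Proof.
have /andP[h _] := freq_bounds R alpha alpha_gt0 k; apply/ltW/(le_lt_trans _ h).
rewrite -[leLHS]mulr1 ler_wpM2l//; have := pi_ge2 R; lra.
Qed.

Lemma robin_eigenvalue_ge k : k%:R <= lam k.
Proof.
case: k => [|k]; first exact: sqr_ge0.
apply: (le_trans (freq_ge k.+1)).
rewrite /robin_eigenvalue expr2; apply: ler_peMr; first exact/ltW/freq_gt0.
by apply: le_trans (freq_ge k.+1); rewrite ler1n.
Qed.

(** [one_coef] already contains the division by the squared norm of the eigenfunction, so the second
    factor is a plain integral. *)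
Definition trace_coef k : R := one_coef R alpha alpha_gt0 k *
  \int[leb]_(x in `]0, 1[) ((y (x, T) - yO x) * robin_eigenfun R alpha alpha_gt0 k x).

Let dE f : \int[leb]_(x in `]0, 1[) ((y (x, T) - yO x) * f x) = \int[leb]_(x in `]0, 1[) (d x * f x).
Proof.
apply: eq_Rintegral => x /set_mem/=; rewrite in_itv/= => /andP[x0 x1].
by rewrite /d clamp_id ?(ltW x0) ?(ltW x1).
Qed.

Lemma trace_coef_bound k :
  `|trace_coef k| <= 2 * L2norm01 (fun x => y (x, T) - yO x).
Proof.
rewrite /trace_coef normrM ler_pM//; first exact: one_coef_le.
rewrite dE /L2norm01.
have -> : \int[leb]_(x in `]0, 1[) ((y (x, T) - yO x) ^+ 2) = \int[leb]_(x in `]0, 1[) (d x ^+ 2).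
  by rewrite (dE (fun x => y (x, T) - yO x)); apply: eq_Rintegral => x /set_mem/=;
    rewrite in_itv/= => /andP[x0 x1]; rewrite /d clamp_id ?(ltW x0) ?(ltW x1).
have I0 : 0 <= \int[leb]_(x in `]0, 1[) (d x ^+ 2) by apply: Rintegral_ge0 => x _; exact: sqr_ge0.
rewrite -(@ler_pXn2r _ 2)// ?nnegrE ?sqrtr_ge0// sqr_sqrtr// real_normK ?num_real//.
have ce := continuous_eigenfun R alpha alpha_gt0 k.
apply: (le_trans (Cauchy_Schwarz_oo R d _ 0 1 continuous_d ce)).
rewrite ler_piMr//; exact: eigenfun_norm2_le1.
Qed.

Notation S := (dirichlet_series R lam).

(** At fixed t the partial sums are the integrals of phi(.,t) against the truncated expansion of 1,
    with an error of order 1/N. *)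
Let mean_series t : t \in `]0, T[ -> mode 0 t = S trace_coef 0 (T - t).
Proof.
move=> tI; have [t0 tT] : 0 < t /\ t < T by move: tI; rewrite in_itv/= => /andP[].
have s0 : 0 < T - t by rewrite subr_gt0.
have [cS _] := dirichlet_series_bound R lam robin_eigenvalue_ge trace_coef _ 0 _ _ s0 (lexx _) trace_coef_bound.
have cYt := continuous_slice R Y t continuous_Y.
pose B : R := Num.sqrt (alpha * \int[leb]_(x in `]0, 1[) (Y (x, t) ^+ 2)).
have partial N : (0 < N)%N ->
  `|mode 0 t - series (dirichlet_term R lam trace_coef 0 (T - t)) N| * (pi * (N%:R - 2^-1)) <= B.
  move=> N0; have := integral_one_expansion R alpha alpha_gt0 N (fun x => Y (x, t)) N0 cYt.
  have -> : \int[leb]_(x in `]0, 1[) Y (x, t) = mode 0 t.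
    by congr Rintegral; apply/funext => x; rewrite mul0r cos0 mulr1.
  rewrite /series/= big_mkord; congr (`|_ - _| * _ <= _).
  apply: eq_bigr => k _; rewrite /dirichlet_term expr0 mul1r /trace_coef dE -mulrA.
  by congr (_ * _); exact: mode_exp.
have cv : series (dirichlet_term R lam trace_coef 0 (T - t)) @ \oo --> mode 0 t.
  apply/cvgrPdist_le => e e0; near=> N.
  have N0 : (0 < N)%N by near: N; exact: nbhs_infty_gt.
  have Nb : B / e + 1 < N%:R by near: N; exact: nbhs_infty_gtr.
  have := partial N N0; set X := `| _ |.
  have p2 := pi_ge2 R.
  have N2 : 1 <= N%:R :> R by rewrite ler1n.
  have Ne : B / e <= pi * (N%:R - 2^-1) by nra.
  have K0 : 0 < pi * (N%:R - 2^-1) :> R by apply: mulr_gt0; [exact: pi_gt0|lra].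
  rewrite ler_pdivrMr// mulrC in Ne.
  by move=> h; rewrite -(ler_pM2r K0); exact: le_trans Ne.
by rewrite /dirichlet_series; apply/esym/cvg_lim.
Unshelve. all: by end_near. Qed.

(** The mean has two expressions for its derivative: the equation for w = 0 gives alpha phi(1,t),
    and termwise differentiation gives the series with exponent 1. *)
Lemma adjoint_trace t : t \in `]0, T[ ->
  alpha * phi (1, t) = S trace_coef 1 (T - t).
Proof.
move=> tI; have [t0 tT] : 0 < t /\ t < T by move: tI; rewrite in_itv/= => /andP[].
have [G [_ _ GD]] := mode_ode 0.
have [_ Gt] := GD t tI.
have d2 := is_derive_dirichlet_series R lam robin_eigenvalue_ge trace_coef _ 0 T t tT trace_coef_bound.
have d3 : is_derive t 1 G (S trace_coef 1 (T - t)).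
  apply: near_eq_is_derive d2.
  have : \forall s \near t, s \in `]0, T[ by exact: near_in_itvoo.
  by apply: filterS => s sI; rewrite -mean_series// (GD s sI).1.
have -> : S trace_coef 1 (T - t) = flux 0 t by case: d3 => _ <-; case: Gt.
rewrite /flux expr0n/= mul0r add0r cos0 mul0r subr0 mulr1.
by rewrite /Y extend2_id ?ler01 ?lexx ?(ltW t0) ?(ltW tT).
Qed.

End adjoint_trace.

(** * Stability of the optimal state *)

Section convex_combinations.
Variable R : realType.
Notation leb := (@lebesgue_measure R).

(** [C1] speaks of partial derivatives only. Near a point the bounded [dx v] gives a Lipschitz bound
    in x uniform in t, which combines with continuity in t at the fixed x. *)
Lemma C1_continuous (v : R * R -> R) : C1 v -> continuous v.
Proof.
move=> [dv1 dv2 cdx cdt] [x t].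
have cvt : {for t, continuous (fun s => v (x, s))}.
  by apply/differentiable_continuous/derivable1_diffP/dv2.
apply/cvgrPdist_le => e e0; set e2 := e / 2; have e20 : 0 < e2 by rewrite divr_gt0.
pose M := `|dx v (x, t)| + 1.
have M0 : 0 < M by rewrite ltr_wpDl.
have /nbhs_ballP[r1 /= r10 b1] : \forall z \near (x, t), `|dx v z| < M.
  have cn : {for (x, t), continuous (fun z => `|dx v z|)} by apply: cvg_norm; exact: cdx.
  by apply: (cvgr_lt _ cn); rewrite ltrDl.
have /nbhs_ballP[r2 /= r20 b2] : \forall s \near t, `|v (x, t) - v (x, s)| <= e2.
  by move/cvgrPdist_le : cvt; exact.
pose r := Num.min r1 (Num.min r2 (e2 / M)).
have r0 : 0 < r by rewrite !lt_min r10 r20 divr_gt0.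
have rr1 : r <= r1 by rewrite ge_min lexx.
have rr2 : r <= r2 by rewrite !ge_min lexx orbT.
have rr3 : r <= e2 / M by rewrite !ge_min lexx !orbT.
have nb : nbhs (x, t) (ball (x, t) r) by exact: nbhsx_ballx.
apply: filterS nb => -[x' t'] [/= bx bt].
have -> : v (x, t) - v (x', t') = (v (x, t) - v (x, t')) + (v (x, t') - v (x', t')) by ring.
apply: (le_trans (ler_normD _ _)); rewrite (splitr e) -/e2 lerD//.
  by apply: b2; rewrite /ball/=; apply: lt_le_trans rr2.
have lip (p q : R) : p < q -> x - r < p -> q < x + r -> `|v (q, t') - v (p, t')| <= M * (q - p).
  move=> pq xp qx.
  have dI (s : R) : s \in `]p, q[ -> is_derive s 1 (fun s => v (s, t')) (dx v (s, t')).
    by move=> _; rewrite /dx derive1E; exact/derivableP/dv1.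
  have cI : {within `[p, q], continuous (fun s => v (s, t'))}.
    by apply: derivable_within_continuous => s _; exact: dv1.
  have [c] := MVT pq dI cI; rewrite in_itv/= => /andP[pc cq] ->.
  rewrite normrM (gtr0_norm (_ : 0 < q - p)) ?subr_gt0// ler_wpM2r//; first by rewrite subr_ge0 ltW.
  apply/ltW/b1; split; rewrite /ball/=; last exact: lt_le_trans rr1.
  by apply: lt_le_trans rr1; rewrite ltr_norml; apply/andP; split; lra.
move: bx; rewrite /ball/= ltr_norml => /andP[b3 b4].
have fin z : 0 <= z -> z < r -> M * z <= e2.
  by move=> z0 zr; rewrite mulrC -ler_pdivlMr//; apply: le_trans rr3; exact: ltW.
have [xx|xx|xx] := ltgtP x x'.
- by rewrite distrC; apply: (le_trans (lip x x' xx _ _)); [lra|lra|apply: fin; lra].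
- by apply: (le_trans (lip x' x xx _ _)); [lra|lra|apply: fin; lra].
- by rewrite xx subrr normr0 ltW.
Qed.

Lemma within_continuous_comb (X : topologicalType) (A : set X) (f g : X -> R) (p q : R) :
  {within A, continuous f} -> {within A, continuous g} ->
  {within A, continuous (fun z => p * f z + q * g z)}.
Proof.
move=> /subspace_continuousP cf /subspace_continuousP cg.
apply/subspace_continuousP => z Az.
by apply: cvgD; apply: cvgM; [exact: cvg_cst|exact: cf|exact: cvg_cst|exact: cg].
Qed.

Lemma square_integrable_comb d (X : measurableType d) (mu : {measure set X -> \bar R})
    (D : set X) (f g : X -> R) (p q : R) : measurable D ->
  square_integrable mu D f -> square_integrable mu D g ->
  square_integrable mu D (fun z => p * f z + q * g z).
Proof.
move=> mD [mf f2] [mg g2].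
have mc : measurable_fun D (fun z => p * f z + q * g z).
  by apply: measurable_funD; apply: measurable_funM => //; exact: measurable_cst.
split => //.
have i1 := integrableD mD (integrableZl mD (2 * p ^+ 2) f2) (integrableZl mD (2 * q ^+ 2) g2).
apply: le_integrable i1 => //.
  by apply/measurable_EFinP; exact: measurable_funX.
move=> z _ /=; rewrite lee_fin.
rewrite ger0_norm ?sqr_ge0// ger0_norm; last first.
  by rewrite addr_ge0// mulr_ge0 ?sqr_ge0// mulr_ge0 ?sqr_ge0.
have := sqr_ge0 (p * f z - q * g z); nra.
Qed.

Lemma integrable_mul_bounded d (X : measurableType d) (mu : {measure set X -> \bar R})
    (D : set X) (f g : X -> R) (M : R) : measurable D ->
  measurable_fun D f -> mu.-integrable D (EFin \o (fun z => `|f z|)) ->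
  measurable_fun D g -> (forall z, D z -> `|g z| <= M) ->
  mu.-integrable D (EFin \o (fun z => f z * g z)).
Proof.
move=> mD mf fi mg gM.
apply: le_integrable (integrableZl mD M fi) => //.
  by apply/measurable_EFinP; exact: measurable_funM.
move=> z Dz /=; rewrite lee_fin normrM [leRHS]normrM normr_id mulrC.
by rewrite ler_wpM2r// (le_trans (gM z Dz))// ler_norm.
Qed.

Lemma Rintegral_comb2 d (X : measurableType d) (mu : {measure set X -> \bar R})
    (D : set X) (f g : X -> R) (p q : R) : measurable D ->
  mu.-integrable D (EFin \o f) -> mu.-integrable D (EFin \o g) ->
  \int[mu]_(z in D) (p * f z + q * g z) =
  p * \int[mu]_(z in D) f z + q * \int[mu]_(z in D) g z.
Proof.
move=> mD fi gi; rewrite RintegralD//; first by rewrite !RintegralZl.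
- exact: (integrableZl mD p fi).
- exact: (integrableZl mD q gi).
Qed.

Variables (T : R).
Hypothesis T_gt0 : 0 < T.

Lemma within_integrable2 (y v : R * R -> R) :
  {within closed_cylinder T, continuous y} -> continuous v ->
  (lebesgue2 R).-integrable (cylinder T) (EFin \o (fun z => y z * v z)).
Proof.
move=> cy cv.
have cY : continuous (extend2 R T y) by apply: continuous_extend2 => //; exact: ltW.
have cYv : continuous (fun z => extend2 R T y z * v z).
  by move=> z; apply: continuousM; [exact: cY|exact: cv].
apply: eq_integrable (continuous_integrable2 R T _ cYv); first exact: measurable_cylinder.
move=> -[x t] /set_mem[/= /[!in_itv]/= /andP[h1 h2] /andP[h3 h4]].
by rewrite extend2_id ?(ltW h1) ?(ltW h2) ?(ltW h3) ?(ltW h4).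
Qed.

Lemma square_integrable_mul2 (g v : R * R -> R) :
  square_integrable (lebesgue2 R) (cylinder T) g -> continuous v ->
  (lebesgue2 R).-integrable (cylinder T) (EFin \o (fun z => g z * v z)).
Proof.
move=> gs cv; have [M M0 vM] := bounded_closed_cylinder R T v cv.
apply: (integrable_mul_bounded _ _ _ _ _ _ M).
- exact: measurable_cylinder.
- by case: gs.
- apply: square_integrable_integrable => //; first exact: measurable_cylinder.
  exact: lebesgue2_cylinder_lty.
- exact: measurable_funS (continuous_measurable2 R v cv).
- by move=> z /cylinder_closed /vM.
Qed.

Lemma weak_dx_comb (y1 y2 g1 g2 : R * R -> R) (p q : R) :
  {within closed_cylinder T, continuous y1} -> {within closed_cylinder T, continuous y2} ->
  weak_dx T y1 g1 -> weak_dx T y2 g2 ->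
  weak_dx T (fun z => p * y1 z + q * y2 z) (fun z => p * g1 z + q * g2 z).
Proof.
move=> cy1 cy2 [s1 w1] [s2 w2]; split.
  by apply: square_integrable_comb => //; exact: measurable_cylinder.
move=> psi psiC1 psis; have cpsi := C1_continuous _ psiC1.
have cdx : continuous (dx psi) by case: psiC1.
have mC := measurable_cylinder R T.
have -> : \int[lebesgue2 R]_(z in cylinder T) ((p * y1 z + q * y2 z) * dx psi z) =
    \int[lebesgue2 R]_(z in cylinder T) (p * (y1 z * dx psi z) + q * (y2 z * dx psi z)).
  by apply: eq_Rintegral => z _; ring.
have -> : \int[lebesgue2 R]_(z in cylinder T) ((p * g1 z + q * g2 z) * psi z) =
    \int[lebesgue2 R]_(z in cylinder T) (p * (g1 z * psi z) + q * (g2 z * psi z)).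
  by apply: eq_Rintegral => z _; ring.
rewrite (Rintegral_comb2 _ _ _ _ _ _ p q mC (within_integrable2 _ _ cy1 cdx) (within_integrable2 _ _ cy2 cdx)).
rewrite (Rintegral_comb2 _ _ _ _ _ _ p q mC (square_integrable_mul2 _ _ s1 cpsi) (square_integrable_mul2 _ _ s2 cpsi)).
by rewrite w1// w2//; ring.
Qed.

Lemma square_integrable_oo (u : R -> R) : square_integrable leb `[0, T] u ->
  square_integrable leb `]0, T[ u.
Proof.
move=> [mu_ u2]; split.
  by apply: measurable_funS mu_ => //; exact: subset_itv_oo_cc.
by apply: integrableS u2 => //; exact: subset_itv_oo_cc.
Qed.

Lemma lebesgue_oo_lty : (leb `]0%R, T[%classic < +oo)%E.
Proof. by rewrite lebesgue_measure_itv/=; case: ifP => _; rewrite -?EFinB ltry. Qed.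

Lemma square_integrable_abs (u : R -> R) : square_integrable leb `[0, T] u ->
  leb.-integrable `]0, T[ (EFin \o (fun t => `|u t|)).
Proof.
move=> /square_integrable_oo us; apply: square_integrable_integrable => //.
exact: lebesgue_oo_lty.
Qed.

Lemma square_integrable_mul1 (u v : R -> R) : square_integrable leb `[0, T] u ->
  continuous v -> leb.-integrable `]0, T[ (EFin \o (fun t => u t * v t)).
Proof.
move=> us cv.
have [M M0 vM] := bounded_closed_cylinder R T _ (continuous_prodE R (fun=> 1) v (fun=> cvg_cst _) cv).
apply: (integrable_mul_bounded _ _ _ _ _ _ M) => //.
- by case: (square_integrable_oo _ us).
- exact: square_integrable_abs.
- exact: measurable_funS (continuous_measurable_fun cv).
- move=> t; rewrite /= in_itv/= => /andP[t0 tT].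
  have := vM (0, t); rewrite /= mul1r; apply.
  by split; rewrite /= in_itv/= ?lexx ?ler01 ?(ltW t0) ?(ltW tT).
Qed.

(** This supplies an explicit state for the competitor (1 - s) ubar + s u in (P_0). *)
Lemma weak_state_comb alpha (u1 u2 : R -> R) (y1 y2 : R * R -> R) (p q : R) :
  square_integrable leb `[0, T] u1 -> square_integrable leb `[0, T] u2 ->
  weak_state T alpha u1 y1 -> weak_state T alpha u2 y2 ->
  weak_state T alpha (fun t => p * u1 t + q * u2 t) (fun z => p * y1 z + q * y2 z).
Proof.
move=> su1 su2 [cy1 [g1 wg1 w1]] [cy2 [g2 wg2 w2]]; split.
  exact: within_continuous_comb.
exists (fun z => p * g1 z + q * g2 z); first exact: weak_dx_comb.
move=> v vC1 vT; have cv := C1_continuous _ vC1.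
have [cdx cdt] : continuous (dx v) /\ continuous (dt v) by case: vC1.
have mC := measurable_cylinder R T.
have mI : measurable (`]0, T[%classic : set (measurableTypeR R)) by exact: measurable_itv.
have cv1 : continuous (fun t => v (1, t)) by exact: continuous_slice2.
have [[sg1 _] [sg2 _]] := (wg1, wg2).
have yi (y : R * R -> R) : {within closed_cylinder T, continuous y} ->
    leb.-integrable `]0, T[ (EFin \o (fun t => y (1, t) * v (1, t))).
  move=> cy; have cY : continuous (extend2 R T y) by apply: continuous_extend2 => //; exact: ltW.
  have cYv : continuous (fun t => extend2 R T y (1, t) * v (1, t)).
    by apply: continuous_mulE => //; exact: continuous_slice2.
  apply: eq_integrable (continuous_integrable_oo R _ 0 T cYv) => // t /set_mem/=.
  rewrite in_itv/= => /andP[t0 tT].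
  by rewrite extend2_id ?lexx ?ler01 ?(ltW t0) ?(ltW tT).
have -> : \int[lebesgue2 R]_(z in cylinder T) ((p * y1 z + q * y2 z) * dt v z) =
    p * \int[lebesgue2 R]_(z in cylinder T) (y1 z * dt v z) +
    q * \int[lebesgue2 R]_(z in cylinder T) (y2 z * dt v z).
  transitivity (\int[lebesgue2 R]_(z in cylinder T) (p * (y1 z * dt v z) + q * (y2 z * dt v z))).
    by apply: eq_Rintegral => z _; ring.
  by apply: Rintegral_comb2 => //; exact: within_integrable2.
have -> : \int[lebesgue2 R]_(z in cylinder T) ((p * g1 z + q * g2 z) * dx v z) =
    p * \int[lebesgue2 R]_(z in cylinder T) (g1 z * dx v z) +
    q * \int[lebesgue2 R]_(z in cylinder T) (g2 z * dx v z).
  transitivity (\int[lebesgue2 R]_(z in cylinder T) (p * (g1 z * dx v z) + q * (g2 z * dx v z))).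
    by apply: eq_Rintegral => z _; ring.
  by apply: Rintegral_comb2 => //; exact: square_integrable_mul2.
have -> : \int[leb]_(t in `]0, T[) ((p * y1 (1, t) + q * y2 (1, t)) * v (1, t)) =
    p * \int[leb]_(t in `]0, T[) (y1 (1, t) * v (1, t)) +
    q * \int[leb]_(t in `]0, T[) (y2 (1, t) * v (1, t)).
  transitivity (\int[leb]_(t in `]0, T[) (p * (y1 (1, t) * v (1, t)) + q * (y2 (1, t) * v (1, t)))).
    by apply: eq_Rintegral => z _; ring.
  by apply: Rintegral_comb2 => //; exact: yi.
have -> : \int[leb]_(t in `]0, T[) ((p * u1 t + q * u2 t) * v (1, t)) =
    p * \int[leb]_(t in `]0, T[) (u1 t * v (1, t)) +
    q * \int[leb]_(t in `]0, T[) (u2 t * v (1, t)).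
  transitivity (\int[leb]_(t in `]0, T[) (p * (u1 t * v (1, t)) + q * (u2 t * v (1, t)))).
    by apply: eq_Rintegral => z _; ring.
  by apply: Rintegral_comb2 => //; exact: square_integrable_mul1.
have comb (a1 a2 b1 b2 c1 c2 d1 d2 : R) : - a1 + b1 + alpha * c1 = d1 ->
    - a2 + b2 + alpha * c2 = d2 ->
    - (p * a1 + q * a2) + (p * b1 + q * b2) + alpha * (p * c1 + q * c2) = p * d1 + q * d2.
  by move=> <- <-; ring.
exact: comb (w1 v vC1 vT) (w2 v vC1 vT).
Qed.

Lemma admissible_comb a b (u1 u2 : R -> R) (p q : R) : 0 <= p -> 0 <= q -> p + q = 1 ->
  admissible T a b u1 -> admissible T a b u2 ->
  admissible T a b (fun t => p * u1 t + q * u2 t).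
Proof.
move=> p0 q0 pq [s1 ab1] [s2 ab2]; split.
  by apply: square_integrable_comb.
apply: (@filterS2 _ _ (ae_filter_ringOfSetsType _) _ _ _ _ ab1 ab2) => t h1 h2 tI.
have /andP[a1 b1] := h1 tI; have /andP[a2 b2] := h2 tI.
have := ler_wpM2l p0 a1; have := ler_wpM2l q0 a2.
have := ler_wpM2l p0 b1; have := ler_wpM2l q0 b2 => k1 k2 k3 k4.
have ea : a = p * a + q * a by rewrite -mulrDl pq mul1r.
have eb : b = p * b + q * b by rewrite -mulrDl pq mul1r.
by apply/andP; split; lra.
Qed.

End convex_combinations.

(** * Variational inequality and the square-root estimate *)

Section optimality.
Variables (R : realType) (T alpha mu a b : R) (yO : R -> R).
Hypotheses (T_gt0 : 0 < T) (mu_gt0 : 0 < mu).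
Hypothesis yO_cont : {within `[0, 1], continuous yO}.
Notation leb := (@lebesgue_measure R).

Lemma within_trace (y : R * R -> R) : {within closed_cylinder T, continuous y} ->
  continuous (fun x => y (clamp R 0 1 x, T)).
Proof.
move=> cy; have cY : continuous (extend2 R T y) by apply: continuous_extend2 => //; exact: ltW.
have -> : (fun x => y (clamp R 0 1 x, T)) = (fun x => extend2 R T y (x, T)).
  by apply/funext => x; rewrite /extend2/= (clamp_id R 0 T T) ?lexx ?ltW.
exact: continuous_slice.
Qed.

(** In the direction u - ubar, optimality for (P_0) gives B + mu (U1 - U0) >= 0; the nonsmooth L^1
    term enters through the convexity of the absolute value. Comparing u with ubar in (P_nu) gives B
    + C / 2 + mu (U1 - U0) <= nu (V0 - V1) / 2. Together they yield C <= nu V0, where C is the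
    squared distance of the final states. *)
Lemma optimal_state_bound (nu : R) (ubar u : R -> R) (ybar y : R * R -> R) : 0 < nu ->
  optimal T alpha mu a b yO 0 ubar ybar -> optimal T alpha mu a b yO nu u y ->
  L2norm01 (fun x => y (x, T) - ybar (x, T)) <=
  Num.sqrt (\int[leb]_(t in `]0, T[) (`|ubar t| ^+ 2)) * Num.sqrt nu.
Proof.
move=> nu0 [adb wsb optb] [ad ws opt].
have cyb := ws; have [cy _] := ws; have [cyb' _] := wsb.
pose cl := clamp R 0 1.
have cE0 := within_trace _ cy; have cB0 := within_trace _ cyb'.
have cO : continuous (fun x => yO (cl x)) by exact: continuous_clampE.
pose D x := ybar (cl x, T) - yO (cl x).
pose E x := y (cl x, T) - ybar (cl x, T).
have cD : continuous D by exact: continuous_subE.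
have cE : continuous E by exact: continuous_subE.
set A := \int[leb]_(x in `]0, 1[) (D x ^+ 2).
set B := \int[leb]_(x in `]0, 1[) (D x * E x).
set C := \int[leb]_(x in `]0, 1[) (E x ^+ 2).
set U0 := \int[leb]_(t in `]0, T[) `|ubar t|.
set U1 := \int[leb]_(t in `]0, T[) `|u t|.
set V0 := \int[leb]_(t in `]0, T[) (`|ubar t| ^+ 2).
set V1 := \int[leb]_(t in `]0, T[) (`|u t| ^+ 2).
have V1_ge0 : 0 <= V1 by apply: Rintegral_ge0 => t _; exact: sqr_ge0.
have C_ge0 : 0 <= C by apply: Rintegral_ge0 => t _; exact: sqr_ge0.
have V0_ge0 : 0 <= V0 by apply: Rintegral_ge0 => t _; exact: sqr_ge0.
have track s : \int[leb]_(x in `]0, 1[) (`|(1 - s) * ybar (x, T) + s * y (x, T) - yO x| ^+ 2) =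
    A + 2 * s * B + s ^+ 2 * C.
  have c1 := continuous_scaleE R (2 * s) _ (continuous_mulE R _ _ cD cE).
  have c2 := continuous_scaleE R (s ^+ 2) _ (continuous_sqrE R _ cE).
  have c3 := continuous_addE R _ _ (continuous_sqrE R _ cD) c1.
  transitivity (\int[leb]_(x in `]0, 1[) (D x ^+ 2 + 2 * s * (D x * E x) + s ^+ 2 * E x ^+ 2)).
    apply: eq_Rintegral => x /set_mem/=; rewrite in_itv/= => /andP[x0 x1].
    rewrite /D /E /cl clamp_id ?(ltW x0) ?(ltW x1)//.
    by rewrite real_normK ?num_real//; ring.
  rewrite Rintegral_ooD// Rintegral_ooD//; last exact: continuous_sqrE.
  rewrite Rintegral_ooZ; last exact: continuous_mulE.
  by rewrite Rintegral_ooZ//; exact: continuous_sqrE.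
have cost0 c w z : cost T mu c yO w z =
    2^-1 * (\int[leb]_(x in `]0, 1[) (`|z (x, T) - yO x| ^+ 2)) +
    c / 2 * (\int[leb]_(t in `]0, T[) (`|w t| ^+ 2)) + mu * (\int[leb]_(t in `]0, T[) `|w t|) by [].
have t0 : \int[leb]_(x in `]0, 1[) (`|ybar (x, T) - yO x| ^+ 2) = A.
  transitivity (A + 2 * 0 * B + 0 ^+ 2 * C); last by rewrite mulr0 expr0n/= !mul0r !addr0.
  rewrite -track; apply: eq_Rintegral => x _; congr (`|_ - _| ^+ 2).
  by rewrite subr0 mul1r mul0r addr0.
have t1 : \int[leb]_(x in `]0, 1[) (`|y (x, T) - yO x| ^+ 2) = A + 2 * B + C.
  transitivity (A + 2 * 1 * B + 1 ^+ 2 * C); last by rewrite mulr1 expr1n mul1r.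
  rewrite -track; apply: eq_Rintegral => x _; congr (`|_ - _| ^+ 2).
  by rewrite subrr mul0r mul1r add0r.
have i0 := square_integrable_abs R T _ adb.1.
have i1 := square_integrable_abs R T _ ad.1.
have key s : 0 < s < 1 -> 0 <= B + s / 2 * C + mu * (U1 - U0).
  move=> /andP[s0 s1].
  have s1' : 0 <= 1 - s by rewrite subr_ge0 ltW.
  have adw := admissible_comb R T a b ubar u (1 - s) s s1' (ltW s0) (subrK _ _) adb ad.
  have wsw := weak_state_comb R T T_gt0 alpha ubar u ybar y (1 - s) s adb.1 ad.1 wsb ws.
  have := optb _ _ adw wsw; rewrite !cost0 t0 track !mul0r !addr0 -/U0.
  have : \int[leb]_(t in `]0, T[) `|(1 - s) * ubar t + s * u t| <= (1 - s) * U0 + s * U1.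
    rewrite /U0 /U1 -Rintegral_comb2//; apply: le_Rintegral => //.
    - exact: square_integrable_abs adw.1.
    - exact: (integrableD _ (integrableZl _ (1 - s) i0) (integrableZl _ s i1)).
    - move=> t _; apply: (le_trans (ler_normD _ _)).
      by rewrite !normrM (ger0_norm s1') (gtr0_norm s0).
  move/(ler_wpM2l (ltW mu_gt0)); set W := Rintegral _ _ _ => h1 h2.
  have : 0 <= s * (B + s / 2 * C + mu * (U1 - U0)) by lra.
  by rewrite pmulr_rge0.
have key0 : 0 <= B + mu * (U1 - U0).
  rewrite leNgt; apply/negP => neg; set X := B + _ in neg.
  (* For this [s] the quadratic term s C / 2 is at most - X / 2, too small to compensate the
     negative [X]. *)
  pose s := Num.min 2^-1 (- X / (C + 1)).
  have C1 : 0 < C + 1 by rewrite ltr_wpDl.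
  have s0 : 0 < s by rewrite lt_min invr_gt0 ltr0n/= divr_gt0// oppr_gt0.
  have s2 : s <= 2^-1 by rewrite ge_min lexx.
  have sC : s * (C + 1) <= - X by rewrite -ler_pdivlMr// ge_min lexx orbT.
  have := key s; rewrite s0 => /(_ (ltac:(lra) : s < 1)).
  have : 0 <= s * C by rewrite mulr_ge0// ltW.
  by rewrite addrAC -/X; nra.
have := opt _ _ adb wsb; rewrite !cost0 t0 t1 -/U0 -/U1 -/V0 -/V1 => h.
have CV : C <= nu * V0.
  have : 0 <= nu * V1 by rewrite mulr_ge0// ltW.
  lra.
rewrite -sqrtrM// mulrC; apply: ler_wsqrtr; apply: le_trans CV.
rewrite le_eqVlt; apply/orP; left; apply/eqP; apply: eq_Rintegral => x /set_mem/=.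
rewrite in_itv/= => /andP[x0 x1].
by rewrite /E /cl clamp_id ?(ltW x0) ?(ltW x1).
Qed.

End optimality.

(** * The theorem *)

Section assembly.
Variables (R : realType) (T alpha mu a b : R) (yO : R -> R).
Hypotheses (T_gt0 : 0 < T) (alpha_gt0 : 0 < alpha) (mu_gt0 : 0 < mu).
Hypothesis yO_cont : {within `[0, 1], continuous yO}.
Notation lam := (robin_eigenvalue R alpha alpha_gt0).
Notation S := (dirichlet_series R lam).
Notation cf yO y := (trace_coef R T alpha yO y alpha_gt0).

Lemma within_trace_sub (y : R * R -> R) (z : R -> R) :
  {within closed_cylinder T, continuous y} -> {within `[0, 1], continuous z} ->
  {within `[0, 1], continuous (fun x => y (x, T) - z x)}.
Proof.
move=> cy cz.
have cd : continuous (fun x => y (clamp R 0 1 x, T) - z (clamp R 0 1 x)).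
  apply: continuous_subE; first exact: within_trace.
  exact: continuous_clampE.
apply: (@subspace_eq_continuous _ _ _ (fun x => y (clamp R 0 1 x, T) - z (clamp R 0 1 x))).
  by move=> x /set_mem/=; rewrite in_itv/= => xI; rewrite clamp_id.
exact: continuous_subspaceT.
Qed.

Lemma within_trace0 (y : R * R -> R) : {within closed_cylinder T, continuous y} ->
  {within `[0, 1], continuous (fun x => y (x, T))}.
Proof.
move=> cy; apply: (@subspace_eq_continuous _ _ _ (fun x => y (clamp R 0 1 x, T))).
  by move=> x /set_mem/=; rewrite in_itv/= => xI; rewrite clamp_id.
by apply: continuous_subspaceT; exact: within_trace.
Qed.

(** The index is [k.+1] because the trace itself is already the first derivative of the mean. The
    chain is determined by the state, and [sg] serves both cases of the theorem. *)
Definition trace_chain (sg : R) (y : R * R -> R) (k : nat) (t : R) : R :=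
  sg * (alpha^-1 * S (cf yO y) k.+1 (T - t)).

Lemma trace_chain_derivative (sg : R) (y : R * R -> R) : {within closed_cylinder T, continuous y} ->
  derivative_chain R (trace_chain sg y) 0 T.
Proof.
move=> cy k t; rewrite in_itv/= => /andP[_ tT].
apply/is_derive_scaleE/is_derive_scaleE.
apply: is_derive_dirichlet_series tT (trace_coef_bound _ _ _ _ _ _ _).
  exact: robin_eigenvalue_ge.
exact: within_trace_sub.
Qed.

Lemma trace_chain0 (sg : R) (y phi : R * R -> R) t : {within closed_cylinder T, continuous y} ->
  weak_adjoint T alpha yO y phi -> t \in `]0, T[ ->
  trace_chain sg y 0 t = sg * phi (1, t).
Proof.
move=> cy wa tI; rewrite /trace_chain; congr (_ * _).
rewrite -(adjoint_trace R T alpha yO y phi T_gt0 alpha_gt0 (within_trace_sub _ _ cy yO_cont) wa t tI).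
by rewrite mulKf// gt_eqF.
Qed.

Lemma trace_chain_derive1n (y phi : R * R -> R) k t : {within closed_cylinder T, continuous y} ->
  weak_adjoint T alpha yO y phi -> t \in `]0, T[ ->
  derive1n k (fun s => phi (1, s)) t = trace_chain 1 y k t.
Proof.
move=> cy wa; elim: k t => [|k IHk] t tI; first by rewrite (trace_chain0 1 _ phi)// mul1r.
rewrite derive1nS derive1E.
have /(_ k t tI) dk := trace_chain_derivative 1 y cy.
have : is_derive t 1 (derive1n k (fun s => phi (1, s))) (trace_chain 1 y k.+1 t).
  apply: near_eq_is_derive dk.
  have : \forall s \near t, s \in `]0, T[ by exact: near_in_itvoo.
  by apply: filterS => s sI; rewrite IHk.
by case.
Qed.

Lemma trace_chain_close (sg : R) (y z : R * R -> R) k (r : R) : `|sg| = 1 -> r < T ->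
  {within closed_cylinder T, continuous y} -> {within closed_cylinder T, continuous z} ->
  forall t, t <= r -> `|trace_chain sg y k t - trace_chain sg z k t| <=
  alpha^-1 * (2 * dirichlet_bound R k.+1 (T - r)) * L2norm01 (fun x => y (x, T) - z (x, T)).
Proof.
move=> sg1 rT cy cz t tr.
have s0 : 0 < T - t by rewrite subr_gt0 (le_lt_trans tr).
have r0 : 0 < T - r by rewrite subr_gt0.
have rs : T - r <= T - t by rewrite lerD2l lerN2.
have cyO := within_trace_sub _ _ cy yO_cont; have czO := within_trace_sub _ _ cz yO_cont.
have cyz := within_trace_sub _ _ cy (within_trace0 _ cz).
rewrite /trace_chain -mulrBr normrM sg1 mul1r -mulrBr normrM gtr0_norm ?invr_gt0//.
rewrite -mulrA ler_wpM2l ?invr_ge0 ?(ltW alpha_gt0)//.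
pose A := Num.max (2 * L2norm01 (fun x => y (x, T) - yO x)) (2 * L2norm01 (fun x => z (x, T) - yO x)).
have bA k' : `|cf yO y k'| <= A.
  by rewrite le_max (trace_coef_bound R T alpha yO y alpha_gt0 cyO).
have bB k' : `|cf yO z k'| <= A.
  by rewrite le_max (trace_coef_bound R T alpha yO z alpha_gt0 czO) orbT.
have lamge := robin_eigenvalue_ge R alpha alpha_gt0.
rewrite -(dirichlet_seriesB R lam lamge _ _ A k.+1 _ s0 bA bB).
(* The coefficients are affine in the final state: their difference is the coefficient for the state
   [y] with the final value of [z] as target, so [trace_coef_bound] applies to it directly. *)
have diff k' : cf yO y k' - cf yO z k' = cf (fun x => z (x, T)) y k'.
  rewrite /trace_coef -mulrBr; congr (_ * _).
  pose e := robin_eigenfun R alpha alpha_gt0 k'.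
  have ce : continuous e by exact: continuous_eigenfun.
  have ci (f : R -> R) : {within `[0, 1], continuous f} ->
      (@lebesgue_measure R).-integrable `]0, 1[ (EFin \o (fun x => f x * e x)).
    move=> cfw; have cc := continuous_mulE R _ _ (continuous_clampE R 0 1 f ler01 cfw) ce.
    apply: eq_integrable (continuous_integrable_oo R _ 0 1 cc) => // x /set_mem/=.
    by rewrite in_itv/= => /andP[? ?]; rewrite clamp_id// !ltW.
  rewrite -RintegralB//; [|exact: ci|exact: ci].
  by apply: eq_Rintegral => x _; rewrite -mulrBl; congr (_ * _); ring.
rewrite (funext diff).
have bd := trace_coef_bound R T alpha (fun x => z (x, T)) y alpha_gt0 cyz.
have [_ h] := dirichlet_series_bound R lam lamge _ _ k.+1 _ _ r0 rs bd.
by apply: (le_trans h); rewrite mulrAC.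
Qed.

Definition near_perturbed (sg nu : R) (ybar : R * R -> R) (P : nat -> R -> R) (E : R) : Prop :=
  exists u y phi, [/\ optimal T alpha mu a b yO nu u y, weak_adjoint T alpha yO y phi,
    E = L2norm01 (fun x => y (x, T) - ybar (x, T)) & P = trace_chain sg y].

End assembly.

Theorem theorem8 (R : realType) (T alpha mu a b : R) (yO : R -> R)
  (T_gt0 : 0 < T) (alpha_gt0 : 0 < alpha) (mu_gt0 : 0 < mu)
  (a_lt0 : a < 0) (b_gt0 : 0 < b)
  (yO_cont : {within `[0, 1], continuous yO})
  (ubar : R -> R) (ybar phibar : R * R -> R)
  (ubar_opt : optimal T alpha mu a b yO 0 ubar ybar)
  (phibar_adj : weak_adjoint T alpha yO ybar phibar)
  (ybar_neq : 0 < L2norm01 (fun x => ybar (x, T) - yO x))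
  (tbar : R) (tbar_in : tbar \in `]0, T[)
  (n : nat) (n_gt0 : (0 < n)%N)
  (n_neq0 : derive1n n (fun t => phibar (1, t)) tbar != 0)
  (n_min : forall k : nat, (0 < k < n)%N ->
     derive1n k (fun t => phibar (1, t)) tbar = 0) :
  (* [e1 nu p], [e2 nu p] are the left-hand sides, as functions of
     p = phi_nu(1,t), of the two equations having solutions near tbar;
     [h1], [h2] those of the two equations having none. *)
  let near_tbar (e1 e2 h1 h2 : R -> R -> R) : Prop :=
    exists nu0 tau : R,
    [/\ 0 < nu0, 0 < tau,
        (forall t, t \in `]tbar - tau, tbar + tau[ -> t \in `]0, T[) &
    [/\ (* (i) *)
        (forall (nu : R) (u : R -> R) (y phi : R * R -> R),
          0 < nu < nu0 ->
          optimal T alpha mu a b yO nu u y -> weak_adjoint T alpha yO y phi ->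
          [/\ [set t | (t \in `]tbar - tau, tbar + tau[) /\
                       e1 nu (phi (1, t)) = 0] #<= `I_n,
              [set t | (t \in `]tbar - tau, tbar + tau[) /\
                       e2 nu (phi (1, t)) = 0] #<= `I_n &
              forall t, t \in `]tbar - tau, tbar + tau[ ->
                h1 nu (phi (1, t)) <> 0 /\ h2 nu (phi (1, t)) <> 0]),
        (* (ii) *)
        (exists2 c : R, 0 < c &
          forall (nu : R) (u : R -> R) (y phi : R * R -> R) (t : R),
          0 < nu < nu0 ->
          optimal T alpha mu a b yO nu u y -> weak_adjoint T alpha yO y phi ->
          t \in `]tbar - tau, tbar + tau[ ->
          e1 nu (phi (1, t)) = 0 \/ e2 nu (phi (1, t)) = 0 ->
          `|tbar - t| <= c * nu `^ ((2 * n)%:R^-1) /\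
          `|tbar - t| <=
            c * (L2norm01 (fun x => y (x, T) - ybar (x, T)) `^ (n%:R^-1)
                 + nu `^ (n%:R^-1))) &
        (* (iii) *)
        (switching_point0 T mu phibar tbar -> odd n) /\
        (odd n ->
          exists2 nu1 : R, 0 < nu1 < nu0 &
          forall (nu : R) (u : R -> R) (y phi : R * R -> R),
          0 < nu < nu1 ->
          optimal T alpha mu a b yO nu u y -> weak_adjoint T alpha yO y phi ->
          exists t : R,
          [/\ t \in `]tbar - tau, tbar + tau[,
              switching_point T mu a b nu phi t &
              e1 nu (phi (1, t)) = 0 \/ e2 nu (phi (1, t)) = 0])]] in
  (phibar (1, tbar) = mu ->
     near_tbar (fun nu p => p - mu) (fun nu p => p - mu + nu * a)
               (fun nu p => p + mu + nu * b) (fun nu p => p + mu)) /\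
  (phibar (1, tbar) = - mu ->
     near_tbar (fun nu p => p + mu) (fun nu p => p + mu + nu * b)
               (fun nu p => p - mu) (fun nu p => p - mu + nu * a)).
Proof.
pose leb := @lebesgue_measure R.
have [adb wsb optb] := ubar_opt; have [cyb _] := wsb.
pose K : R := Num.sqrt (\int[leb]_(t in `]0, T[) (`|ubar t| ^+ 2)).
(* [sg] normalises the value at [tbar] to + mu. Only the shifts [a'] and [b'] in the equations are
   reflected; optimality keeps the original bounds [a] and [b]. *)
have core (sg a' b' : R) : sg = 1 \/ sg = -1 -> sg * phibar (1, tbar) = mu ->
  exists nu0 tau : R,
  [/\ 0 < nu0, 0 < tau,
      (forall t, t \in `]tbar - tau, tbar + tau[ -> t \in `]0, T[) &
  [/\ (forall (nu : R) (u : R -> R) (y phi : R * R -> R), 0 < nu < nu0 ->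
        optimal T alpha mu a b yO nu u y -> weak_adjoint T alpha yO y phi ->
        [/\ [set t | (t \in `]tbar - tau, tbar + tau[) /\ sg * phi (1, t) - mu = 0] #<= `I_n,
            [set t | (t \in `]tbar - tau, tbar + tau[) /\
              sg * phi (1, t) - mu + nu * a' = 0] #<= `I_n &
            forall t, t \in `]tbar - tau, tbar + tau[ ->
              sg * phi (1, t) + mu + nu * b' <> 0 /\ sg * phi (1, t) + mu <> 0]),
      (exists2 c, 0 < c & forall (nu : R) (u : R -> R) (y phi : R * R -> R) (t : R),
        0 < nu < nu0 ->
        optimal T alpha mu a b yO nu u y -> weak_adjoint T alpha yO y phi ->
        t \in `]tbar - tau, tbar + tau[ ->
        sg * phi (1, t) - mu = 0 \/ sg * phi (1, t) - mu + nu * a' = 0 ->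
        `|tbar - t| <= c * nu `^ ((2 * n)%:R^-1) /\
        `|tbar - t| <= c * (L2norm01 (fun x => y (x, T) - ybar (x, T)) `^ (n%:R^-1)
                            + nu `^ (n%:R^-1))),
      ((changes_sign (fun s => sg * phibar (1, s) - mu) tbar \/
        changes_sign (fun s => sg * phibar (1, s) + mu) tbar) -> odd n) &
      (odd n -> exists2 nu1 : R, 0 < nu1 < nu0 &
        forall (nu : R) (u : R -> R) (y phi : R * R -> R), 0 < nu < nu1 ->
        optimal T alpha mu a b yO nu u y -> weak_adjoint T alpha yO y phi ->
        exists t : R, [/\ t \in `]tbar - tau, tbar + tau[,
          changes_sign (fun s => sg * phi (1, s) - mu) t & sg * phi (1, t) - mu = 0])]].
  move=> sgE sgmu.
  have sg1 : `|sg| = 1 by case: sgE => ->; rewrite ?normrN normr1.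
  have sgn0 : sg != 0 by rewrite -normr_gt0 sg1.
  pose F := trace_chain R T alpha yO alpha_gt0 sg ybar.
  have FE k t : F k t = sg * trace_chain R T alpha yO alpha_gt0 1 ybar k t.
    by rewrite /F /trace_chain mul1r.
  have F1 k : F k tbar = sg * derive1n k (fun t => phibar (1, t)) tbar.
    by rewrite FE (trace_chain_derive1n R T alpha yO T_gt0 alpha_gt0 yO_cont ybar phibar).
  pose Adm nu P E := near_perturbed R T alpha mu a b yO alpha_gt0 sg nu ybar P E.
  have cont nu u y : optimal T alpha mu a b yO nu u y -> {within closed_cylinder T, continuous y}.
    by case=> _ [].
  have [||||||nu0 [tau [nu00 tau0 sub [p1 p2 p3 p4]]]] :=
    perturbed_zeros R T mu tbar a' b' K n F Adm mu_gt0 tbar_in n_gt0 (sqrtr_ge0 _).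
  - exact: trace_chain_derivative.
  - by rewrite F1.
  - by move=> k kn; rewrite F1 n_min// mulr0.
  - by rewrite F1 mulf_neq0.
  - move=> nu P E nu_gt0 [u [y [phi [ou wa -> ->]]]]; split.
    + exact/trace_chain_derivative/(cont _ _ _ ou).
    + exact: sqrtr_ge0.
    + exact: (optimal_state_bound R T alpha mu a b yO T_gt0 mu_gt0 yO_cont nu ubar u).
  - move=> k l r _ rT; exists (alpha^-1 * (2 * dirichlet_bound R k.+1 (T - r))).
      apply: mulr_ge0; first by rewrite invr_ge0 ltW.
      by apply: mulr_ge0 => //; apply: dirichlet_bound_ge0; rewrite subr_gt0.
    move=> nu P E nu_gt0 [u [y [phi [ou wa -> ->]]]] t; rewrite in_itv/= => /andP[_ tr].
    by apply: trace_chain_close => //; exact: (cont _ _ _ ou).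
  have toP nu u y phi : optimal T alpha mu a b yO nu u y -> weak_adjoint T alpha yO y phi ->
      Adm nu (trace_chain R T alpha yO alpha_gt0 sg y) (L2norm01 (fun x => y (x, T) - ybar (x, T))).
    by move=> ou wa; exists u, y, phi.
  have PE nu u y phi t : optimal T alpha mu a b yO nu u y -> weak_adjoint T alpha yO y phi ->
      t \in `]tbar - tau, tbar + tau[ ->
      trace_chain R T alpha yO alpha_gt0 sg y 0 t = sg * phi (1, t).
    by move=> ou wa /sub tI; apply: trace_chain0 => //; exact: (cont _ _ _ ou).
  exists nu0, tau; split => //; split.
  - move=> nu u y phi nuI ou wa.
    have [h1 h2 h3] := p1 nu _ _ nuI (toP _ _ _ _ ou wa).
    split.
    + apply: card_le_trans h1; apply: subset_card_le => t [tI e1].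
      by split => //; rewrite (PE _ _ _ _ _ ou wa).
    + apply: card_le_trans h2; apply: subset_card_le => t [tI e1].
      by split => //; rewrite (PE _ _ _ _ _ ou wa).
    + by move=> t tI; rewrite -(PE _ _ _ _ _ ou wa tI); exact: h3.
  - have [c c0 h] := p2; exists c => // nu u y phi t nuI ou wa tI.
    rewrite -(PE _ _ _ _ _ ou wa tI) => e1.
    exact: h nuI (toP _ _ _ _ ou wa) tI e1.
  - have F0 s : s \in `]0, T[ -> sg * phibar (1, s) = F 0%N s.
      by move=> sI; rewrite /F (trace_chain0 _ _ _ _ _ _ _ _ _ phibar).
    by move=> [h|h]; apply: p3; [left|right]; apply: changes_sign_eq tbar_in _ h => s /F0 ->.
  - move=> on; have [nu1 nu1I h] := p4 on; exists nu1 => // nu u y phi nuI ou wa.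
    have [t [tI ct Pt]] := h nu _ _ nuI (toP _ _ _ _ ou wa).
    exists t; split => //; last by rewrite -(PE _ _ _ _ _ ou wa tI).
    by apply: changes_sign_eq tI _ ct => s sI; rewrite (PE _ _ _ _ _ ou wa).
split => ptb.
  have [|nu0 [tau [nu00 tau0 sub [p1 p2 p3 p4]]]] := core 1 a b (or_introl erefl).
    by rewrite mul1r.
  exists nu0, tau; split => //; split.
  - move=> nu u y phi nuI ou wa; have [h1 h2 h3] := p1 nu u y phi nuI ou wa.
    split.
    + by apply: card_le_trans h1; apply: subset_card_le => t /=; rewrite mul1r.
    + by apply: card_le_trans h2; apply: subset_card_le => t /=; rewrite mul1r.
    + by move=> t /h3; rewrite mul1r.
  - have [c c0 h] := p2; exists c => // nu u y phi t nuI ou wa tI e1.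
    by apply: (h nu u y phi t nuI ou wa tI); rewrite mul1r.
  - split.
      move=> [_ [h|h]]; apply: p3; [left|right]; move: h; congr changes_sign;
        by apply/funext => s; rewrite mul1r.
    move=> /p4[nu1 nu1I h]; exists nu1 => // nu u y phi nuI ou wa.
    have [t [tI ct e1]] := h nu u y phi nuI ou wa.
    exists t; split => //; last by left; rewrite mul1r in e1.
    split; first exact: sub.
    by apply: Or43; move: ct; congr changes_sign; apply/funext => s; rewrite mul1r.
(* After negation the equations match up to sign: the shift [- b] belongs to the equation with nu b,
   and the two excluded equations exchange places. *)
have [|nu0 [tau [nu00 tau0 sub [p1 p2 p3 p4]]]] := core (-1) (- b) (- a) (or_intror erefl).
  by rewrite ptb mulN1r opprK.
have n1 p : -1 * p - mu = - (p + mu) by ring.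
have n2 nu p : -1 * p - mu + nu * - b = - (p + mu + nu * b) by ring.
have n3 nu p : -1 * p + mu + nu * - a = - (p - mu + nu * a) by ring.
have n4 p : -1 * p + mu = - (p - mu) by ring.
exists nu0, tau; split => //; split.
- move=> nu u y phi nuI ou wa; have [h1 h2 h3] := p1 nu u y phi nuI ou wa.
  split.
  + apply: card_le_trans h1; apply: subset_card_le => t [tI e1].
    by split => //; rewrite n1 e1 oppr0.
  + apply: card_le_trans h2; apply: subset_card_le => t [tI e1].
    by split => //; rewrite n2 e1 oppr0.
  + move=> t tI; have [h4 h5] := h3 t tI; split => e1.
      by apply: h5; rewrite n4 e1 oppr0.
    by apply: h4; rewrite n3 e1 oppr0.
- have [c c0 h] := p2; exists c => // nu u y phi t nuI ou wa tI e1.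
  apply: (h nu u y phi t nuI ou wa tI); rewrite n2 n1.
  by case: e1 => ->; rewrite oppr0; [left|right].
- have chN (f g : R -> R) t : (forall s, f s = - g s) -> changes_sign f t <-> changes_sign g t.
    move=> fg; split => -[e e0 h]; exists e => // r s rI sI; have := h r s rI sI.
      by rewrite !fg mulrNN.
    by rewrite !fg mulrNN.
  split.
    move=> [_ [h|h]]; apply: p3; [right|left].
      by apply/(chN _ (fun s => phibar (1, s) - mu)) => // s; exact: n4.
    by apply/(chN _ (fun s => phibar (1, s) + mu)) => // s; exact: n1.
  move=> /p4[nu1 nu1I h]; exists nu1 => // nu u y phi nuI ou wa.
  have [t [tI ct e1]] := h nu u y phi nuI ou wa.
  exists t; split => //; last by left; move/eqP: e1; rewrite n1 oppr_eq0 => /eqP.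
  split; first exact: sub.
  by apply: Or42; apply/(chN (fun s => -1 * phi (1, s) - mu)) => // s; exact: n1.
Qed.
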